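(* Let $\boldsymbol f\in \boldsymbol L_2(\Omega)$ and $\gamma\ge 0$ (with $\gamma>0$ if $d=3$). Let $\mathfrak U_h\subset\mathfrak U$ be a finite-dimensional subspace. Then the variational problem $$\text{(VF)}\qquad \mathfrak u=(\boldsymbol u,\boldsymbol P,\widehat{\boldsymbol u},\widehat{\boldsymbol p})\in\mathfrak U:\quad b(\mathfrak u,\mathfrak v)=L(\mathfrak v)\quad\forall \mathfrak v\in\mathfrak V$$ and the DPG scheme $$\text{(DPG)}\qquad \mathfrak u_h\in\mathfrak U_h:\quad b(\mathfrak u_h,\mathfrak v)=L(\mathfrak v)\quad\forall\mathfrak v\in\mathfrak T(\mathfrak U_h)$$ are well posed (each has a unique solution), and their respective solutions $\mathfrak u=(\boldsymbol u,\boldsymbol P,\widehat{\boldsymbol u},\widehat{\boldsymbol p})\in\mathfrak U$ and $\mathfrak u_h\in\mathfrak U_h$ satisfy $$\|\mathfrak u\|_{\mathfrak U}\le C\|\boldsymbol f\|\qquad\text{and}\qquad \|\mathfrak u-\mathfrak u_h\|_{\mathfrak U}\le C\inf\{\|\mathfrak u-\mathfrak w\|_{\mathfrak U};\ \mathfrak w\in\mathfrak U_h\}$$ with a constant $C>0$ that is independent of $\boldsymbol f$, $\mathcal T$ and $\mathfrak U_h$. Furthermore, $\boldsymbol u\in\boldsymbol H_0(\boldsymbol\nabla\mathbf{curl},\Omega)$, $\boldsymbol P=-\boldsymbol\nabla\mathbf{curl}\,\boldsymbol u\in\mathbb H(\mathbf{curl}^*\boldsymbol\nabla^*,\Omega)$,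 $\mathrm{tr}(\boldsymbol u)=\widehat{\boldsymbol u}$, $\mathrm{tr}^*(\boldsymbol P)=\widehat{\boldsymbol p}$, and $\boldsymbol u$ solves $$\mathbf{curl}^*\boldsymbol\nabla^*\boldsymbol\nabla\mathbf{curl}\,\boldsymbol u+\gamma\boldsymbol u=\boldsymbol f\quad\text{in }\Omega.$$
   Context: Let $d\in\{2,3\}$ and let $\Omega\subset\mathbb R^d$ be a bounded, simply connected Lipschitz domain with boundary $\Gamma$ and exterior unit normal $\boldsymbol n$. All functions are real-valued. Operators. For a vector function $\boldsymbol v$, $\boldsymbol\nabla\boldsymbol v$ is the tensor whose $i$-th row is $(\nabla v_i)^\top$; for a $d\times d$ tensor function $\boldsymbol Q$, $\mathbf{div}\,\boldsymbol Q$ is the vector of row-wise divergences. $\boldsymbol\nabla^*:=-\mathbf{div}$. If $d=3$: $\mathbf{curl}\,\boldsymbol v=\nabla\times\boldsymbol v$ and $\mathbf{curl}^*=\mathbf{curl}$. If $d=2$: $\mathbf{curl}\,v=(\nabla v)^\perp$ for scalar $v$, where $(v_1,v_2)^\perp:=(v_2,-v_1)$, and $\mathbf{curl}^*\boldsymbol v=\mathrm{rot}\,\boldsymbol v:=\mathrm{div}(\boldsymbol v^\perp)$ for vector $\boldsymbol v$. Thus $\mathbf{curl}^*\boldsymbol\nabla^*\boldsymbol Q=-\mathbf{curl}\,\mathbf{div}\,\boldsymbol Q$ ($d=3$) or $-\mathrm{rot}\,\mathbf{div}\,\boldsymbol Q$ ($d=2$). Convention: bold-face symbols $\boldsymbol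 u,\boldsymbol v,\boldsymbol f,\dots$ denote vector-valued functions if $d=3$ and scalar functions if $d=2$; accordingly $\boldsymbol L_2(\omega)=L_2(\omega)^3$ if $d=3$ and $L_2(\omega)$ if $d=2$; $\boldsymbol{\mathcal D}(\Omega)$ is the space of smooth vector ($d=3$) or scalar ($d=2$) functions with compact support in $\Omega$. Spaces, for $\omega\subset\Omega$: $\mathbb L_2(\omega)=L_2(\omega)^{d\times d}$; $\mathbb L_2^\perp(\omega)=\{\boldsymbol Q\in\mathbb L_2(\omega);\ \text{matrix trace of }\boldsymbol Q=0\}$; $\boldsymbol H(\boldsymbol\nabla\mathbf{curl},\omega)=\{\boldsymbol v\in\boldsymbol L_2(\omega);\ \boldsymbol\nabla\mathbf{curl}\,\boldsymbol v\in\mathbb L_2(\omega)\}$; $\mathbb H(\mathbf{curl}^*\boldsymbol\nabla^*,\omega)=\{\boldsymbol Q\in\mathbb L_2^\perp(\omega);\ \mathbf{curl}^*\boldsymbol\nabla^*\boldsymbol Q\in\boldsymbol L_2(\omega)\}$. For $d=2$, $\boldsymbol H(\boldsymbol\nabla\mathbf{curl},\omega)=H^2(\omega)$. They carry the graph norms $\|\boldsymbol v\|_{\boldsymbol\nabla\mathbf{curl},\omega}^2=\|\boldsymbol v\|_\omega^2+\|\boldsymbol\nabla\mathbf{curl}\,\boldsymbol v\|_\omega^2$, $\|\boldsymbol Q\|^2_{\mathbf{curl}^*\boldsymbol\nabla^*,\omega}=\|\boldsymbol Q\|_\omega^2+\|\mathbf{curl}^*\boldsymbol\nabla^*\boldsymbol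 Q\|_\omega^2$. Here $(\cdot,\cdot)_\omega$, $\|\cdot\|_\omega$ are $L_2(\omega)$ inner products and norms; the index is dropped if $\omega=\Omega$. $\boldsymbol H_0(\boldsymbol\nabla\mathbf{curl},\Omega)$ is the completion of $\boldsymbol{\mathcal D}(\Omega)$ in $\|\cdot\|_{\boldsymbol\nabla\mathbf{curl}}$. Mesh. $\mathcal T=\{T\}$ is a mesh of non-intersecting Lipschitz polyhedra (polygons if $d=2$) with $\overline\Omega=\cup\{\overline T;\ T\in\mathcal T\}$, and $\mathcal S=\{\partial T;\ T\in\mathcal T\}$. $\boldsymbol H(\boldsymbol\nabla\mathbf{curl},\mathcal T)$ and $\mathbb H(\mathbf{curl}^*\boldsymbol\nabla^*,\mathcal T)$ are the product spaces over $T\in\mathcal T$ (identified with piecewise defined functions), with product norms $\|\cdot\|_{\boldsymbol\nabla\mathbf{curl},\mathcal T}$, $\|\cdot\|_{\mathbf{curl}^*\boldsymbol\nabla^*,\mathcal T}$. $(\cdot,\cdot)_{\mathcal T}$ is the $L_2$ bilinear form with differential operators applied piecewise. Traces. $\mathrm{tr}:\boldsymbol H(\boldsymbol\nabla\mathbf{curl},\Omega)\to\mathbb H(\mathbf{curl}^*\boldsymbol\nabla^*,\mathcal T)'$, $\langle\mathrm{tr}(\boldsymbol v),\boldsymbol Q\rangle_{\mathcal S}:=(\boldsymbol\nabla\mathbf{curl}\,\boldsymbol v,\boldsymbol Q)-(\boldsymbol v,\mathbf{curl}^*\boldsymbol\nabla^*\boldsymbol Q)_{\mathcal T}$, and $\mathrm{tr}^*:\mathbb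 H(\mathbf{curl}^*\boldsymbol\nabla^*,\Omega)\to\boldsymbol H(\boldsymbol\nabla\mathbf{curl},\mathcal T)'$, $\langle\mathrm{tr}^*(\boldsymbol Q),\boldsymbol v\rangle^*_{\mathcal S}:=(\boldsymbol\nabla\mathbf{curl}\,\boldsymbol v,\boldsymbol Q)_{\mathcal T}-(\boldsymbol v,\mathbf{curl}^*\boldsymbol\nabla^*\boldsymbol Q)$. Trace spaces: $\widehat{\boldsymbol H}_0(\mathcal S)=\mathrm{tr}(\boldsymbol H_0(\boldsymbol\nabla\mathbf{curl},\Omega))$, $\widehat{\boldsymbol H}^*(\mathcal S)=\mathrm{tr}^*(\mathbb H(\mathbf{curl}^*\boldsymbol\nabla^*,\Omega))$, with norms $\|\widehat{\boldsymbol v}\|_{\inf}=\inf\{\|\boldsymbol v\|_{\boldsymbol\nabla\mathbf{curl}};\ \boldsymbol v\in\boldsymbol H(\boldsymbol\nabla\mathbf{curl},\Omega),\ \mathrm{tr}(\boldsymbol v)=\widehat{\boldsymbol v}\}$, $\|\widehat{\boldsymbol q}\|_{\inf^*}=\inf\{\|\boldsymbol Q\|_{\mathbf{curl}^*\boldsymbol\nabla^*};\ \boldsymbol Q\in\mathbb H(\mathbf{curl}^*\boldsymbol\nabla^*,\Omega),\ \mathrm{tr}^*(\boldsymbol Q)=\widehat{\boldsymbol q}\}$. The pairings $\langle\cdot,\cdot\rangle_{\mathcal S}$, $\langle\cdot,\cdot\rangle_{\mathcal S}^*$ of elements of trace spaces with test functions are those of the functionals. Formulation. $\mathfrak U=\boldsymbol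 L_2(\Omega)\times\mathbb L_2^\perp(\Omega)\times\widehat{\boldsymbol H}_0(\mathcal S)\times\widehat{\boldsymbol H}^*(\mathcal S)$ with $\|(\boldsymbol u,\boldsymbol P,\widehat{\boldsymbol u},\widehat{\boldsymbol p})\|_{\mathfrak U}^2=\|\boldsymbol u\|^2+\|\boldsymbol P\|^2+\|\widehat{\boldsymbol u}\|_{\inf}^2+\|\widehat{\boldsymbol p}\|_{\inf^*}^2$; $\mathfrak V=\boldsymbol H(\boldsymbol\nabla\mathbf{curl},\mathcal T)\times\mathbb H(\mathbf{curl}^*\boldsymbol\nabla^*,\mathcal T)$ with $\|(\boldsymbol v,\boldsymbol Q)\|_{\mathfrak V}^2=\|\boldsymbol v\|_{\boldsymbol\nabla\mathbf{curl},\mathcal T}^2+\|\boldsymbol Q\|_{\mathbf{curl}^*\boldsymbol\nabla^*,\mathcal T}^2$ and inducing inner product $\langle\!\langle\cdot,\cdot\rangle\!\rangle_{\mathfrak V}$; $$b(\boldsymbol u,\boldsymbol P,\widehat{\boldsymbol u},\widehat{\boldsymbol p};\boldsymbol v,\boldsymbol Q)=(\boldsymbol u,\gamma\boldsymbol v+\mathbf{curl}^*\boldsymbol\nabla^*\boldsymbol Q)_{\mathcal T}+(\boldsymbol P,\boldsymbol Q-\boldsymbol\nabla\mathbf{curl}\,\boldsymbol v)_{\mathcal T}+\langle\widehat{\boldsymbol u},\boldsymbol Q\rangle_{\mathcal S}+\langle\widehat{\boldsymbol p},\boldsymbol v\rangle^*_{\mathcal S},\qquad L(\boldsymbol v,\boldsymbol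 Q)=(\boldsymbol f,\boldsymbol v).$$ The trial-to-test operator $\mathfrak T:\mathfrak U\to\mathfrak V$ is defined by $\langle\!\langle\mathfrak T\mathfrak w,\delta\mathfrak v\rangle\!\rangle_{\mathfrak V}=b(\mathfrak w,\delta\mathfrak v)$ for all $\delta\mathfrak v\in\mathfrak V$. *)

(* Defs.v *)
From HB Require Import structures.
From mathcomp Require Import all_boot all_order all_algebra.
From mathcomp Require Import all_classical all_reals all_analysis.

Set Implicit Arguments.
Unset Strict Implicit.
Unset Printing Implicit Defensive.
Import Order.TTheory GRing.Theory Num.Theory.
Import numFieldNormedType.Exports.
Local Open Scope classical_set_scope.
Local Open Scope ring_scope.

(* R^d is 'rV[R]_d with the product sigma-algebra, which is its Borel
   sigma-algebra. *)
Section row_vector_measurable.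
Context {R : realType} {n : nat}.

Let coord (i : 'I_n) (x : 'rV[R]_n) : R := x ord0 i.

Let rV_set0 : g_sigma_preimage coord set0.
Proof. exact: sigma_algebra0. Qed.

Let rV_setC A : g_sigma_preimage coord A -> g_sigma_preimage coord (~` A).
Proof. exact: sigma_algebraC. Qed.

Let rV_bigcup (F : (set 'rV[R]_n)^nat) :
  (forall i, g_sigma_preimage coord (F i)) ->
  g_sigma_preimage coord (\bigcup_i F i).
Proof. exact: sigma_algebra_bigcup. Qed.

HB.instance Definition _ := @isMeasurable.Build default_measure_display
  'rV[R]_n (g_sigma_preimage coord) rV_set0 rV_setC rV_bigcup.

Lemma measurable_coord (i : 'I_n) :
  measurable_fun [set: 'rV[R]_n] (fun x => x ord0 i).
Proof.
move=> _ Y mY; rewrite setTI; apply: sub_sigma_algebra => /=.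
rewrite -bigcup_seq/=; exists i => /=; first by rewrite mem_index_enum.
by exists Y => //; rewrite setTI.
Qed.

Lemma measurable_fun_rV d (T : measurableType d) (f : T -> 'rV[R]_n) :
  (forall i, measurable_fun setT (fun x => f x ord0 i)) -> measurable_fun setT f.
Proof.
move=> mf _ Y mY; rewrite setTI.
have : preimage_set_system setT f (g_sigma_preimage coord) (f @^-1` Y).
  by exists Y => //; rewrite setTI.
rewrite -g_sigma_preimage_comp; move: (f @^-1` Y).
apply: smallest_sub; first exact: sigma_algebra_measurable.
rewrite -bigcup_seq => A [i _] [B mB <-]; exact: mf.
Qed.

End row_vector_measurable.

Section lebesgue.
Context {R : realType}.

Definition rV_cons n (p : 'rV[R]_n * measurableTypeR R) : 'rV[R]_n.+1 :=
  row_mx (p.2%:M : 'rV_1) p.1.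

Lemma measurable_rV_cons n : measurable_fun setT (@rV_cons n).
Proof.
apply: measurable_fun_rV => i.
case: (@split_ordP 1 n i) => j ->.
  apply: (eq_measurable_fun snd) => //.
  by move=> x _; rewrite /rV_cons (@row_mxEl _ 1 1 n) (ord1 j) mxE eqxx mulr1n.
apply: (eq_measurable_fun
  (fun x : 'rV[R]_n * measurableTypeR R => x.1 ord0 j)) => //.
  by move=> x _; rewrite /rV_cons (@row_mxEr _ 1 1 n).
exact: (measurableT_comp (measurable_coord j) measurable_fst).
Qed.


(* Push forward of the product measure along the identification of R^n x R
   with R^(n+1). *)
Definition lebesgue_step n (mu : {measure set 'rV[R]_n -> \bar R}) :
    {measure set 'rV[R]_n.+1 -> \bar R} :=
  measure_function_pushforward__canonical__measure_function_Measure
    (mu \x @lebesgue_measure R)%E (@measurable_rV_cons n).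

Fixpoint leb d : {measure set 'rV[R]_d -> \bar R} :=
  if d is n.+1 then lebesgue_step (leb n) else dirac (0 : 'rV[R]_0).

End lebesgue.

Section domains.
Context {R : realType} {d : nat}.
Implicit Types (w : set 'rV[R]_d) (x y e : 'rV[R]_d).

Definition dotp x y : R := \sum_i x ord0 i * y ord0 i.

Definition boundary w := closure w `\` interior w.

(* Near each boundary point the domain is the strict epigraph, in the direction
   of a unit vector e, of a Lipschitz function on the hyperplane orthogonal to
   e; that function is represented by its extension to R^d that is constant
   along e. *)
Definition lipschitz_boundary w : Prop :=
  forall x, boundary w x -> exists e (phi : 'rV[R]_d -> R) (U : set 'rV[R]_d),
    [/\ dotp e e = 1,
        lipschitz phi,
        forall y (t : R), phi (y + t *: e) = phi y,
        nbhs x U &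
        forall y, U y -> (w y <-> phi y < dotp y e)].

Definition lipschitz_domain w : Prop :=
  [/\ open w, connected w, w !=set0, bounded_set w & lipschitz_boundary w].

(* Path-connectedness follows for the open connected sets considered here. *)
Definition simply_connected w : Prop :=
  let I := `[0 : R, 1]%classic in
  forall c : R -> 'rV[R]_d,
    {within I, continuous c} -> (forall t, I t -> w (c t)) -> c 0 = c 1 ->
  exists h : R * R -> 'rV[R]_d,
    [/\ {within I `*` I, continuous h},
        forall p, (I `*` I) p -> w (h p),
        forall t, I t -> h (0, t) = c t,
        forall t, I t -> h (1, t) = c 0 &
        forall s, I s -> h (s, 0) = c 0 /\ h (s, 1) = c 0].

Definition lipschitz_polyhedron w : Prop :=
  lipschitz_domain w /\
  exists2 H : seq ('rV[R]_d * R), (forall h, h \in H -> h.1 != 0) &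
    forall x, boundary w x -> exists2 h, h \in H & dotp h.1 x = h.2.

Definition mesh (Omega : set 'rV[R]_d) N (T : 'I_N -> set 'rV[R]_d) : Prop :=
  [/\ forall i, lipschitz_polyhedron (T i),
      forall i j, i != j -> T i `&` T j = set0 &
      closure Omega = \bigcup_i closure (T i)].

End domains.

Section operators.
Context {R : realType}.

Definition partial d (k : 'I_d) (f : 'rV[R]_d -> R) : 'rV[R]_d -> R :=
  fun x => 'D_(delta_mx ord0 k) f x.

Definition smooth d (f : 'rV[R]_d -> R) : Prop :=
  forall s : seq 'I_d, let g := foldr (@partial d) f s in
    continuous g /\ forall (k : 'I_d) x, derivable g x (delta_mx ord0 k).

Definition test d p q (w : set 'rV[R]_d) (F : 'rV[R]_d -> 'M[R]_(p, q)) : Prop :=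
  (forall i j, smooth (fun x => F x i j)) /\
  exists2 K, compact K /\ K `<=` w & forall x, ~ K x -> F x = 0.

Definition grad d p (v : 'rV[R]_d -> 'rV[R]_p) : 'rV[R]_d -> 'M[R]_(p, d) :=
  fun x => \matrix_(i, j) partial j (fun y => v y ord0 i) x.

Definition div d p (Q : 'rV[R]_d -> 'M[R]_(p, d)) : 'rV[R]_d -> 'rV[R]_p :=
  fun x => \row_i \sum_j partial j (fun y => Q y i j) x.

Definition gradstar d p (Q : 'rV[R]_d -> 'M[R]_(p, d)) : 'rV[R]_d -> 'rV[R]_p :=
  fun x => - div Q x.

Definition perp (a : 'rV[R]_2) : 'rV[R]_2 :=
  \row_i (if i == 0 then a 0 1 else - a 0 0).

Definition curl2 (v : 'rV[R]_2 -> 'rV[R]_1) : 'rV[R]_2 -> 'rV[R]_2 :=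
  fun x => perp (grad v x).

Definition rot (v : 'rV[R]_2 -> 'rV[R]_2) : 'rV[R]_2 -> 'rV[R]_1 :=
  div (fun x => perp (v x)).

(* Indices are in Z/3. *)
Definition curl3 (v : 'rV[R]_3 -> 'rV[R]_3) : 'rV[R]_3 -> 'rV[R]_3 :=
  fun x => \row_(i < 3) (partial (i + 1) (fun y => v y 0 (i + 2)) x
                         - partial (i + 2) (fun y => v y 0 (i + 1)) x).

(* Number of components of a bold-face function; scalars are 'rV_1. *)
Definition ncomp (d : nat) : nat := if d is 2 then 1%N else d.

Definition curl d : ('rV[R]_d -> 'rV[R]_(ncomp d)) -> 'rV[R]_d -> 'rV[R]_d :=
  match d with 2 => curl2 | 3 => curl3 | _ => fun _ _ => 0 end.

Definition curlstar d : ('rV[R]_d -> 'rV[R]_d) -> 'rV[R]_d -> 'rV[R]_(ncomp d) :=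
  match d with 2 => rot | 3 => curl3 | _ => fun _ _ => 0 end.

End operators.

Notation bfield R d := ('rV[R]_d -> 'rV[R]_(ncomp d)).
Notation tfield R d := ('rV[R]_d -> 'M[R]_d).

Section spaces.
Context {R : realType} {d : nat}.
Implicit Types (w : set 'rV[R]_d) (u v : bfield R d) (P Q : tfield R d).

Definition L2 p q w (F : 'rV[R]_d -> 'M[R]_(p, q)) : Prop :=
  forall i j, (fun x => F x i j) \_ w \in Lfun (leb d) 2%:E.

Definition ip p q w (F G : 'rV[R]_d -> 'M[R]_(p, q)) : R :=
  \int[leb d]_(x in w) (\sum_i \sum_j F x i j * G x i j).

Definition L2norm p q w (F : 'rV[R]_d -> 'M[R]_(p, q)) : R :=
  Num.sqrt (ip w F F).

Definition aeeq p q w (F G : 'rV[R]_d -> 'M[R]_(p, q)) : Prop :=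
  {ae leb d, forall x, w x -> F x = G x}.

Definition L2perp w Q : Prop :=
  L2 w Q /\ {ae leb d, forall x, w x -> \tr (Q x) = 0}.

(* The differential operators on L_2 functions are meant in the sense of
   distributions; [gradcurl] and [curlstargradstar] return an L_2
   representative when there is one. *)
Definition is_gradcurl w v (G : tfield R d) : Prop :=
  L2 w G /\
  forall Phi, test w Phi -> ip w G Phi = ip w v (curlstar (gradstar Phi)).

Definition is_curlstargradstar w Q (g : bfield R d) : Prop :=
  L2 w g /\ forall phi, test w phi -> ip w g phi = ip w Q (grad (curl phi)).

Definition gradcurl w v : tfield R d := xget (fun=> 0) (is_gradcurl w v).

Definition curlstargradstar w Q : bfield R d :=
  xget (fun=> 0) (is_curlstargradstar w Q).

Definition Hgc w v : Prop := L2 w v /\ exists G, is_gradcurl w v G.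

Definition Hcg w Q : Prop := L2perp w Q /\ exists g, is_curlstargradstar w Q g.

Definition Hgc_norm w v : R :=
  Num.sqrt (L2norm w v ^+ 2 + L2norm w (gradcurl w v) ^+ 2).

Definition Hcg_norm w Q : R :=
  Num.sqrt (L2norm w Q ^+ 2 + L2norm w (curlstargradstar w Q) ^+ 2).

(* The completion of the test functions, as their closure in [Hgc w]. *)
Definition Hgc0 w v : Prop :=
  Hgc w v /\
  forall e : R, 0 < e -> exists2 phi, test w phi & Hgc_norm w (v - phi) < e.

End spaces.

Section dpg.
Context {R : realType} {d : nat}.
Variables (Omega : set 'rV[R]_d) (N : nat) (T : 'I_N -> set 'rV[R]_d).
Implicit Types (u v : bfield R d) (P Q : tfield R d).

(* Piecewise functions are represented by functions on Omega; membership in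
   L_2 of Omega only adds measurability on the (null) mesh skeleton. *)
Definition Hgc_mesh v : Prop := L2 Omega v /\ forall i, Hgc (T i) v.

Definition Hcg_mesh Q : Prop := L2perp Omega Q /\ forall i, Hcg (T i) Q.

Definition tr v Q : R :=
  ip Omega (gradcurl Omega v) Q - \sum_i ip (T i) v (curlstargradstar (T i) Q).

Definition trstar Q v : R :=
  \sum_i ip (T i) (gradcurl (T i) v) Q - ip Omega v (curlstargradstar Omega Q).

(* Elements of the dual of a mesh space are real functions on all fields, of
   which only the values on the mesh space matter. *)
Definition eq_Hcg_dual (l l' : tfield R d -> R) : Prop :=
  forall Q, Hcg_mesh Q -> l Q = l' Q.

Definition eq_Hgc_dual (l l' : bfield R d -> R) : Prop :=
  forall v, Hgc_mesh v -> l v = l' v.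

Definition trace_space0 (uh : tfield R d -> R) : Prop :=
  exists2 v, Hgc0 Omega v & eq_Hcg_dual (tr v) uh.

Definition trace_space_star (ph : bfield R d -> R) : Prop :=
  exists2 Q, Hcg Omega Q & eq_Hgc_dual (trstar Q) ph.

Definition norm_inf (uh : tfield R d -> R) : R :=
  inf [set Hgc_norm Omega v | v in
         [set v | Hgc Omega v /\ eq_Hcg_dual (tr v) uh]].

Definition norm_inf_star (ph : bfield R d -> R) : R :=
  inf [set Hcg_norm Omega Q | Q in
         [set Q | Hcg Omega Q /\ eq_Hgc_dual (trstar Q) ph]].

Notation trial :=
  (bfield R d * tfield R d * (tfield R d -> R) * (bfield R d -> R))%type.
Notation dtest := (bfield R d * tfield R d)%type.

Definition in_U (w : trial) : Prop :=
  let: (u, P, uh, ph) := w in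
  [/\ L2 Omega u, L2perp Omega P, trace_space0 uh & trace_space_star ph].

(* Equality in U: trial fields are L_2 functions up to null sets. *)
Definition eqU (w w' : trial) : Prop :=
  let: (u, P, uh, ph) := w in let: (u', P', uh', ph') := w' in
  [/\ aeeq Omega u u', aeeq Omega P P', eq_Hcg_dual uh uh' & eq_Hgc_dual ph ph'].

Definition normU (w : trial) : R :=
  let: (u, P, uh, ph) := w in
  Num.sqrt (L2norm Omega u ^+ 2 + L2norm Omega P ^+ 2
            + norm_inf uh ^+ 2 + norm_inf_star ph ^+ 2).

Definition in_V (t : dtest) : Prop := Hgc_mesh t.1 /\ Hcg_mesh t.2.

Definition ipV (t t' : dtest) : R :=
  let: (v, Q) := t in let: (v', Q') := t' in
  \sum_i (ip (T i) v v' + ip (T i) (gradcurl (T i) v) (gradcurl (T i) v')) +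
  \sum_i (ip (T i) Q Q'
          + ip (T i) (curlstargradstar (T i) Q) (curlstargradstar (T i) Q')).

Definition bform (gamma : R) (w : trial) (t : dtest) : R :=
  let: (u, P, uh, ph) := w in let: (v, Q) := t in
  \sum_i ip (T i) u (gamma *: v + curlstargradstar (T i) Q)
  + \sum_i ip (T i) P (Q - gradcurl (T i) v) + uh Q + ph v.

Definition Lform (f : bfield R d) (t : dtest) : R := ip Omega f t.1.

(* Defined up to null sets by the Riesz representation theorem. *)
Definition trial_to_test (gamma : R) (w : trial) : dtest :=
  xget (0, 0) [set t | in_V t /\
    forall dt, in_V dt -> ipV t dt = bform gamma w dt].

Definition finite_dim_subspace (Uh : set trial) : Prop :=
  exists n (e : 'I_n -> trial), (forall i, in_U (e i)) /\
    Uh = [set w | exists c : 'I_n -> R, w = \sum_i c i *: e i].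

Definition VF (gamma : R) (f : bfield R d) (w : trial) : Prop :=
  in_U w /\ forall t, in_V t -> bform gamma w t = Lform f t.

Definition DPG (gamma : R) (f : bfield R d) (Uh : set trial) (w : trial) : Prop :=
  Uh w /\
  forall t, (trial_to_test gamma @` Uh) t -> bform gamma w t = Lform f t.

Definition uniquely_solvable (S : set trial) : Prop :=
  (exists w, S w) /\ forall w w', S w -> S w' -> eqU w w'.

End dpg.

(* Main.v *)
(** Let A be the graph of grad curl on test fields.  The space H_0(grad curl)
    is the closure of A, and the trace-free fields with an L_2 distributional
    curl* grad* form the adjoint of A; since weak grad curl fields are trace
    free, A lives in L_2 times trace-free L_2 and the two relations are
    adjoint to each other.  Hence everything reduces to Hilbert space theory
    for graphs, once L_2 is known to be complete and grad curl to be coercive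
    (for d = 2 by Poincare's inequality, for d = 3 because gamma > 0).

    Stability: if the Riesz representative of b(w, .) in the broken test space
    has components v, Q with broken derivatives g, c, then the defining
    equations give u - c in H_0 with derivative Q - P, and P + g in H* with
    derivative gamma u - v; these fields have the traces of w.  Pairing them by
    Green's formula yields an energy identity that bounds w by the
    representative, with a constant that does not see the mesh.  Uniqueness,
    the a priori bound and quasi-optimality follow; existence for VF is the
    Riesz theorem for the energy on H_0, and for the DPG scheme it is the
    consistency of the normal equations. *)

From HB Require Import structures.
Require Import Defs.
From mathcomp Require Import all_boot all_order all_algebra.
From mathcomp Require Import all_classical all_reals all_analysis.
From mathcomp Require Import measurable_realfun.
From mathcomp Require Import ring lra.
Set Implicit Arguments.
Unset Strict Implicit.
Unset Printing Implicit Defensive.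
Import Order.TTheory GRing.Theory Num.Theory.
Import numFieldNormedType.Exports.
Local Open Scope classical_set_scope.
Local Open Scope ring_scope.

(** * Semi-inner products *)

(** Fields are functions rather than classes, and [gradcurl] and [curlstargradstar] choose
    representatives, so neither is linear on the nose. Derivatives are therefore carried instead of
    computed: a field travels with a candidate derivative in a linear relation. Inner products are
    only semidefinite, on a subset of all functions, and completeness, the Riesz theorem and
    adjoints are stated in that generality.

    The mesh enters the abstract argument only through two closed linear relations, the broken
    derivatives, which extend the closure and the adjoint. Concretely, the elements are disjoint and
    fill the domain up to a null set, so elementwise inner products add up. The coercivity constant
    is fixed by the domain and [gamma] before any mesh is chosen, which makes the final constant
    uniform.

    Weak derivatives are trace free because they can be tested with a bump times the identity, where
    [curlstar] meets a gradient. Symmetry of mixed derivatives is thus needed on bumps only, and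
    these are built from a class in which it follows by induction. *)

Section semi_inner_product.
Context {R : realType} {E : lmodType R}.
Implicit Types (S : set E) (a : E -> E -> R) (x y z : E).

(** The carrier is a subset because an integral means nothing for a general function, and
    definiteness is not asked because a function that vanishes almost everywhere need not be
    zero. *)
Record semi_ip S a : Prop := SemiIp {
  sip0 : S 0;
  sipL : forall k x y, S x -> S y -> S (k *: x + y);
  sipC : forall x y, S x -> S y -> a x y = a y x;
  sip_linear : forall k x y z, S x -> S y -> S z ->
    a (k *: x + y) z = k * a x z + a y z;
  sip_ge0 : forall x, S x -> 0 <= a x x }.

Definition complete_ip S a : Prop :=
  forall u : nat -> E, (forall n, S (u n)) ->
  (forall e : R, 0 < e -> exists N, forall m n, (N <= m)%N -> (N <= n)%N ->
     a (u m - u n) (u m - u n) < e) ->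
  exists2 x, S x & forall e : R, 0 < e -> exists N, forall n, (N <= n)%N ->
     a (u n - x) (u n - x) < e.

Section theory.
Variables (S : set E) (a : E -> E -> R).
Hypothesis H : semi_ip S a.

Lemma sipZ k x : S x -> S (k *: x).
Proof. by move=> Sx; rewrite -[_ *: _]addr0; apply: (sipL H) => //; exact: sip0 H. Qed.

Lemma sipD x y : S x -> S y -> S (x + y).
Proof. by move=> Sx Sy; rewrite -[x]scale1r; exact: (sipL H). Qed.

Lemma sipN x : S x -> S (- x).
Proof. by move=> Sx; rewrite -scaleN1r; exact: sipZ. Qed.

Lemma sipB x y : S x -> S y -> S (x - y).
Proof. by move=> Sx Sy; apply: sipD => //; exact: sipN. Qed.

Lemma sipDl x y z : S x -> S y -> S z -> a (x + y) z = a x z + a y z.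
Proof. by move=> *; rewrite -{1}[x]scale1r (sip_linear H)// mul1r. Qed.

Lemma sip0l z : S z -> a 0 z = 0.
Proof.
move=> Sz; have S0 := sip0 H.
have := sipDl S0 S0 Sz; rewrite addr0 => h.
by apply: (@addrI _ (a 0 z)); rewrite -h addr0.
Qed.

Lemma sipZl k x z : S x -> S z -> a (k *: x) z = k * a x z.
Proof.
move=> Sx Sz; rewrite -[k *: x]addr0 (sip_linear H)//; last exact: sip0 H.
by rewrite sip0l// addr0.
Qed.

Lemma sipNl x z : S x -> S z -> a (- x) z = - a x z.
Proof. by move=> *; rewrite -scaleN1r sipZl// mulN1r. Qed.

Lemma sipBl x y z : S x -> S y -> S z -> a (x - y) z = a x z - a y z.
Proof. by move=> Sx Sy Sz; rewrite sipDl ?sipNl//; exact: sipN. Qed.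

Lemma sipDr x y z : S x -> S y -> S z -> a z (x + y) = a z x + a z y.
Proof.
by move=> Sx Sy Sz; rewrite (sipC H)// ?sipDl// ?(sipC H Sz)//; exact: sipD.
Qed.

Lemma sipZr k x z : S x -> S z -> a z (k *: x) = k * a z x.
Proof. by move=> Sx Sz; rewrite (sipC H)// ?sipZl// ?(sipC H Sz)//; exact: sipZ. Qed.

Lemma sipNr x z : S x -> S z -> a z (- x) = - a z x.
Proof. by move=> *; rewrite -scaleN1r sipZr// mulN1r. Qed.

Lemma sipBr x y z : S x -> S y -> S z -> a z (x - y) = a z x - a z y.
Proof. by move=> Sx Sy Sz; rewrite sipDr ?sipNr//; exact: sipN. Qed.

Lemma sip_distC x y : S x -> S y -> a (x - y) (x - y) = a (y - x) (y - x).
Proof.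
move=> Sx Sy; have Syx := sipB Sy Sx.
by rewrite -opprB sipNl ?sipNr ?opprK//; exact: sipN.
Qed.

Lemma sip_sqrD k x y : S x -> S y ->
  a (x + k *: y) (x + k *: y) = a x x + 2 * k * a x y + k ^+ 2 * a y y.
Proof.
move=> Sx Sy; have Sky := sipZ k Sy.
rewrite sipDl// ?sipDr// ?sipZl// ?sipZr// ?(sipC H Sy Sx); first by ring.
exact: sipD.
Qed.

Lemma cauchy_schwarz x y : S x -> S y -> a x y ^+ 2 <= a x x * a y y.
Proof.
move=> Sx Sy.
have J k : 0 <= a x x + 2 * k * a x y + k ^+ 2 * a y y.
  by rewrite -sip_sqrD//; apply: (sip_ge0 H); apply: sipD => //; exact: sipZ.
have A0 := sip_ge0 H Sx; have B0 := sip_ge0 H Sy.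
move: (a x x) (a x y) (a y y) A0 B0 J => A D B A0 B0 J.
have [B0'|Bn0] := eqVneq B 0.
  have [->|Dn0] := eqVneq D 0; first by rewrite expr0n/= mulr_ge0.
  (* With [B = 0] the quadratic is affine in its parameter; this value would make it [-1]. *)
  have := J (- (A + 1) / (2 * D)); rewrite B0' mulr0 addr0.
  have -> : A + 2 * (- (A + 1) / (2 * D)) * D = -1 by field.
  by lra.
have Bp : 0 < B by rewrite lt_def Bn0.
have := J (- D / B).
have -> : A + 2 * (- D / B) * D + (- D / B) ^+ 2 * B = (A * B - D ^+ 2) / B by field.
by rewrite pmulr_lge0 ?invr_gt0// subr_ge0.
Qed.

Definition sip_norm x := Num.sqrt (a x x).

Lemma sip_norm_ge0 x : 0 <= sip_norm x. Proof. exact: sqrtr_ge0. Qed.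

Lemma sip_norm_sqr x : S x -> sip_norm x ^+ 2 = a x x.
Proof. by move=> Sx; rewrite sqr_sqrtr//; exact: (sip_ge0 H). Qed.

Lemma sip_cs x y : S x -> S y -> `|a x y| <= sip_norm x * sip_norm y.
Proof.
move=> Sx Sy; rewrite -sqrtrM; last exact: (sip_ge0 H).
by rewrite -sqrtr_sqr ler_wsqrtr// cauchy_schwarz.
Qed.

Lemma sip_normD x y : S x -> S y -> sip_norm (x + y) <= sip_norm x + sip_norm y.
Proof.
move=> Sx Sy; rewrite -(@ler_pXn2r _ 2)// ?nnegrE ?addr_ge0 ?sip_norm_ge0//.
rewrite sip_norm_sqr; last exact: sipD.
rewrite -[in leLHS](scale1r y) sip_sqrD// sqrrD !sip_norm_sqr//.
have := le_trans (ler_norm _) (sip_cs Sx Sy); rewrite expr1n !mul1r -mulr_natl.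
by lra.
Qed.

Lemma sip_normN x : S x -> sip_norm (- x) = sip_norm x.
Proof. by move=> Sx; rewrite /sip_norm sipNl ?sipNr ?opprK//; exact: sipN. Qed.

(** Direct method: [J x = a x x - 2 * L x] is minimized. The bound on [L] keeps [J] bounded below
    and forces [L] to vanish on vectors of norm zero, so no quotient by them is taken and the
    representative is determined only up to them. *)
Lemma riesz (L : E -> R) (M : R) : complete_ip S a ->
  (forall k x y, S x -> S y -> L (k *: x + y) = k * L x + L y) ->
  (forall x, S x -> L x ^+ 2 <= M * a x x) ->
  exists2 x, S x & forall y, S y -> a x y = L y.
Proof.
move=> cS Llin Lb.
pose J x := a x x - 2 * L x.
have M0 : 0 <= `|M| by [].
have Jlb x : S x -> - (`|M|) <= J x.
  move=> Sx; have A0 := sip_ge0 H Sx.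
  have h : L x ^+ 2 <= `|M| * a x x.
    by apply: le_trans (Lb _ Sx) _; apply: ler_wpM2r => //; exact: ler_norm.
  rewrite /J; move: (a x x) (L x) `|M| A0 h M0 => A l m A0 h m0.
  suff : `|2 * l| <= A + m by have := ler_norm (2 * l); lra.
  rewrite -(@ler_pXn2r _ 2)// ?nnegrE ?addr_ge0// real_normK ?num_real//.
  by have := sqr_ge0 (A - m); rewrite !expr2 in h *; lra.
have JS : [set J x | x in S] !=set0 by exists (J 0), 0 => //; exact: sip0 H.
have Jhi : has_inf [set J x | x in S].
  by split=> //; exists (- `|M|) => _ [x Sx <-]; exact: Jlb.
pose I := inf [set J x | x in S].
have IJ x : S x -> I <= J x by move=> Sx; apply: (ge_inf Jhi.2); exists x.
have /choice[u uP] n : exists x, S x /\ J x < I + n.+1%:R^-1.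
  have h : I < I + n.+1%:R^-1 by rewrite ltrDl invr_gt0.
  by have [_ [x Sx <-] ?] := inf_lt JS h; exists x.
have Su n : S (u n) := (uP n).1.
have L2 x k y : S x -> S y -> L (x + k *: y) = L x + k * L y.
  by move=> Sx Sy; rewrite addrC Llin// addrC.
have JD x k y : S x -> S y ->
    J (x + k *: y) = J x + 2 * k * (a x y - L y) + k ^+ 2 * a y y.
  by move=> Sx Sy; rewrite /J sip_sqrD// L2//; ring.
(* At the midpoint of [u m] and [u n] the functional is at least [I]; it lies below the mean of the
   two end values by a quarter of the squared distance. *)
have cau m n : a (u m - u n) (u m - u n) <= 2 * m.+1%:R^-1 + 2 * n.+1%:R^-1.
  have Sy : S (u m - u n) by exact: sipB.
  have h1 : J (u n + 2^-1 *: (u m - u n)) >= I.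
    by apply: IJ; apply: sipD => //; exact: sipZ.
  have h2 : J (u m) = J (u n + 1 *: (u m - u n)) by rewrite scale1r addrC subrK.
  rewrite JD// in h1; rewrite JD// in h2.
  have := (uP m).2; have := (uP n).2; rewrite h2.
  move: h1; move: (a (u m - u n) (u m - u n)) (a _ _ - L _) => A D.
  move: (J (u n)) (m.+1%:R^-1) (n.+1%:R^-1) => j em en.
  have -> : (I <= j + 2 * 2^-1 * D + 2^-1 ^+ 2 * A) = (I <= j + D + A / 4).
    by congr (_ <= _); field.
  by rewrite expr1n !mul1r mulr1 => *; lra.
have invN (e : R) : 0 < e -> exists N, forall n, (N <= n)%N -> n.+1%:R^-1 < e.
  move=> e0; have [N _ NP] := near_infty_natSinv_lt (PosNum e0).
  by exists N => n Nn; exact: NP.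
have [|x Sx xP] := cS u Su.
  move=> e e0; have e4 : 0 < e / 4 by rewrite divr_gt0.
  have [N NP] := invN _ e4; exists N => m n Nm Nn.
  apply: le_lt_trans (cau m n) _.
  have := NP _ Nm; have := NP _ Nn.
  by move: (m.+1%:R^-1) (n.+1%:R^-1) => em en; lra.
exists x => // y Sy.
have A0 := sip_ge0 H Sy.
(* Variation of [J] around the limit: [I] is compared with [J (u n + t *: y)]. Half of [e] pays for
   [J (u n) - I], the other half for replacing [u n] by [x]. *)
have key t : 0 <= 2 * t * (a x y - L y) + t ^+ 2 * a y y.
  apply/ler_addgt0Pr => e e0.
  pose t1 := 2 * `|t| + 1.
  have t10 : 0 < t1 by rewrite ltr_wpDl // mulr_ge0.
  have e2 : 0 < e / 2 by rewrite divr_gt0.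
  have e3 : 0 < (e / 2 / t1) ^+ 2 / (a y y + 1).
    by apply: divr_gt0; [apply: exprn_gt0; apply: divr_gt0|rewrite ltr_wpDl].
  have [N1 N1P] := invN _ e2; have [N2 N2P] := xP _ e3.
  pose n := maxn N1 N2.
  have h1 := N1P n (leq_maxl _ _); have h2 := N2P n (leq_maxr _ _).
  have Sd : S (u n - x) by exact: sipB.
  have h3 : I <= J (u n + t *: y) by apply: IJ; apply: sipD => //; exact: sipZ.
  rewrite JD// in h3; have h4 := (uP n).2.
  have h5 : a (u n) y = a x y + a (u n - x) y by rewrite sipBl//; ring.
  have h6 : `|a (u n - x) y| <= e / 2 / t1.
    rewrite -[leRHS]ger0_norm; last by rewrite divr_ge0// ltW.
    rewrite -ler_sqr ?nnegrE// !real_normK ?num_real//.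
    apply: le_trans (cauchy_schwarz Sd Sy) _.
    have : a (u n - x) (u n - x) * (a y y + 1) <= (e / 2 / t1) ^+ 2.
      by rewrite -ler_pdivlMr; [exact: ltW|lra].
    have := sip_ge0 H Sd; nra.
  have h7 : 2 * t * a (u n - x) y <= e / 2.
    apply: le_trans (ler_norm _) _; rewrite 2!normrM (@ger0_norm _ 2)//.
    have : t1 * (e / 2 / t1) = e / 2 by field; rewrite gt_eqF.
    move: h6; rewrite /t1; have := normr_ge0 t; have := normr_ge0 (a (u n - x) y).
    move: (`|t|) (`|_|) (e / 2 / _) => A B D; nra.
  rewrite h5 in h3; move: h1 h3 h4 h7.
  by move: (n.+1%:R^-1) => en; lra.
(* Nearly the optimal [t]; the [+ 1] avoids dividing by zero when [a y y = 0]. *)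
have := key (- (a x y - L y) / (a y y + 1)).
set D := a x y - L y; set A := a y y in A0 *.
have -> : 2 * (- D / (A + 1)) * D + (- D / (A + 1)) ^+ 2 * A
   = - (D ^+ 2 * (A + 2) / (A + 1) ^+ 2) by field; lra.
rewrite oppr_ge0 pmulr_lle0 ?invr_gt0 ?exprn_gt0//; last lra.
rewrite pmulr_lle0; last lra.
move=> D0; apply/eqP; rewrite -subr_eq0 -/D -sqrf_eq0.
by rewrite eq_le D0 sqr_ge0.
Qed.

End theory.

Lemma complete_ip_equiv S a b (c C : R) : 0 < c -> 0 < C ->
  semi_ip S a ->
  (forall x, S x -> c * a x x <= b x x) -> (forall x, S x -> b x x <= C * a x x) ->
  complete_ip S a -> complete_ip S b.
Proof.
move=> c0 C0 Ha ca bC cS u Su uc.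
have SB x y : S x -> S y -> S (x - y) by exact: (sipB Ha).
have [|x Sx xP] := cS u Su.
  move=> e e0; have [N NP] := uc _ (mulr_gt0 c0 e0); exists N => m n Nm Nn.
  rewrite -(ltr_pM2l c0); apply: le_lt_trans (ca _ _) (NP _ _ Nm Nn).
  exact: SB.
exists x => // e e0; have [N NP] := xP _ (divr_gt0 e0 C0).
exists N => n Nn; apply: le_lt_trans (bC _ _) _; first exact: SB.
by rewrite mulrC -ltr_pdivlMr//; exact: NP.
Qed.

End semi_inner_product.

(** * Lebesgue measure on row vectors *)

Section boxes.
Context {R : realType} {n : nat}.
Implicit Types (a b x y : 'rV[R]_n) (w : set 'rV[R]_n).

Definition box a b : set 'rV[R]_n := [set x | forall i, a 0 i < x 0 i < b 0 i].
Definition cbox a b : set 'rV[R]_n := [set x | forall i, a 0 i <= x 0 i <= b 0 i].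

Lemma box_cbox a b : box a b `<=` cbox a b.
Proof. by move=> x h i; have /andP[/ltW-> /ltW->] := h i. Qed.

Lemma boxE a b : box a b =
  \bigcap_(i in [set: 'I_n]) ((fun x => x 0 i) @^-1` `]a 0 i, b 0 i[%classic).
Proof.
apply/seteqP; split=> x h; first by move=> i _ /=; rewrite in_itv/=; exact: h.
by move=> i; have := h i I; rewrite /= in_itv.
Qed.

Lemma cboxE a b : cbox a b =
  \bigcap_(i in [set: 'I_n]) ((fun x => x 0 i) @^-1` `[a 0 i, b 0 i]%classic).
Proof.
apply/seteqP; split=> x h; first by move=> i _ /=; rewrite in_itv/=; exact: h.
by move=> i; have := h i I; rewrite /= in_itv.
Qed.

Lemma measurable_box a b : measurable (box a b).
Proof.
rewrite boxE; apply: fin_bigcap_measurable => [|i _].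
  exact: finite_finset.
by rewrite -[X in measurable X]setTI; exact: (measurable_coord i).
Qed.

Lemma measurable_cbox a b : measurable (cbox a b).
Proof.
rewrite cboxE; apply: fin_bigcap_measurable => [|i _].
  exact: finite_finset.
by rewrite -[X in measurable X]setTI; exact: (measurable_coord i).
Qed.

Lemma boxI a b a' b' : box a b `&` box a' b' =
  box (\row_i Num.max (a 0 i) (a' 0 i)) (\row_i Num.min (b 0 i) (b' 0 i)).
Proof.
apply/seteqP; split=> x.
  case=> h h' i; rewrite !mxE gt_max lt_min.
  by have /andP[-> ->] := h i; have /andP[-> ->] := h' i.
move=> h; split=> i; have := h i; rewrite !mxE gt_max lt_min.
  by move=> /andP[/andP[-> _] /andP[-> _]].
by move=> /andP[/andP[_ ->] /andP[_ ->]].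
Qed.

(** Rational corners make the family countable, and asking for the closed box inside [w] makes every
    bump on such a box a test function of [w]. *)
Lemma open_box_cover w : open w ->
  w `<=` \bigcup_(p in [set p : 'rV[rat]_n * 'rV[rat]_n |
              cbox (map_mx ratr p.1) (map_mx ratr p.2) `<=` w])
            box (map_mx ratr p.1) (map_mx ratr p.2).
Proof.
move=> ow x wx; have /nbhs_ballP[e /= e0 ew] := open_nbhs_nbhs (conj ow wx).
have e2 : 0 < e / 2 by rewrite divr_gt0.
have lo i : exists q : rat, x 0 i - e / 2 < ratr q < x 0 i.
  have /rat_in_itvoo[q] : x 0 i - e / 2 < x 0 i by rewrite ltrBlDr ltrDl.
  by rewrite in_itv/=; exists q.
have hi i : exists q : rat, x 0 i < ratr q < x 0 i + e / 2.
  have /rat_in_itvoo[q] : x 0 i < x 0 i + e / 2 by rewrite ltrDl.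
  by rewrite in_itv/=; exists q.
move/choice : lo => [l lP]; move/choice : hi => [h hP].
exists (\row_i l i, \row_i h i) => /=; last first.
  by move=> i; rewrite !mxE; have /andP[_ ->] := lP i; have /andP[-> _] := hP i.
move=> y yP; apply: ew; split => // i j; rewrite (ord1 i).
have := yP j; rewrite !mxE /ball/= => /andP[y1 y2].
have /andP[l1 l2] := lP j; have /andP[h1 h2] := hP j.
by rewrite ltr_norml; apply/andP; split; lra.
Qed.

Lemma open_rV_measurable w : open w -> measurable w.
Proof.
move=> ow; have -> : w = \bigcup_(p in [set p : 'rV[rat]_n * 'rV[rat]_n |
              cbox (map_mx ratr p.1) (map_mx ratr p.2) `<=` w])
            box (map_mx ratr p.1) (map_mx ratr p.2).
  apply/seteqP; split; first exact: open_box_cover.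
  by move=> x [p pw bx]; apply: pw; exact: box_cbox.
rewrite bigcup_mkcond; apply: countable_bigcupT_measurable => [|p].
  exact: countableP.
by case: ifP => // _; exact: measurable_box.
Qed.

Lemma continuous_rV_measurable (f : 'rV[R]_n -> R) :
  continuous f -> measurable_fun setT f.
Proof.
move=> cf; apply: (measurability _ (measurable_realfun.RGenOpens.measurableE R)).
move=> _ [_ [a [b ->] <-]]; rewrite setTI; apply: open_rV_measurable.
by move/continuousP : cf; apply; exact: interval_open.
Qed.

End boxes.

(** * Sigma-finiteness, Fubini in the first coordinate, null hyperplanes *)

Section leb_sigma_finite.
Context {R : realType}.

Lemma rV_consl n (y : 'rV[R]_n) (t : R) : rV_cons (y, t) 0 ord0 = t.
Proof.
have -> : ord0 = lshift n (ord0 : 'I_1) by exact: val_inj.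
by rewrite /rV_cons (@row_mxEl _ 1 1 n) mxE eqxx mulr1n.
Qed.

Lemma rV_consr n (y : 'rV[R]_n) (t : R) i : rV_cons (y, t) 0 (lift ord0 i) = y 0 i.
Proof.
have -> : lift ord0 i = rshift 1 i by exact: val_inj.
by rewrite /rV_cons (@row_mxEr _ 1 1 n).
Qed.

Definition cube n (M : R) : set 'rV[R]_n := cbox (const_mx (- M)) (const_mx M).
Arguments cube n M : clear implicits.

Lemma cubeP n (M : R) x : cube n M x <-> forall i, `|x 0 i| <= M.
Proof. by split=> h i; have := h i; rewrite ?mxE ler_norml. Qed.

Lemma leb_cube n (M : R) : (leb n (cube n M) < +oo)%E.
Proof.
elim: n => [|n IHn].
  by rewrite /= /dirac indicE ltry.
have -> : leb n.+1 (cube n.+1 M) =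
   (leb n \x @lebesgue_measure R)%E (cube n M `*` `[- M, M]%classic).
  rewrite [LHS]/=/pushforward; congr (_ _).
  apply/seteqP; split=> -[y t].
    move=> /cubeP h; split.
      by apply/cubeP => i; have := h (lift ord0 i); rewrite rV_consr.
    by have := h ord0; rewrite rV_consl /= in_itv/= ler_norml.
  rewrite /= in_itv/= => -[/cubeP h1 h2]; apply/cubeP => i.
  case: (unliftP ord0 i) => [j|] ->; last by rewrite rV_consl ler_norml.
  by rewrite rV_consr.
rewrite product_measure1E//; last exact: measurable_cbox.
apply: lte_mul_pinfty; [by []|by rewrite ge0_fin_numE|].
suff : (@lebesgue_measure R `[(- M)%R, M]%classic < +oo)%E by [].
by rewrite lebesgue_measure_itv/=; case: ifP; rewrite ?ltry.
Qed.

Lemma cubeT n : [set: 'rV[R]_n] = \bigcup_k cube n k%:R.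
Proof.
apply/esym/seteqP; split=> // x _.
have [N NP] : exists N, forall i, `|x 0 i| <= N%:R.
  have /choice[N NP] (i : 'I_n) : exists N, `|x 0 i| <= N%:R.
    by exists (Num.bound `|x 0 i|); rewrite ltW// archi_boundP.
  exists (\max_i N i) => i; apply: le_trans (NP i) _.
  by rewrite ler_nat; exact: leq_bigmax.
by exists N => //; apply/cubeP.
Qed.

Lemma sigma_finite_leb n : sigma_finite setT (@leb R n).
Proof.
exists (fun k => cube n k%:R); first exact: cubeT.
by move=> k; split; [exact: measurable_cbox|exact: leb_cube].
Qed.

(* An alias of [leb] on which the sigma-finite structure can be declared. *)
Definition lebs n : set 'rV[R]_n -> \bar R := leb n.
Arguments lebs : clear implicits.

HB.instance Definition _ n := Measure.copy (lebs n) (leb n).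
HB.instance Definition _ n := Measure_isSigmaFinite.Build _ _ _ (lebs n)
  (@sigma_finite_leb n).

Local Open Scope ereal_scope.

Lemma ge0_integral_leb_prod n (f : 'rV[R]_n.+1 -> \bar R) :
  measurable_fun [set: 'rV[R]_n.+1] f -> (forall x, 0 <= f x) ->
  \int[leb n.+1]_x f x =
  \int[lebs n \x @lebesgue_measure R]_p f (rV_cons p).
Proof.
move=> mf f0.
have mh := @measurable_rV_cons R n.
have := @ge0_integral_pushforward _ _ _ _ R _ mh (lebs n \x @lebesgue_measure R) setT f measurableT.
by rewrite preimage_setT => ->.
Qed.

Lemma ge0_integral_lebS n (f : 'rV[R]_n.+1 -> \bar R) :
  measurable_fun [set: 'rV[R]_n.+1] f -> (forall x, 0 <= f x) ->
  \int[leb n.+1]_x f x = \int[lebesgue_measure]_t \int[leb n]_y f (rV_cons (y, t)).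
Proof.
move=> mf f0; rewrite ge0_integral_leb_prod//.
rewrite (@fubini_tonelli2 _ _ _ _ R (lebs n) lebesgue_measure (f \o @rV_cons R n))//; last by move=> x; exact: f0.
apply: measurableT_comp => //; exact: measurable_rV_cons.
Qed.

Lemma ge0_integral_lebS12 n (f : 'rV[R]_n.+1 -> \bar R) :
  measurable_fun [set: 'rV[R]_n.+1] f -> (forall x, 0 <= f x) ->
  \int[leb n.+1]_x f x = \int[leb n]_y \int[lebesgue_measure]_t f (rV_cons (y, t)).
Proof.
move=> mf f0; rewrite ge0_integral_leb_prod//.
rewrite (@fubini_tonelli1 _ _ _ _ R (lebs n) lebesgue_measure (f \o @rV_cons R n))//; last by move=> x; exact: f0.
apply: measurableT_comp => //; exact: measurable_rV_cons.
Qed.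

Lemma integrable_leb_prod n (f : 'rV[R]_n.+1 -> \bar R) :
  (leb n.+1).-integrable setT f ->
  (lebs n \x @lebesgue_measure R).-integrable setT (f \o @rV_cons R n).
Proof.
move=> /integrableP[mf fi]; apply/integrableP; split.
  apply: measurableT_comp => //; exact: measurable_rV_cons.
move: fi; rewrite ge0_integral_leb_prod//.
exact: measurableT_comp.
Qed.

Lemma integral_leb_prod n (f : 'rV[R]_n.+1 -> \bar R) :
  (leb n.+1).-integrable setT f ->
  \int[leb n.+1]_x f x =
  \int[lebs n \x @lebesgue_measure R]_p f (rV_cons p).
Proof.
move=> If; have mf := measurable_int _ If.
have mh := @measurable_rV_cons R n.
have := @integral_pushforward _ _ _ _ R _ mh (lebs n \x @lebesgue_measure R) setT f mf.
by rewrite preimage_setT => ->//; exact: integrable_leb_prod.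
Qed.

Lemma integral_lebS21 n (f : 'rV[R]_n.+1 -> \bar R) :
  (leb n.+1).-integrable setT f ->
  \int[leb n.+1]_x f x = \int[lebesgue_measure]_t \int[leb n]_y f (rV_cons (y, t)).
Proof.
move=> If; rewrite integral_leb_prod//.
rewrite -(@integral21_prod_meas1 _ _ _ _ _ (lebs n) lebesgue_measure (f \o @rV_cons R n))//.
exact: integrable_leb_prod.
Qed.

Lemma integral_lebS12 n (f : 'rV[R]_n.+1 -> \bar R) :
  (leb n.+1).-integrable setT f ->
  \int[leb n.+1]_x f x = \int[leb n]_y \int[lebesgue_measure]_t f (rV_cons (y, t)).
Proof.
move=> If; rewrite integral_leb_prod//.
rewrite -(@integral12_prod_meas1 _ _ _ _ _ (lebs n) lebesgue_measure (f \o @rV_cons R n))//.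
exact: integrable_leb_prod.
Qed.

Lemma dotpS n (h : 'rV[R]_n.+1) y t :
  dotp h (rV_cons (y, t)) = (h 0%R ord0 * t + dotp (\row_i h 0%R (lift ord0 i)) y)%R.
Proof.
rewrite /dotp big_ord_recl rV_consl; congr (_ + _)%R.
by apply: eq_bigr => i _; rewrite rV_consr mxE.
Qed.

Lemma measurable_dotp n (h : 'rV[R]_n) : measurable_fun [set: 'rV[R]_n] (dotp h).
Proof.
apply: measurable_sum => i; apply: measurable_realfun.measurable_funM => //.
exact: measurable_coord.
Qed.

Lemma measurable_hyperplane n (h : 'rV[R]_n) (c : R) :
  measurable [set x | dotp h x = c].
Proof.
have -> : [set x | dotp h x = c] = setT `&` (dotp h @^-1` [set c]).
  by rewrite setTI.
exact: measurable_dotp.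
Qed.

(** Induction on the dimension. If the leading coefficient is zero, the slices orthogonal to the
    first axis are hyperplanes one dimension below; otherwise each line parallel to that axis meets
    the set in a single point. *)
Lemma hyperplane_null n (h : 'rV[R]_n) (c : R) : h != 0%R ->
  leb n [set x | dotp h x = c] = 0.
Proof.
elim: n h c => [|n IHn] h c h0.
  by rewrite (thinmx0 h) eqxx in h0.
set A := [set x | _]; have mA : measurable A by exact: measurable_hyperplane.
have mA1 : measurable_fun [set: 'rV[R]_n.+1] (EFin \o (\1_A : _ -> R)).
  by apply/measurable_EFinP; exact: measurable_indic.
rewrite -[A]setIT -[LHS]integral_indic//.
set h' := (\row_i h 0%R (lift ord0 i) : 'rV[R]_n)%R.
have slice t y : \1_A (rV_cons (y, t)) = \1_[set y | dotp h' y = c - h 0 ord0 * t]%R y :> R.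
  rewrite !indicE; congr (_%:R); congr (nat_of_bool _).
  apply/idP/idP; rewrite !inE /A/= dotpS => e; first by rewrite -e addrC addKr.
  by rewrite e addrC subrK.
have [h00|hn0] := eqVneq (h 0%R ord0) 0%R.
  have h'n0 : h' != 0%R.
    apply: contra h0 => /eqP e; apply/eqP/rowP => i; rewrite mxE.
    case: (unliftP ord0 i) => [j|] ->//.
    by have /rowP/(_ j) := e; rewrite !mxE.
  rewrite ge0_integral_lebS//.
  apply: integral0_eq => t _; under eq_integral do rewrite slice.
  rewrite integral_indic ?setIT ?IHn//.
  exact: measurable_hyperplane.
rewrite ge0_integral_lebS12//.
apply: integral0_eq => y _.
have slice2 t : \1_A (rV_cons (y, t)) = \1_[set (c - dotp h' y) / h 0 ord0]%R t :> R.
  rewrite !indicE; congr (_%:R); congr (nat_of_bool _).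
  apply/idP/idP; rewrite !inE /A/= dotpS -/h' => e.
    by rewrite -e addrK mulrC mulKf.
  by rewrite e mulrC divfK// subrK.
under eq_integral do rewrite slice2.
by rewrite integral_indic// setIT; exact: lebesgue_measure_set1.
Qed.

End leb_sigma_finite.
Arguments cube {R} n M.

Lemma cvg_rV (R : realType) (T : Type) (F : set_system T) {FF : Filter F} n
  (f : T -> 'rV[R]_n) (l : 'rV[R]_n) :
  (forall i, f x 0 i @[x --> F] --> l 0 i) -> f @ F --> l.
Proof.
move=> h; apply/cvg_ballP => e e0.
have : \forall x \near F, forall i, ball (l 0 i) e (f x 0 i).
  apply: filter_forall => i.
  by have /cvg_ballP := h i; apply.
by apply: filterS => x hx; split => // i j; rewrite (ord1 i).
Qed.

(** * Directional derivatives along slices *)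

Section quotients.
Context {R : realType} (V W : normedModType R) (f : V -> R) (g : W -> R).
Variables (a v : V) (b w : W).
Hypothesis fg : forall h : R, f (h *: v + a) = g (h *: w + b).

Let fg_quotient : (fun h : R => h^-1 *: ((f \o shift a) (h *: v) - f a)) =
  (fun h : R => h^-1 *: ((g \o shift b) (h *: w) - g b)).
Proof. by apply/funext => h /=; have := fg 0; rewrite !scale0r !add0r fg => ->. Qed.

(** A directional derivative sees only the restriction to one line, so it transfers between
    functions on different spaces that agree along the two lines, such as a field and its slices. *)
Lemma derivable_quotient : derivable f a v <-> derivable g b w.
Proof. by rewrite /derivable fg_quotient. Qed.

Lemma derive_quotient : 'D_v f a = 'D_w g b.
Proof. by rewrite /derive fg_quotient. Qed.

End quotients.

Section slices.
Context {R : realType} {n : nat}.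

Lemma continuous_rV_consl (y : 'rV[R]_n) : continuous (fun t : R => rV_cons (y, t)).
Proof.
move=> t; apply: cvg_rV => i.
case: (unliftP ord0 i) => [j|] ->.
  by rewrite rV_consr; under eq_fun do rewrite rV_consr; exact: cvg_cst.
by rewrite rV_consl; under eq_fun do rewrite rV_consl; exact: cvg_id.
Qed.

Lemma continuous_rV_consr (t : R) : continuous (fun y : 'rV[R]_n => rV_cons (y, t)).
Proof.
move=> y; apply: (@cvg_rV _ _ (nbhs y)) => i.
case: (unliftP ord0 i) => [j|] ->.
  by rewrite rV_consr; under eq_fun do rewrite rV_consr; exact: coord_continuous.
by rewrite rV_consl; under eq_fun do rewrite rV_consl; exact: cvg_cst.
Qed.

Lemma rV_consDl (h : R) (y : 'rV[R]_n) (t : R) :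
  h *: delta_mx 0 ord0 + rV_cons (y, t) = rV_cons (y, h + t).
Proof.
apply/rowP => i; rewrite [LHS]mxE [X in X + _]mxE [X in _ * X + _]mxE eqxx /=.
case: (unliftP ord0 i) => [j|] ->.
  by rewrite !rV_consr eq_sym (negPf (neq_lift _ _)) mulr0 add0r.
by rewrite !rV_consl eqxx mulr1.
Qed.

Lemma rV_consDr (h : R) (y : 'rV[R]_n) (t : R) (k : 'I_n) :
  h *: delta_mx 0 (lift ord0 k) + rV_cons (y, t) =
  rV_cons (h *: delta_mx 0 k + y, t).
Proof.
apply/rowP => i; rewrite [LHS]mxE [X in X + _]mxE [X in _ * X + _]mxE eqxx /=.
case: (unliftP ord0 i) => [j|] ->.
  by rewrite !rV_consr !mxE eqxx/= (inj_eq (@lift_inj _ ord0)).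
by rewrite !rV_consl (negPf (neq_lift _ _)) mulr0 add0r.
Qed.

Lemma derivable_slicel (f : 'rV[R]_n.+1 -> R) y t :
  derivable f (rV_cons (y, t)) (delta_mx 0 ord0) ->
  derivable (fun s : R => f (rV_cons (y, s))) t 1.
Proof.
apply: (derivable_quotient _).1 => h.
by rewrite rV_consDl scaler1.
Qed.

Lemma partial_slicel (f : 'rV[R]_n.+1 -> R) y t :
  partial ord0 f (rV_cons (y, t)) = derive1 (fun s : R => f (rV_cons (y, s))) t.
Proof.
rewrite derive1E /partial; apply: derive_quotient => h.
by rewrite rV_consDl scaler1.
Qed.

Lemma derivable_slicer (f : 'rV[R]_n.+1 -> R) y t (k : 'I_n) :
  derivable f (rV_cons (y, t)) (delta_mx 0 (lift ord0 k)) ->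
  derivable (fun z : 'rV[R]_n => f (rV_cons (z, t))) y (delta_mx 0 k).
Proof. by apply: (derivable_quotient _).1 => h; rewrite rV_consDr. Qed.

Lemma partial_slicer (f : 'rV[R]_n.+1 -> R) y t (k : 'I_n) :
  partial (lift ord0 k) f (rV_cons (y, t)) =
  partial k (fun z : 'rV[R]_n => f (rV_cons (z, t))) y.
Proof. by apply: derive_quotient => h; rewrite rV_consDr. Qed.

Lemma cube_slice (M : R) (y : 'rV[R]_n) t :
  cube n.+1 M (rV_cons (y, t)) <-> cube n M y /\ `|t| <= M.
Proof.
split=> [/cubeP h|[/cubeP h1 h2]].
  split; last by have := h ord0; rewrite rV_consl.
  by apply/cubeP => i; have := h (lift ord0 i); rewrite rV_consr.
apply/cubeP => i; case: (unliftP ord0 i) => [j|] ->; last by rewrite rV_consl.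
by rewrite rV_consr.
Qed.

End slices.

(** * Compact supports and vanishing integrals of derivatives *)

Section compact_support.
Context {R : realType} {n : nat}.
Implicit Types (f g : 'rV[R]_n -> R) (M : R).

Lemma closed_cbox (a b : 'rV[R]_n) : closed (cbox a b).
Proof.
rewrite cboxE; apply: closed_bigI => i _.
apply: closed_comp; last exact: interval_closed.
by move=> x _; exact: coord_continuous.
Qed.

Lemma compact_cbox (a b : 'rV[R]_n) : compact (cbox a b).
Proof.
apply: bounded_closed_compact; last first.
  exact: closed_cbox.
pose M := \sum_i (`|a 0 i| + `|b 0 i|).
exists M; split; first exact: num_real.
move=> N MN x xab /=.
have M0 : 0 <= M by apply: sumr_ge0 => i _; rewrite addr_ge0.
rewrite [leLHS]mx_normrE; apply: bigmax_le => [|[i j] _ /=].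
  exact: le_trans M0 (ltW MN).
apply: le_trans (ltW MN); rewrite (ord1 i) /M (bigD1 j)//=.
have rest : 0 <= \sum_(i < n | i != j) (`|a 0 i| + `|b 0 i|).
  by apply: sumr_ge0 => k _; rewrite addr_ge0.
have /andP[h1 h2] := xab j.
have h3 := ler_norm (b 0 j); have h4 := lerNnormlW (lexx `|a 0 j|).
have h5 := normr_ge0 (a 0 j); have h6 := normr_ge0 (b 0 j).
by rewrite ler_norml; apply/andP; split; lra.
Qed.

Lemma bounded_cube (w : set 'rV[R]_n) : bounded_set w -> exists M, w `<=` cube n M.
Proof.
move=> [M [_ MP]]; exists (`|M| + 1) => x wx; apply/cubeP => i.
have MM : M < `|M| + 1 by apply: le_lt_trans (ler_norm _) _; rewrite ltrDl.
apply: le_trans (MP _ MM x wx); rewrite [leRHS]mx_normrE.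
exact: (@le_bigmax _ _ _ 0 (fun ij : 'I_1 * 'I_n => `|x ij.1 ij.2|) (0, i)).
Qed.

Lemma integrable_compact_supp g M : continuous g ->
  (forall x, ~ cube n M x -> g x = 0) -> (leb n).-integrable setT (EFin \o g).
Proof.
move=> cg g0; have mg := continuous_rV_measurable cg.
have mC : measurable (cube n M : set 'rV[R]_n) by exact: measurable_cbox.
suff Ig : (leb n).-integrable (cube n M) (EFin \o g).
  move: Ig => /(integrable_mkcond _ mC); rewrite (_ : patch _ _ _ = EFin \o g)//.
  apply/funext => x; rewrite patchE; case: ifPn => //=.
  by rewrite notin_setE => /g0 ->.
apply: measurable_bounded_integrable => //.
- exact: leb_cube.
- exact: measurable_funTS.
- have : compact (g @` cube n M).
    apply: continuous_compact; last exact: compact_cbox.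
    exact: continuous_subspaceT.
  move/compact_bounded => [B [Br BP]]; exists B; split => // B' BB' x Cx.
  by apply: (BP B' BB'); exists x.
Qed.

Lemma partial_out (U : set 'rV[R]_n) f k x : open U -> U x ->
  (forall y, U y -> f y = 0) -> partial k f x = 0.
Proof.
move=> oU Ux f0; rewrite /partial -[RHS](derive_cst 0 x (delta_mx ord0 k)).
apply: near_eq_derive.
by apply: filterS (open_nbhs_nbhs (conj oU Ux)) => y Uy; rewrite f0.
Qed.

Lemma partial_supp (K : set 'rV[R]_n) f k x : closed K ->
  (forall y, ~ K y -> f y = 0) -> ~ K x -> partial k f x = 0.
Proof. by move=> /closed_openC cK f0 Kx; exact: (partial_out k cK Kx). Qed.

End compact_support.

Lemma integral_derive1_supp (R : realType) (h : R -> R) (M : R) :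
  (forall t, derivable h t 1) -> continuous (derive1 h) ->
  (forall t, ~ (`|t| <= M) -> h t = 0) ->
  (\int[lebesgue_measure]_t (derive1 h t)%:E = 0)%E.
Proof.
move=> dh ch' h0.
(* Strictly beyond the support and positive: [h] vanishes at both ends of [[- N, N]], and the
   interval is not degenerate. *)
pose N := `|M| + 1.
have MN : M < N by apply: le_lt_trans (ler_norm _) _; rewrite ltrDl.
have N0 : 0 < N by rewrite ltr_wpDl.
have hc : continuous h by move=> t; apply: differentiable_continuous; apply/derivable1_diffP.
have h'0 t : ~ (`|t| <= M) -> derive1 h t = 0.
  move=> tM; rewrite derive1E -[RHS](derive_cst 0 t 1).
  apply: near_eq_derive.
  have oU : open [set t : R | M < `|t|].
    rewrite (_ : [set t | _] = (fun u : R => `|u|) @^-1` `]M, +oo[%classic); last first.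
      by apply/seteqP; split=> u /=; rewrite in_itv/= andbT.
    by apply: open_comp => //; move=> u _; exact: norm_continuous.
  have Ut : [set t : R | M < `|t|] t by rewrite /= ltNge; apply/negP.
  apply: filterS (open_nbhs_nbhs (conj oU Ut)) => u /= Uu.
  by rewrite h0//; apply/negP; rewrite -ltNge.
have -> : (fun t => (derive1 h t)%:E) = (fun t => (derive1 h t)%:E) \_ `[- N, N]%classic.
  apply/funext => t; rewrite patchE; case: ifPn => //=.
  rewrite notin_setE /= in_itv/= => tN; rewrite h'0//.
  by move=> tM; apply: tN; rewrite -ler_norml; apply: le_trans tM (ltW MN).
rewrite -integral_mkcond (@continuous_FTC2 _ _ h).
- rewrite !h0 ?subee//; apply/negP; rewrite -ltNge ?normrN ger0_norm// ltW//.
- by rewrite gtrN.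
- exact: continuous_subspaceT.
- split; [by move=> t _; exact: dh| |].
    by apply: cvg_at_right_filter; exact: hc.
  by apply: cvg_at_left_filter; exact: hc.
- by [].
Qed.

(** By Fubini, a derivative in the leading coordinate is integrated in that variable first; for any
    other coordinate the leading one is frozen and the induction hypothesis applies to the slice. *)
Lemma integral_partial0 (R : realType) n (k : 'I_n) (f : 'rV[R]_n -> R) M :
  (forall x, derivable f x (delta_mx 0 k)) -> continuous (partial k f) ->
  (forall x, ~ cube n M x -> f x = 0) ->
  (\int[leb n]_x (partial k f x)%:E = 0)%E.
Proof.
elim: n k f => [[]//|n IHn] k f df cf f0.
have Ip : (leb n.+1).-integrable setT (EFin \o partial k f).
  apply: (@integrable_compact_supp _ _ _ M) => // x; apply: partial_supp => //.
  exact: closed_cbox.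
move: df cf Ip; case: (unliftP ord0 k) => [j|] -> df cf Ip.
  rewrite integral_lebS21//; apply: integral0_eq => t _.
  under eq_integral do rewrite partial_slicer.
  apply: IHn => [y|y|y My].
  - by apply: derivable_slicer; exact: df.
  - rewrite (_ : partial _ _ = fun y => partial (lift ord0 j) f (rV_cons (y, t))); last first.
      by apply/funext => z; rewrite partial_slicer.
    by apply: continuous_comp; [exact: continuous_rV_consr|exact: cf].
  - by apply: f0 => /cube_slice[].
rewrite integral_lebS12//; apply: integral0_eq => y _.
under eq_integral do rewrite partial_slicel.
apply: (@integral_derive1_supp _ _ M) => [t|t|t tM].
- by apply: derivable_slicel; exact: df.
- rewrite (_ : derive1 _ = fun t => partial ord0 f (rV_cons (y, t))); last first.
    by apply/funext => z; rewrite partial_slicel.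
  by apply: continuous_comp; [exact: continuous_rV_consl|exact: cf].
- by apply: f0 => /cube_slice[].
Qed.

(** * Square integrable functions and fields *)

Section square_integrable.
Context {d : measure_display} {T : measurableType d} {R : realType}.
Variables (mu : {measure set T -> \bar R}) (w : set T).
Hypothesis mw : measurable w.
Implicit Types f g : T -> R.

Definition sqint f :=
  measurable_fun w f /\ mu.-integrable w (EFin \o (fun x => f x ^+ 2)).

Definition sqip f g : R := \int[mu]_(x in w) (f x * g x).

Lemma sqintP f : f \_ w \in Lfun mu 2%:E <-> sqint f.
Proof.
have mfw : measurable_fun w f <-> measurable_fun setT (f \_ w).
  rewrite -(measurable_restrictT f mw).
  by split.
have sqE : (EFin \o (fun x => f x ^+ 2)) \_ w = EFin \o (fun x => (f \_ w) x ^+ 2).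
  apply/funext => x; rewrite /= !patchE; case: ifPn => // _.
  by rewrite /point/= expr0n.
split.
  move=> fL; split.
    by apply/mfw; move: fL; rewrite inE => /andP[] /[!inE].
  apply/(integrable_mkcond _ mw); rewrite sqE.
  exact: Lfun2_integrable_sqr.
move=> [/mfw mf /(integrable_mkcond _ mw)]; rewrite sqE => fi.
rewrite inE; apply/andP; split; rewrite inE//=.
rewrite /finite_norm unlock /Lnorm poweR_lty//.
have /integrableP[_] := fi; apply: le_lt_trans; apply: ge0_le_integral => //.
- by move=> x _; rewrite lee_fin powR_ge0.
- apply/measurable_EFinP; apply: (measurableT_comp (measurable_powR _)).
  exact: measurableT_comp.
- by apply: measurableT_comp => //; case/integrableP : fi.
- move=> x _; rewrite /= lee_fin powR_mulrn// real_normK ?num_real//.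
  by rewrite ler_norm.
Qed.

Lemma sqint_mul f g : sqint f -> sqint g ->
  mu.-integrable w (EFin \o (fun x => f x * g x)).
Proof.
move=> [mf fi] [mg gi].
apply: (@le_integrable _ _ _ mu w mw _ (EFin \o (fun x => f x ^+ 2 + g x ^+ 2))).
- by apply/measurable_EFinP; exact: measurable_realfun.measurable_funM.
- move=> x _ /=; rewrite lee_fin normrM [leRHS]ger0_norm ?addr_ge0 ?sqr_ge0//.
  rewrite -(real_normK (num_real (f x))) -(real_normK (num_real (g x))).
  have := sqr_ge0 (`|f x| - `|g x|); have := normr_ge0 (f x).
  have := normr_ge0 (g x); move: `|f x| `|g x| => a b; rewrite !expr2; nra.
- by rewrite (_ : EFin \o _ = (EFin \o (fun x => f x ^+ 2)%R) \+ (EFin \o (fun x => g x ^+ 2)%R))%E;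
    [exact: integrableD|apply/funext].
Qed.

Lemma sqint0 : sqint 0.
Proof.
split; first exact: measurable_cst.
rewrite (_ : EFin \o _ = cst 0%E); first exact: integrable0.
by apply/funext => x /=; rewrite expr0n.
Qed.

Lemma sqintZ k f : sqint f -> sqint (k *: f).
Proof.
move=> [mf fi]; split; first by apply: measurable_realfun.measurable_funM.
rewrite (_ : EFin \o _ = (fun x => (k ^+ 2)%:E * (EFin \o (fun x => f x ^+ 2)%R) x))%E.
  exact: integrableZl.
by apply/funext => x /=; rewrite -EFinM -exprMn.
Qed.

Lemma sqintD f g : sqint f -> sqint g -> sqint (f + g).
Proof.
move=> hf hg; have [mf fi] := hf; have [mg gi] := hg.
split; first exact: measurable_realfun.measurable_funD.
have fg := sqint_mul hf hg.
rewrite (_ : EFin \o _ = (EFin \o (fun x => f x ^+ 2)%R) \+ (fun x => 2%:E * (EFin \o (fun x => f x * g x)%R) x)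
   \+ (EFin \o (fun x => g x ^+ 2)%R))%E.
  apply: integrableD => //; apply: integrableD => //; exact: integrableZl.
apply/funext => x /=; rewrite -EFinM -!EFinD; congr EFin.
by rewrite [(f + g) x]/(f x + g x) sqrrD -mulr_natl.
Qed.

Lemma semi_ip_sqip : semi_ip sqint sqip.
Proof.
split.
- exact: sqint0.
- by move=> k f g hf hg; apply: sqintD => //; exact: sqintZ.
- by move=> f g _ _; rewrite /sqip; under eq_Rintegral do rewrite mulrC.
- move=> k f g h hf hg hh; rewrite /sqip.
  rewrite -RintegralZl//; last exact: sqint_mul.
  rewrite -RintegralD//; last 2 first.
  + rewrite (_ : EFin \o _ = (fun x => k%:E * (EFin \o (fun x => f x * h x)%R) x)%E)//.
    by apply: integrableZl => //; exact: sqint_mul.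
  + exact: sqint_mul.
  apply: eq_Rintegral => x _.
  by rewrite [(k *: f + g) x]/(k * f x + g x) mulrDl mulrA.
- by move=> f _; apply: Rintegral_ge0 => x _; rewrite -expr2 sqr_ge0.
Qed.

Lemma sqipE f : sqint f -> (sqip f f)%:E = (\int[mu]_(x in w) (f x ^+ 2)%:E)%E.
Proof.
move=> hf; rewrite /sqip /Rintegral fineK.
  by apply: eq_integral => x _; rewrite expr2.
by apply: integrable_fin_num => //; exact: sqint_mul.
Qed.

Lemma sqip_eq0 f : sqint f -> sqip f f = 0 -> ae_eq mu w f (cst 0).
Proof.
move=> hf h0; have h := congr1 EFin h0; rewrite sqipE// in h.
have mf2 : measurable_fun w (fun x => (f x ^+ 2)%:E) by case/integrableP : hf.2.
have : (\int[mu]_(x in w) `|(f x ^+ 2)%:E| = 0)%E.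
  transitivity (\int[mu]_(x in w) (f x ^+ 2)%:E)%E => //.
  by apply: eq_integral => x _; rewrite gee0_abs// lee_fin sqr_ge0.
move/(ae_eq_integral_abs mu mw mf2); apply: filterS => x /= fx0 wx.
by have /eqP := fx0 wx; rewrite eqe sqrf_eq0 => /eqP.
Qed.

Lemma sqip_ae f f' g : sqint f -> sqint f' -> sqint g -> ae_eq mu w f f' ->
  sqip f g = sqip f' g.
Proof.
move=> hf hf' hg ff'; rewrite /sqip /Rintegral; congr fine.
apply: ae_eq_integral => //; first by case/integrableP : (sqint_mul hf hg).
  by case/integrableP : (sqint_mul hf' hg).
by apply: filterS ff' => x /= e wx; rewrite e.
Qed.

End square_integrable.

(** * Completeness of square integrable functions *)

Section riesz_fischer.
Context {d : measure_display} {T : measurableType d} {R : realType}.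
Variables (mu : {measure set T -> \bar R}) (w : set T).
Hypotheses (mw : measurable w) (fw : (mu w < +oo)%E).
Implicit Types f g : T -> R.

Let S := sqint mu w.
Let a := sqip mu w.

Let absE (x : R) k : ((`|x|)%:E <= (2 ^+ k * x ^+ 2 + 2 ^- k)%:E)%E.
Proof.
rewrite lee_fin -(real_normK (num_real x)).
have h : 2 ^- k * 2 ^+ k = 1 :> R by rewrite mulVf// expf_neq0.
have h1 : 0 < 2 ^+ k :> R by rewrite exprn_gt0.
have h2 : 0 < 2 ^- k :> R by rewrite invr_gt0.
have := normr_ge0 x; move: `|x| (2 ^+ k) (2 ^- k) h h1 h2 => y A B h h1 h2 y0.
have : 0 <= B * (A * y - 1) ^+ 2 by rewrite mulr_ge0 ?sqr_ge0// ltW.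
have -> : B * (A * y - 1) ^+ 2 = A * y ^+ 2 * (B * A) - 2 * (B * A) * y + B by ring.
by rewrite h mulr1; lra.
Qed.

(* The integral of each increment is at most 2 ^- k * (1 + c), because
   |x| <= 2 ^+ k * x ^+ 2 + 2 ^- k. *)
Lemma rapid_cvg (v : nat -> T -> R) : (forall k, S (v k)) ->
  (forall k, a (v k.+1 - v k) (v k.+1 - v k) <= 4 ^- k) ->
  {ae mu, forall x, w x -> cvgn (v ^~ x)}.
Proof.
move=> Sv rv.
have SvB k : S (v k.+1 - v k).
  exact: (sipB (semi_ip_sqip mu mw) (Sv k.+1) (Sv k)).
have [c c0 muc] : exists2 c : R, 0 <= c & (mu w <= c%:E)%E.
  exists (fine (mu w)); first by rewrite fine_ge0.
  by rewrite fineK// ge0_fin_numE.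
pose D k x : \bar R := (`|v k.+1 x - v k x|)%:E.
have D0 k x : (0 <= D k x)%E by rewrite lee_fin.
have mD k : measurable_fun w (D k).
  apply/measurable_EFinP; apply: measurableT_comp => //.
  by apply: measurable_realfun.measurable_funB; [case: (Sv k.+1)|case: (Sv k)].
have ID k : (\int[mu]_(x in w) D k x <= (2 ^- k * (1 + c))%:E)%E.
  have m2 : measurable_fun w (fun x => (((v k.+1 - v k) x) ^+ 2)%:E).
    by case/integrableP : (SvB k).2.
  have p2 : 0 <= 2 ^+ k :> R by rewrite exprn_ge0.
  have n2 : 0 <= 2 ^- k :> R by rewrite invr_ge0.
  have s2 x : (0 <= (((v k.+1 - v k) x) ^+ 2)%:E)%E by rewrite lee_fin sqr_ge0.
  have ps2 x : (0 <= (2 ^+ k)%:E * (((v k.+1 - v k) x) ^+ 2)%:E)%E.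
    by rewrite mule_ge0.
  have pm2 : measurable_fun w (fun x => (2 ^+ k)%:E * (((v k.+1 - v k) x) ^+ 2)%:E)%E.
    exact: emeasurable_funM.
  apply: (@le_trans _ _ (2 ^+ k * a (v k.+1 - v k) (v k.+1 - v k) + 2 ^- k * c)%:E).
    apply: (@le_trans _ _ ((2 ^+ k)%:E * (\int[mu]_(x in w) (((v k.+1 - v k) x) ^+ 2)%:E)
       + (2 ^- k)%:E * mu w)%E); last first.
      rewrite -(sqipE mw (SvB k)) EFinD !EFinM; apply: leeD2l.
      by rewrite lee_wpmul2l// lee_fin.
    rewrite -integral_cst// -ge0_integralZl// -ge0_integralD//.
    apply: ge0_le_integral => //.
      by apply: emeasurable_funD.
    by move=> x _; rewrite -EFinM -EFinD; exact: absE.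
  rewrite lee_fin mulrDr mulr1 lerD2r.
  apply: (@le_trans _ _ (2 ^+ k * 4 ^- k)).
    by rewrite ler_wpM2l ?exprn_ge0//; exact: rv.
  have -> : 4 = 2 * 2 :> R by ring.
  by rewrite exprMn invfM mulrA divff ?mul1r// expf_neq0.
have sumD : (\int[mu]_(x in w) (\sum_(k <oo) D k x) < +oo)%E.
  rewrite integral_nneseries//; apply: (@le_lt_trans _ _
      (\sum_(k <oo) (2 ^- k * (1 + c))%:E)%E).
    by apply: lee_nneseries => // k _ _; apply: integral_ge0.
  apply: le_lt_trans (ltry (2 * (1 + c))).
  have c1 : 0 <= 2 * (1 + c) by rewrite mulr_ge0// addr_ge0.
  apply: le_trans (epsilon_trick0 predT c1); rewrite le_eqVlt; apply/orP; left.
  apply/eqP; apply: eq_eseriesr => k _; congr EFin.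
  rewrite natrX exprS; set A := 1 + _.
  by field; rewrite expf_neq0.
have : {ae mu, forall x, w x -> (\sum_(k <oo) D k x)%E \is a fin_num}.
  apply: integrable_ae => //; apply/integrableP; split.
    by apply: ge0_emeasurable_sum.
  move: sumD; congr (_ < _)%E; apply: eq_integral => x _.
  by rewrite gee0_abs//; apply: nneseries_ge0.
apply: filterS => x hx wx.
have fin := hx wx.
have : cvgn (series (fun k => `|v k.+1 x - v k x|)).
  by apply: nnseries_is_cvg => //; rewrite ltey_eq fin.
move/(@normed_cvg _ R (fun k => v k.+1 x - v k x)).
rewrite (_ : series _ = fun n => v n x - v 0%N x); last first.
  exact: (telescopeK (v ^~ x)).
move=> cv; rewrite (_ : v ^~ x = (fun n => v n x - v 0%N x) + cst (v 0%N x)).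
  by apply: is_cvgD => //; exact: is_cvg_cst.
by apply/funext => n; rewrite fctE subrK.
Qed.

(** A rapidly convergent subsequence has a limit almost everywhere, and Fatou's lemma turns the
    Cauchy estimate into convergence of the whole sequence to it. *)
Lemma complete_sqip : complete_ip S a.
Proof.
move=> u Su uc.
have sip := semi_ip_sqip mu mw.
have /choice[N NP] k : exists N, forall m n, (N <= m)%N -> (N <= n)%N ->
    a (u m - u n) (u m - u n) < 4 ^- k.
  by apply: uc; rewrite invr_gt0 exprn_gt0.
(* The maximum makes [M] monotone and at least [N k]; the summand [k] gives [k <= M k], so that
   [key] may compare [u n] with [v k] as soon as [n <= k]. *)
pose M k := (k + \max_(j < k.+1) N j)%N.
have NM k : (N k <= M k)%N by apply: leq_trans (leq_addl _ _); exact: (leq_bigmax (@ord_max k)).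
have MS k : (M k <= M k.+1)%N by rewrite /M [in leqRHS]big_ord_recr /= leq_add// leq_maxl.
pose v k := u (M k).
have Sv k : S (v k) by exact: Su.
have vae := @rapid_cvg v Sv.
have {}vae : {ae mu, forall x, w x -> cvgn (v ^~ x)}.
  by apply: vae => k; apply: ltW; apply: NP => //; apply: leq_trans (MS k).
(* The upper limit is measurable whether or not the sequence converges, and it is the limit at
   almost every point of [w]. *)
pose f x := fine (limn_esup (fun k => (v k x)%:E)).
have fv : {ae mu, forall x, w x -> v ^~ x @ \oo --> f x}.
  apply: filterS vae => x h wx; have /cvg_ex[/= l vl] := h wx.
  suff -> : f x = l by [].
  rewrite /f (cvg_limn_einf_sup (_ : _ --> l%:E)).2//.
  by apply: cvg_EFin => //; near=> k.
have mf : measurable_fun w f.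
  apply: (measurableT_comp (fine_measurable measurableT)).
  apply: measurable_fun_limn_esup => k; apply/measurable_EFinP.
  by case: (Sv k).
have key n e : (forall k, (n <= k)%N -> a (u n - u k) (u n - u k) <= e) ->
    (\int[mu]_(x in w) ((u n x - f x) ^+ 2)%:E <= e%:E)%E.
  move=> ne.
  have mh k : measurable_fun w (fun x => ((u n x - v k x) ^+ 2)%:E).
    apply/measurable_EFinP; apply: measurable_realfun.measurable_funX.
    by apply: measurable_realfun.measurable_funB; [case: (Su n)|case: (Sv k)].
  apply: (@le_trans _ _ (\int[mu]_(x in w)
      limn_einf (fun k => ((u n x - v k x) ^+ 2)%:E))%E).
    rewrite le_eqVlt; apply/orP; left; apply/eqP.
    apply: ae_eq_integral => //.
    + apply/measurable_EFinP; apply: measurable_realfun.measurable_funX.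
      by apply: measurable_realfun.measurable_funB => //; case: (Su n).
    + apply: (measurableT_comp (@oppe_measurable R setT)).
      apply: measurable_fun_limn_esup => k.
      exact: (measurableT_comp (@oppe_measurable R setT)).
    + apply: filterS fv => x h wx; rewrite (cvg_limn_einf_sup (_ : _ --> ((u n x - f x) ^+ 2)%:E)).1//.
      apply: cvg_EFin; first by near=> k.
      rewrite /comp /=; apply: cvgM; (apply: cvgB; first exact: cvg_cst); exact: h.
  apply: le_trans; first apply: fatou => //.
    by move=> k x _; rewrite lee_fin sqr_ge0.
  rewrite limn_einf_lim; apply: lime_le; first exact: is_cvg_einfs.
  exists n => // k /= nk; apply: (@le_trans _ _ (\int[mu]_(x in w) ((u n x - v k x) ^+ 2)%:E)%E).
    by apply: ereal_inf_lbound; exists k => /=.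
  have Snk : S (u n - v k) by exact: (sipB sip (Su n) (Sv k)).
  rewrite -(sqipE mw Snk) lee_fin; apply: ne.
  exact: leq_trans nk (leq_addr _ _).
have SB n e : (forall k, (n <= k)%N -> a (u n - u k) (u n - u k) <= e) -> S (u n - f).
  move=> ne; split; first by apply: measurable_realfun.measurable_funB => //; case: (Su n).
  apply/integrableP; split.
    apply/measurable_EFinP; apply: measurable_realfun.measurable_funX.
    by apply: measurable_realfun.measurable_funB => //; case: (Su n).
  apply: le_lt_trans (ltry e); apply: le_trans (key n e ne).
  rewrite le_eqVlt; apply/orP; left; apply/eqP; apply: eq_integral => x _.
  by rewrite gee0_abs// lee_fin sqr_ge0.
have Sf : S f.
  have [N0 N0P] := uc 1 ltr01.
  have h : S (u N0 - f).
    by apply: (SB N0 1) => k k0; apply: ltW; exact: N0P.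
  have -> : f = u N0 - (u N0 - f) by rewrite subKr.
  exact: (sipB sip (Su N0) h).
exists f => // e e0; have e2 : 0 < e / 2 by rewrite divr_gt0.
have [N1 N1P] := uc _ e2; exists N1 => n nN.
have ne k : (n <= k)%N -> a (u n - u k) (u n - u k) <= e / 2.
  by move=> nk; apply: ltW; apply: N1P => //; exact: leq_trans nk.
have := key n _ ne; rewrite -[leLHS](sqipE mw (SB n _ ne)) lee_fin => h.
by apply: le_lt_trans h _; lra.
Unshelve. all: by end_near. Qed.

End riesz_fischer.

(** * Square integrable matrix fields *)

Section L2_fields.
Context {R : realType} {d p q : nat}.
Implicit Types (w : set 'rV[R]_d) (F G H : 'rV[R]_d -> 'M[R]_(p, q)).

Let entry F i j : 'rV[R]_d -> R := fun x => F x i j.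

Lemma L2P w F : measurable w ->
  L2 w F <-> forall i j, sqint (leb d) w (entry F i j).
Proof. by move=> mw; split=> h i j; have /(sqintP _ mw) := h i j. Qed.

Section fixed_domain.
Variable w : set 'rV[R]_d.
Hypothesis mw : measurable w.

Lemma ipE F G : L2 w F -> L2 w G ->
  ip w F G = \sum_i \sum_j sqip (leb d) w (entry F i j) (entry G i j).
Proof.
move=> /(L2P _ mw) hF /(L2P _ mw) hG; rewrite /ip /Rintegral.
have I i j : (leb d).-integrable w (EFin \o (fun x => F x i j * G x i j)).
  by apply: (@sqint_mul _ _ _ (leb d) w mw (entry F i j) (entry G i j)).
have I2 i : (leb d).-integrable w (fun x => \sum_j (F x i j * G x i j)%:E)%E.
  apply: (@integrable_sum _ _ _ _ w mw _ _ _ (fun j x => (F x i j * G x i j)%:E)).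
  by move=> j _; exact: I.
rewrite (eq_integral (fun x => \sum_i \sum_j ((F x i j * G x i j)%:E))%E); last first.
  by move=> x _ /=; rewrite -sumEFin; apply: eq_bigr => i _; rewrite -sumEFin.
rewrite integral_sum//.
transitivity (fine (\sum_i \sum_j sqip (leb d) w (entry F i j) (entry G i j))%:E) => //.
congr fine; rewrite -sumEFin; apply: eq_bigr => i _.
rewrite -sumEFin integral_sum//; last by move=> j; exact: I.
apply: eq_bigr => j _.
rewrite /sqip /Rintegral fineK//.
by apply: integrable_fin_num => //; exact: I.
Qed.

Let sip := semi_ip_sqip (leb d) mw.

Lemma semi_ip_L2 : semi_ip (@L2 R d p q w) (ip w).
Proof.
have L20 : L2 w (0 : 'rV[R]_d -> 'M[R]_(p, q)).
  apply/(L2P _ mw) => i j; rewrite (_ : entry _ _ _ = 0); first exact: sqint0.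
  by apply/funext => x; rewrite /entry mxE.
have eL k F G i j : entry (k *: F + G) i j = k *: entry F i j + entry G i j.
  by apply/funext => x; rewrite /entry !mxE.
have L2L k F G : L2 w F -> L2 w G -> L2 w (k *: F + G).
  move=> /(L2P _ mw) hF /(L2P _ mw) hG; apply/(L2P _ mw) => i j; rewrite eL.
  exact: (sipL sip).
split=> //.
- move=> F G hF hG; rewrite !ipE//; apply: eq_bigr => i _; apply: eq_bigr => j _.
  by apply: (sipC sip); [have /(L2P _ mw) := hF|have /(L2P _ mw) := hG].
- move=> k F G H hF hG hH; rewrite !ipE//; last exact: L2L.
  rewrite mulr_sumr -big_split/=; apply: eq_bigr => i _.
  rewrite mulr_sumr -big_split/=; apply: eq_bigr => j _.
  rewrite eL; apply: (sip_linear sip).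
  + by have /(L2P _ mw) := hF.
  + by have /(L2P _ mw) := hG.
  + by have /(L2P _ mw) := hH.
- move=> F hF; rewrite ipE//; apply: sumr_ge0 => i _; apply: sumr_ge0 => j _.
  by apply: (sip_ge0 sip); have /(L2P _ mw) := hF.
Qed.

Lemma sqip_le_ip F i j : L2 w F ->
  sqip (leb d) w (entry F i j) (entry F i j) <= ip w F F.
Proof.
move=> hF; have /(L2P _ mw) hF' := hF; rewrite ipE// (bigD1 i)//= (bigD1 j)//=.
rewrite -addrA lerDl addr_ge0//; apply: sumr_ge0 => k _.
  exact: (sip_ge0 sip).
by apply: sumr_ge0 => l _; exact: (sip_ge0 sip).
Qed.

Lemma complete_ip_L2 : (leb d w < +oo)%E -> complete_ip (@L2 R d p q w) (ip w).
Proof.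
move=> fw u Su uc; have sL := semi_ip_L2.
have cS i j : exists f, sqint (leb d) w f /\ forall e : R, 0 < e ->
    exists N, forall n, (N <= n)%N ->
    sqip (leb d) w (entry (u n) i j - f) (entry (u n) i j - f) < e.
  have Se n : sqint (leb d) w (entry (u n) i j) by have /(L2P _ mw) := Su n.
  have [|f Sf fP] := complete_sqip mw fw Se; last by exists f.
  move=> e e0; have [N NP] := uc e e0; exists N => m n Nm Nn.
  apply: le_lt_trans (NP m n Nm Nn).
  have -> : entry (u m) i j - entry (u n) i j = entry (u m - u n) i j.
    by apply/funext => x; rewrite /entry !mxE.
  by apply: sqip_le_ip; exact: (sipB sL).
have /choice[f fP] (ij : 'I_p * 'I_q) := cS ij.1 ij.2.
pose F : 'rV[R]_d -> 'M[R]_(p, q) := fun x => \matrix_(i, j) f (i, j) x.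
have eF i j : entry F i j = f (i, j) by apply/funext => x; rewrite /entry mxE.
have hF : L2 w F by apply/(L2P _ mw) => i j; rewrite eF; exact: (fP (i, j)).1.
exists F => // e e0.
(* Each of the [p * q] entries is allowed an error [e / c]; the [+ 1] makes the total strictly
   smaller than [e] and keeps [c] positive. *)
pose c : R := (p * q)%:R + 1.
have c0 : 0 < c by rewrite ltr_wpDl.
have /choice[N NP] ij := (fP ij).2 _ (divr_gt0 e0 c0).
exists (\max_ij N ij) => n Nn.
rewrite ipE//; try by apply: (sipB sL).
apply: (@le_lt_trans _ _ (\sum_(i < p) \sum_(j < q) (e / c))).
  apply: ler_sum => i _; apply: ler_sum => j _; apply: ltW.
  have -> : entry (u n - F) i j = entry (u n) i j - f (i, j).
    rewrite -eF; apply/funext => x; rewrite [RHS]/(entry (u n) i j x - entry F i j x).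
    by rewrite /entry [LHS]mxE [X in _ + X]mxE.
  by apply: (NP (i, j)); apply: leq_trans Nn; exact: leq_bigmax.
under eq_bigr do rewrite sumr_const card_ord.
rewrite sumr_const card_ord -mulrnA -mulr_natr mulrAC ltr_pdivrMr//.
by rewrite ltr_pM2l// mulnC ltrDl.
Qed.

Lemma ip_eq0 F : L2 w F -> ip w F F = 0 -> aeeq w F 0.
Proof.
move=> hF F0; have /(L2P _ mw) hF' := hF.
have e0 i j : ae_eq (leb d) w (entry F i j) (cst 0).
  apply: sqip_eq0 => //; apply/eqP; rewrite eq_le (sip_ge0 sip)// andbT.
  by rewrite -F0; exact: sqip_le_ip.
have : {ae leb d, forall x, forall ij : 'I_p * 'I_q, w x -> entry F ij.1 ij.2 x = 0}.
  by apply: filter_forall => -[i j]; exact: e0.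
by apply: filterS => x h wx; apply/matrixP => i j; rewrite mxE; exact: (h (i, j)).
Qed.

Lemma ip_ae F F' G : L2 w F -> L2 w F' -> L2 w G -> aeeq w F F' ->
  ip w F G = ip w F' G.
Proof.
move=> hF hF' hG FF'; rewrite !ipE//; apply: eq_bigr => i _; apply: eq_bigr => j _.
move: hF hF' hG => /(L2P _ mw) hF /(L2P _ mw) hF' /(L2P _ mw) hG.
by apply: sqip_ae => //; apply: filterS FF' => x /= e wx; rewrite /entry e.
Qed.

End fixed_domain.

Lemma L2S w w' F : measurable w -> measurable w' -> w' `<=` w -> L2 w F -> L2 w' F.
Proof.
move=> mw mw' ww' /(L2P _ mw) hF; apply/(L2P _ mw') => i j.
have [mF iF] := hF i j; split; first exact: (measurable_funS mw ww').
exact: (integrableS mw mw' ww').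
Qed.

(** Extension by zero rewrites an integral over a subset as an inner product on the large set, where
    bilinearity is available. *)
Definition cut w F : 'rV[R]_d -> 'M[R]_(p, q) := fun x => if x \in w then F x else 0.

Lemma cut_in w F x : w x -> cut w F x = F x.
Proof. by move=> wx; rewrite /cut mem_set. Qed.

Lemma cut_out w F x : ~ w x -> cut w F x = 0.
Proof. by move=> wx; rewrite /cut memNset. Qed.

Lemma L2_cut w w' F : measurable w -> measurable w' -> w' `<=` w ->
  L2 w' F -> L2 w (cut w' F).
Proof.
move=> mw mw' ww' hF i j.
have /sub_Lfun_mfun := hF i j.
rewrite (_ : _ \_ w = (entry F i j) \_ w'); first by move=> _; exact: hF.
apply/funext => x; rewrite !patchE; case: ifPn => [xw|xw].
  rewrite /cut; case: ifPn => //; by rewrite mxE.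
case: ifPn => // xw'; move: xw; rewrite notin_setE => -[]; apply: ww'.
exact: set_mem.
Qed.

Lemma ip_cut w w' F G : w' `<=` w -> ip w' F G = ip w F (cut w' G).
Proof.
move=> ww'; rewrite /ip Rintegral_mkcond [RHS]Rintegral_mkcond; congr Rintegral.
apply/funext => x; rewrite !patchE.
have [xw'|xw'] := boolP (x \in w').
  rewrite mem_set; last by apply: ww'; exact: set_mem.
  by rewrite cut_in//; exact: set_mem.
case: ifP => // _; rewrite cut_out; last by rewrite notin_setE in xw'.
by rewrite big1// => i _; rewrite big1// => j _; rewrite mxE mulr0.
Qed.

Lemma ip_supp w w' F G : w' `<=` w -> (forall x, ~ w' x -> G x = 0) ->
  ip w' F G = ip w F G.
Proof.
move=> ww' G0; rewrite (ip_cut _ _ ww'); congr ip; apply/funext => x.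
have [xw|xw] := pselect (w' x); first by rewrite cut_in.
by rewrite cut_out// G0.
Qed.

Lemma eq_ip w F F' G G' : (forall x, w x -> F x = F' x) ->
  (forall x, w x -> G x = G' x) -> ip w F G = ip w F' G'.
Proof.
move=> FF GG; apply: eq_Rintegral => x /set_mem wx.
by rewrite FF// GG.
Qed.

(** Disjointness leaves at most one nonzero term in the sum of the extensions by zero of [G], so
    that sum equals [G] off the null remainder; additivity of the inner product on [w] does the
    rest. *)
Lemma ip_partition w N (T : 'I_N -> set 'rV[R]_d) F G :
  measurable w -> (forall i, measurable (T i)) -> (forall i, T i `<=` w) ->
  (forall i j, i != j -> T i `&` T j = set0) ->
  (leb d).-negligible (w `\` \bigcup_i T i) ->
  L2 w F -> L2 w G -> \sum_i ip (T i) F G = ip w F G.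
Proof.
move=> mw mT Tw dT wT hF hG; have sL := semi_ip_L2 mw.
have hc i : L2 w (cut (T i) G).
  by apply: L2_cut => //; exact: (L2S mw).
have hs : forall s : seq 'I_N, L2 w (\sum_(i <- s) cut (T i) G) /\
    \sum_(i <- s) ip w F (cut (T i) G) = ip w F (\sum_(i <- s) cut (T i) G).
  elim=> [|i s [IH1 IH2]].
    rewrite !big_nil; split; first exact: sip0 sL.
    by rewrite (sipC sL)// ?(sip0l sL)//; exact: sip0 sL.
  rewrite !big_cons; split; first exact: (sipD sL).
  by rewrite (sipDr sL)// IH2.
under eq_bigr => i _ do rewrite (ip_cut _ _ (Tw i)).
have [h1 ->] := hs (index_enum 'I_N).
rewrite (sipC sL)// [RHS](sipC sL)//; apply: (ip_ae mw) => //.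
case: wT => A [mA A0 wA]; exists A; split => // x /= xA; apply: wA.
split; first by apply: contrapT => nw; apply: xA => /nw.
move=> [i _ Tix]; apply: xA => wx; rewrite fct_sumE (bigD1 i)//= cut_in//.
rewrite big1 ?addr0// => j ji; rewrite cut_out// => Tjx.
by have /seteqP[/(_ x) + _] := dT _ _ ji; apply.
Qed.

End L2_fields.

(** * Smooth bumps *)

Section flat_functions.
Context {R : realType}.
Implicit Types (c s t : R) (p q : {poly R}).

(** The classical function [exp (- c / t)], with a polynomial factor in [1 / t] that makes the
    family stable under differentiation. For [p = 1] it tends to the indicator of the positive axis
    as [c] tends to 0. *)
Definition flat c p t : R := if 0 < t then p.[t^-1] * expR (- (c * t^-1)) else 0.

Lemma poly_le_exp c q : 0 < c ->
  exists2 K, 0 <= K & forall s, 0 <= s -> `|q.[s]| <= K * expR (c * s).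
Proof.
move=> c0.
have mono n : exists2 K : R, 0 <= K & forall s, 0 <= s -> s ^+ n <= K * expR (c * s).
  case: n => [|n].
    exists 1 => // s s0; rewrite expr0 mul1r -expR0 ler_expR.
    by rewrite mulr_ge0// ltW.
  exists (n.+1`!%:R / c ^+ n.+1); first by rewrite divr_ge0// exprn_ge0// ltW.
  move=> s s0; have cs0 : 0 <= c * s by rewrite mulr_ge0// ltW.
  have h : (c * s) ^+ n.+1 / n.+1`!%:R <= expR (c * s).
    by apply: le_trans (expR_ge1Dxn n cs0); rewrite lerDr.
  rewrite mulrAC ler_pdivlMr ?exprn_gt0// mulrC -exprMn.
  by move: h; rewrite ler_pdivrMr ?ltr0n ?fact_gt0// => h; rewrite [leRHS]mulrC.
have /choice[K KP] (n : nat) : exists K : R, 0 <= K /\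
    forall s, 0 <= s -> s ^+ n <= K * expR (c * s).
  by have [K K0 KP] := mono n; exists K.
exists (\sum_(i < size q) `|q`_i| * K i).
  by apply: sumr_ge0 => i _; rewrite mulr_ge0//; have [] := KP i.
move=> s s0; rewrite horner_coef mulr_suml.
apply: le_trans (ler_norm_sum _ _ _) _; apply: ler_sum => i _.
rewrite normrM -mulrA ler_wpM2l// ger0_norm ?exprn_ge0//.
by have [_] := KP i; apply.
Qed.

(** The exponential dominates [p] even after multiplication by ['X^2]. Quadratic decay is what
    differentiability at 0, with derivative 0, requires. *)
Lemma flat_bound c p : 0 < c -> exists2 K, 0 <= K & forall t, `|flat c p t| <= K * t ^+ 2.
Proof.
move=> c0; have [K K0 KP] := poly_le_exp (p * 'X^2) c0.
exists K => // t; rewrite /flat; case: ifPn => [t0|_]; last by rewrite normr0 mulr_ge0 ?sqr_ge0.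
have := KP t^-1; rewrite invr_ge0 (ltW t0) => /(_ isT).
rewrite hornerM hornerXn normrM (@ger0_norm _ (_ ^+ 2)) ?sqr_ge0// exprVn.
rewrite ler_pdivrMr ?exprn_gt0// mulrAC => h.
rewrite normrM (@ger0_norm _ (expR _)) ?expR_ge0// expRN.
by rewrite ler_pdivrMr ?expR_gt0.
Qed.

(** Chain rule at [s = 1 / t]: the inner derivative is [- s ^+ 2], and differentiating
    [p s * exp (- c s)] in [s] gives the remaining factor up to sign. *)
Definition flat' c p : {poly R} := 'X^2 * (c *: p - p^`()).

Lemma is_derive_flat c p t : 0 < c -> is_derive t 1 (flat c p) (flat c (flat' c p) t).
Proof.
move=> c0; have [t0|t0|<-] := ltgtP 0 t.
- apply: (@near_eq_is_derive R R R (fun u : R => p.[u^-1] * expR (- (c * u^-1))) _ t 1).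
    have oU : open [set u : R | 0 < u] by exact: open_gt.
    by apply: filterS (open_nbhs_nbhs (conj oU t0)) => u /= u0; rewrite /flat u0.
  have t0' : t != 0 by rewrite gt_eqF.
  have dV : is_derive t 1 (fun u : R => u^-1) (- t ^- 2).
    have := is_deriveV t0' (is_derive_id t 1).
    by rewrite scaleNr /GRing.scale /= mulr1.
  have d1 : is_derive t 1 (fun u : R => p.[u^-1]) ((p^`()).[t^-1] * (- t ^- 2)).
    exact: (@is_derive1_comp _ (horner p) (fun u => u^-1) t _ _ (is_derive_poly p _) dV).
  have d2 : is_derive t 1 (fun u : R => expR (- (c * u^-1))) (expR (- (c * t^-1)) * (- (c * (- t ^- 2)))).
    apply: (@is_derive1_comp _ expR (fun u => - (c * u^-1))).
  have -> : flat c (flat' c p) t = p.[t^-1] *: (expR (- (c * t^-1)) * (- (c * (- t ^- 2)))) +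
     expR (- (c * t^-1)) *: ((p^`()).[t^-1] * (- t ^- 2)).
    rewrite /flat t0 /flat' hornerM hornerXn hornerD hornerN hornerZ /GRing.scale/= exprVn.
    by ring.
  exact: is_deriveM.
- apply: (@near_eq_is_derive R R R (cst 0) _ t 1).
    have oU : open [set u : R | u < 0] by exact: open_lt.
    apply: filterS (open_nbhs_nbhs (conj oU t0)) => u /= u0.
    by rewrite /flat ltNge (ltW u0).
  by rewrite /flat ltNge (ltW t0)/=; exact: is_derive_cst.
- have f0 q : flat c q 0 = 0 by rewrite /flat ltxx.
  have [K K0 KP] := flat_bound p c0.
  have lim : (fun h : R => h^-1 *: ((flat c p \o shift 0) (h *: 1) - flat c p 0)) @ 0^' --> (0 : R).
    have Kp : 0 < K + 1 by rewrite ltr_wpDl.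
    apply/cvgrPdist_le => e e0; near=> h.
    have h0 : h != 0 by near: h; exact: nbhs_dnbhs_neq.
    rewrite sub0r normrN /= f0 subr0 addr0 /GRing.scale/= mulr1 normrM normfV.
    rewrite mulrC ler_pdivrMr ?normr_gt0//; apply: le_trans (KP h) _.
    rewrite -(real_normK (num_real h)) expr2 mulrA ler_wpM2r//.
    apply: (@le_trans _ _ ((K + 1) * `|h|)); first by rewrite ler_wpM2r// lerDl.
    rewrite mulrC -ler_pdivlMr//.
    near: h; apply: dnbhs0_le.
    by rewrite divr_gt0.
  rewrite f0; apply: DeriveDef; first by apply/cvg_ex; exists 0.
  by rewrite /derive; apply/cvg_lim.
Unshelve. all: by end_near. Qed.

Lemma flat_ge0 c t : 0 <= flat c 1 t.
Proof. by rewrite /flat; case: ifP => // _; rewrite hornerC mul1r expR_ge0. Qed.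

Lemma flat_le1 c t : 0 < c -> flat c 1 t <= 1.
Proof.
move=> c0; rewrite /flat; case: ifP => // t0; rewrite hornerC mul1r.
by rewrite expR_le1 oppr_le0; apply: mulr_ge0; rewrite ?invr_ge0 ltW.
Qed.

Lemma flat_cvg t : 0 < t -> flat n.+1%:R^-1 1 t @[n --> \oo] --> (1 : R).
Proof.
move=> t0; rewrite /flat t0; under eq_fun do rewrite hornerC mul1r.
suff : expR (- (n.+1%:R^-1 * t^-1)) @[n --> \oo] --> expR (0 : R) by rewrite expR0.
apply: continuous_cvg; first exact: continuous_expR.
rewrite -oppr0; apply: cvgN; rewrite -(mul0r t^-1).
by apply: cvgM; [exact: cvg_harmonic|exact: cvg_cst].
Qed.

End flat_functions.

Section bump_algebra.
Context {R : realType} {d : nat}.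
Implicit Types (f g : 'rV[R]_d -> R) (k : 'I_d).

(* Closed under partial derivatives, which gives smoothness and lets the
   symmetry of mixed derivatives be checked on generators. *)
Inductive bump_alg : ('rV[R]_d -> R) -> Prop :=
| bump_coord c p k s b : 0 < c -> bump_alg (fun x => flat c p (s * x 0 k + b))
| bump_cst r : bump_alg (fun=> r)
| bump_add f g : bump_alg f -> bump_alg g -> bump_alg (f + g)
| bump_mul f g : bump_alg f -> bump_alg g -> bump_alg (f * g).

Lemma coord_shift (h : R) (x : 'rV[R]_d) k l :
  (h *: delta_mx 0 k + x) 0 l = h * (l == k)%:R + x 0 l.
Proof. by rewrite !mxE eqxx. Qed.

Lemma is_derive_coord c p l s b k (x : 'rV[R]_d) : 0 < c ->
  is_derive x (delta_mx 0 k) (fun x : 'rV[R]_d => flat c p (s * x 0 l + b))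
    (if l == k then s * flat c (flat' c p) (s * x 0 l + b) else 0).
Proof.
move=> c0; case: (eqVneq l k) => [->|lk].
  pose G (t : R) := flat c p (s * t + b).
  have dG : is_derive (x 0 k) 1 G (s * flat c (flat' c p) (s * x 0 k + b)).
    have ds : is_derive (x 0 k) 1 (fun t : R => s * t + b) s.
      have := is_deriveD (is_deriveZ s (is_derive_id (x 0 k) (1 : R)))
        (is_derive_cst b (x 0 k) (1 : R)).
      by rewrite addr0 /GRing.scale /= mulr1.
    rewrite mulrC; exact: (@is_derive1_comp _ (flat c p) _ (x 0 k) _ _
      (is_derive_flat p (s * x 0 k + b) c0) ds).
  have hG h : flat c p (s * (h *: delta_mx 0 k + x) 0 k + b) = G (h *: 1 + x 0 k).
    by rewrite coord_shift eqxx.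
  have [dG1 dG2] := dG; split.
    by apply/(derivable_quotient hG).
  by rewrite (derive_quotient hG).
have hG h : flat c p (s * (h *: delta_mx 0 k + x) 0 l + b) =
    cst (flat c p (s * x 0 l + b)) (h *: (1 : R) + 0).
  by rewrite coord_shift (negPf lk) mulr0 add0r.
split; first by apply/(derivable_quotient hG); exact: derivable_cst.
by rewrite (derive_quotient hG) derive_cst.
Qed.

Lemma bump_alg_derive f : bump_alg f -> continuous f /\
  forall k, (forall x, derivable f x (delta_mx 0 k)) /\ bump_alg (partial k f).
Proof.
elim=> {f}.
- move=> c p l s b c0; split.
    move=> x; apply: (@continuous_comp _ _ _ (fun x : 'rV[R]_d => s * x 0 l + b) (flat c p)).
      apply: (@continuousD _ _ _ (fun x : 'rV[R]_d => s * x 0 l) (cst b)).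
        by apply: (@continuousM _ _ (cst s) (fun x : 'rV[R]_d => x 0 l));
          [exact: cst_continuous|exact: coord_continuous].
      exact: cst_continuous.
    apply: differentiable_continuous; apply/derivable1_diffP.
    by have [] := is_derive_flat p (s * x 0 l + b) c0.
  move=> k; split.
    by move=> x; have [] := is_derive_coord p l s b k x c0.
  have [lk|lk] := eqVneq l k.
    rewrite (_ : partial k _ = (fun=> s) * (fun x => flat c (flat' c p) (s * x 0 l + b))).
      by apply: bump_mul; [exact: bump_cst|exact: bump_coord].
    apply/funext => x; have [_] := is_derive_coord p l s b k x c0.
    by rewrite lk eqxx.
  rewrite (_ : partial k _ = fun=> 0); first exact: bump_cst.
  apply/funext => x; have [_] := is_derive_coord p l s b k x c0.
  by rewrite (negPf lk).
- move=> r; split; first exact: cst_continuous.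
  move=> k; split; first by move=> x; exact: derivable_cst.
  rewrite (_ : partial k _ = fun=> 0); first exact: bump_cst.
  by apply/funext => x; exact: derive_cst.
- move=> f g bf [cf df] bg [cg dg]; split; first by move=> x; exact: (continuousD (cf x) (cg x)).
  move=> k; have [df1 df2] := df k; have [dg1 dg2] := dg k; split.
    by move=> x; apply: derivableD.
  rewrite (_ : partial k _ = partial k f + partial k g); first exact: bump_add.
  by apply/funext => x; rewrite /partial deriveD.
- move=> f g bf [cf df] bg [cg dg]; split; first by move=> x; exact: (continuousM (cf x) (cg x)).
  move=> k; have [df1 df2] := df k; have [dg1 dg2] := dg k; split.
    by move=> x; apply: derivableM.
  rewrite (_ : partial k _ = f * partial k g + g * partial k f).
    by apply: bump_add; exact: bump_mul.
  by apply/funext => x; rewrite /partial deriveM.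
Qed.

Lemma bump_alg_smooth f : bump_alg f -> smooth f.
Proof.
move=> bf s; have : bump_alg (foldr (@partial R d) f s).
  by elim: s => //= k s IH; have [_ /(_ k)[]] := bump_alg_derive IH.
by move=> /bump_alg_derive[cg dg]; split=> // k x; have [] := dg k.
Qed.

Lemma partialD k f g : (forall x, derivable f x (delta_mx 0 k)) ->
  (forall x, derivable g x (delta_mx 0 k)) ->
  partial k (f + g) = partial k f + partial k g.
Proof. by move=> df dg; apply/funext => x; rewrite /partial deriveD. Qed.

Lemma partialM k f g : (forall x, derivable f x (delta_mx 0 k)) ->
  (forall x, derivable g x (delta_mx 0 k)) ->
  partial k (f * g) = f * partial k g + g * partial k f.
Proof. by move=> df dg; apply/funext => x; rewrite /partial deriveM. Qed.

(** A generator depends on one coordinate, so its mixed derivatives in two different directions are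
    zero in either order; sums and, by Leibniz, products inherit the symmetry. *)
Lemma bump_alg_partialC f0 i j : bump_alg f0 ->
  partial i (partial j f0) = partial j (partial i f0).
Proof.
have p0 k (r : R) : partial k ((fun=> r) : 'rV[R]_d -> R) = fun=> 0.
  by apply/funext => x; exact: derive_cst.
have dd f k : bump_alg f -> forall x, derivable f x (delta_mx 0 k).
  by move=> /bump_alg_derive[_ /(_ k)[]].
have bb f k : bump_alg f -> bump_alg (partial k f).
  by move=> /bump_alg_derive[_ /(_ k)[]].
move=> bf; elim: bf i j => {f0}.
- move=> c p l s b c0 i j; have [->//|ij] := eqVneq i j.
  have pE k : partial k (fun x => flat c p (s * x 0 l + b)) =
     fun x => if l == k then s * flat c (flat' c p) (s * x 0 l + b) else 0.
    by apply/funext => x; have [_] := is_derive_coord p l s b k x c0.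
  have pE2 k k' : k != k' -> partial k (partial k' (fun x => flat c p (s * x 0 l + b))) = fun=> 0.
    move=> kk'; rewrite pE; case: eqVneq => [lk|_]; last exact: p0.
    rewrite -[X in partial k X]/((fun=> s) * (fun x : 'rV[R]_d => flat c (flat' c p) (s * x 0 l + b))).
    apply/funext => x; rewrite /partial deriveM; last 2 first.
    + exact: derivable_cst.
    + by apply: dd; exact: bump_coord.
    have [_ ->] := is_derive_coord (flat' c p) l s b k x c0.
    by rewrite lk eq_sym (negPf kk') derive_cst !scaler0 addr0.
  by rewrite !pE2// eq_sym.
- by move=> r i j; rewrite !p0.
- move=> f g bf IHf bg IHg i j.
  have d1 k := dd _ k bf; have d2 k := dd _ k bg.
  have d3 k l := dd _ k (bb _ l bf); have d4 k l := dd _ k (bb _ l bg).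
  rewrite (partialD (d1 j) (d2 j)) (partialD (d1 i) (d2 i)).
  by rewrite (partialD (d3 i j) (d4 i j)) (partialD (d3 j i) (d4 j i)) IHf IHg.
- move=> f g bf IHf bg IHg i j.
  have d1 k := dd _ k bf; have d2 k := dd _ k bg.
  have d3 k l := dd _ k (bb _ l bf); have d4 k l := dd _ k (bb _ l bg).
  have d5 k l := dd _ k (bump_mul bf (bb _ l bg)).
  have d6 k l := dd _ k (bump_mul bg (bb _ l bf)).
  rewrite (partialM (d1 j) (d2 j)) (partialM (d1 i) (d2 i)).
  rewrite (partialD (d5 i j) (d6 i j)) (partialD (d5 j i) (d6 j i)).
  rewrite (partialM (d1 i) (d4 i j)) (partialM (d2 i) (d3 i j)).
  rewrite (partialM (d1 j) (d4 j i)) (partialM (d2 j) (d3 j i)).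
  move: (IHf i j) (IHg i j) => -> ->.
  move: (partial j (partial i f)) (partial j (partial i g)) (partial i f)
    (partial j f) (partial i g) (partial j g) => A B C D E F.
  apply/funext => x; rewrite !fctE.
  by move: (f x) (g x) (A x) (B x) (C x) (D x) (E x) (F x) => *; ring.
Qed.

(** Two flat factors per coordinate switch off outside []a k, b k[]; the parameter [1 / (n + 1)]
    drives the product to the indicator of the box. The factors [1] and [-1] match the shape of the
    generator [bump_coord]. *)
Definition bump (n : nat) (a b : 'rV[R]_d) : 'rV[R]_d -> R :=
  \prod_k ((fun x : 'rV[R]_d => flat n.+1%:R^-1 1 (1 * x 0 k + - a 0 k)) *
           (fun x : 'rV[R]_d => flat n.+1%:R^-1 1 (-1 * x 0 k + b 0 k))).

Lemma bumpE n a b x : bump n a b x =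
  \prod_k (flat n.+1%:R^-1 1 (x 0 k - a 0 k) * flat n.+1%:R^-1 1 (b 0 k - x 0 k)).
Proof.
rewrite /bump fct_prodE; apply: eq_bigr => k _.
by rewrite fctE mul1r mulN1r [- _ + _]addrC.
Qed.

Lemma bump_bump_alg n a b : bump_alg (bump n a b).
Proof.
apply: (big_ind bump_alg); [exact: bump_cst|exact: bump_mul|].
by move=> k _; apply: bump_mul; apply: bump_coord; rewrite invr_gt0.
Qed.

Lemma bump_ge0 n a b x : 0 <= bump n a b x.
Proof. by rewrite bumpE; apply: prodr_ge0 => k _; rewrite mulr_ge0// flat_ge0. Qed.

Lemma bump_le1 n a b x : bump n a b x <= 1.
Proof.
rewrite bumpE; elim: (index_enum _) => [|k s IH]; first by rewrite big_nil.
have c0 : 0 < n.+1%:R^-1 :> R by rewrite invr_gt0.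
rewrite big_cons mulr_ile1//; first by rewrite mulr_ge0// flat_ge0.
  by apply: prodr_ge0 => l _; rewrite mulr_ge0// flat_ge0.
by rewrite mulr_ile1// ?flat_ge0 ?flat_le1.
Qed.

Lemma bump_out n a b x : ~ box a b x -> bump n a b x = 0.
Proof.
move=> abx; have [k /negP] : exists k, ~ (a 0 k < x 0 k < b 0 k).
  by apply/existsNP => h; apply: abx.
rewrite negb_and -!leNgt bumpE (bigD1 k)//= /flat => /orP[|] h.
  by rewrite ifF ?mul0r// subr_gt0 ltNge h.
have -> : (0 < b 0 k - x 0 k) = false by rewrite subr_gt0 ltNge h.
by rewrite mulr0 mul0r.
Qed.

Lemma bump_cvg a b x : bump n a b x @[n --> \oo] --> (\1_(box a b) x : R).
Proof.
have [xab|xab] := pselect (box a b x); last first.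
  rewrite indicE memNset//; under eq_fun do rewrite (bump_out _ xab).
  exact: cvg_cst.
rewrite indicE mem_set//; under eq_fun do rewrite bumpE.
rewrite -[true%:R]/(1 : R); elim: (index_enum _) => [|k s IH].
  by under eq_fun do rewrite big_nil; exact: cvg_cst.
under eq_fun do rewrite big_cons.
have /andP[h1 h2] := xab k.
have fa : flat n.+1%:R^-1 1 (x 0 k - a 0 k) @[n --> \oo] --> (1 : R).
  by apply: flat_cvg; rewrite subr_gt0.
have fb : flat n.+1%:R^-1 1 (b 0 k - x 0 k) @[n --> \oo] --> (1 : R).
  by apply: flat_cvg; rewrite subr_gt0.
have h := cvgM (cvgM fa fb) IH; rewrite !mulr1 in h; exact: h.
Qed.

End bump_algebra.

(** * The fundamental lemma of the calculus of variations *)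

Section fundamental_lemma.
Context {R : realType} {d : nat}.
Implicit Types (w : set 'rV[R]_d) (g : 'rV[R]_d -> R).

Definition boxes : set (set 'rV[R]_d) := [set A | exists a b, A = box a b].

(** Boxes are stable under intersection, so knowing that they generate the measurable sets permits
    Dynkin induction from boxes to all of them. *)
Lemma boxes_generate : @measurable _ 'rV[R]_d = <<s boxes >>.
Proof.
apply/seteqP; split; last first.
  apply: smallest_sub; first exact: sigma_algebra_measurable.
  by move=> _ [a [b ->]]; exact: measurable_box.
apply: smallest_sub; first exact: smallest_sigma_algebra.
rewrite -bigcup_seq => _ [i _ [Y mY <-]].
pose T := g_sigma_algebraType boxes.
have : measurable_fun [set: T] (fun x : T => (x : 'rV[R]_d) 0 i).
  apply: (measurability _ (measurable_realfun.RGenOpens.measurableE R)).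
  move=> _ [_ [u [v ->] <-]]; rewrite setTI.
  rewrite (_ : _ @^-1` _ = \bigcup_N
     (box (\row_j if j == i then u else - N%:R) (\row_j if j == i then v else N%:R))).
    apply: bigcupT_measurable => N; apply: sub_sigma_algebra.
    by do 2 eexists.
  apply/seteqP; split=> x /=.
    rewrite in_itv/= => xuv.
    have : [set: 'rV[R]_d] x by []; rewrite cubeT => -[N _ /cubeP xN].
    (* One more than the radius of the closed cube, because boxes are open. *)
    exists N.+1 => // j; rewrite !mxE; case: eqVneq => [->//|_].
    have := xN j; rewrite -natr1 ler_norml => /andP[x1 x2]; apply/andP; split; lra.
  by move=> [N _ /(_ i)]; rewrite !mxE eqxx in_itv.
by move=> /(_ measurableT Y mY).
Qed.

(** Dominated convergence with the absolute value of [g] as majorant: bumps take values between 0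
    and 1 and tend to the indicator of the box. *)
Lemma integral_box_eq0 w g : (leb d).-integrable w (EFin \o g) -> measurable w ->
  forall a b, cbox a b `<=` w -> (forall n, \int[leb d]_(x in w) (g x * bump n a b x) = 0) ->
  (\int[leb d]_(x in box a b) (g x)%:E = 0)%E.
Proof.
move=> ig mw a b abw gb0.
have mg : measurable_fun w g by apply/measurable_EFinP; case/integrableP : ig.
have mb n : measurable_fun w (fun x => (g x * bump n a b x)%:E).
  apply/measurable_EFinP; apply: measurable_realfun.measurable_funM => //.
  apply: measurable_funTS; apply: continuous_rV_measurable.
  by have [] := bump_alg_derive (bump_bump_alg n a b).
have := @dominated_cvg _ _ R (leb d) w mw (fun n x => (g x * bump n a b x)%:E)
  (fun x => (g x * \1_(box a b) x)%:E) (fun x => (`|g x|)%:E) mb.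
have ign : (leb d).-integrable w (fun x => (`|g x|)%:E) by exact: integrable_norm.
have b0 n : (\int[leb d]_(x in w) (g x * bump n a b x)%:E = 0)%E.
  rewrite -[RHS]/(0%:E) -(gb0 n) /Rintegral fineK//.
  apply: integrable_fin_num => //; apply: (le_integrable mw _ _ ig) => // x _ /=.
  by rewrite lee_fin normrM ler_piMr// ger0_norm ?bump_ge0 ?bump_le1.
move=> dc; have {}dc : (\int[leb d]_(x in w) (g x * bump n a b x)%:E)%E @[n --> \oo] -->
    (\int[leb d]_(x in w) (g x * \1_(box a b) x)%:E)%E.
  apply: dc => //.
    move=> x _; apply: cvg_EFin; first by apply: nearW.
    by apply: cvgM; [exact: cvg_cst|exact: bump_cvg].
  by move=> n x _; rewrite /= lee_fin normrM ler_piMr// ger0_norm ?bump_ge0 ?bump_le1.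
rewrite (_ : (fun n => _) = cst 0%E) in dc; last by apply/funext => n; exact: b0.
have {}dc := cvg_lim _ dc; rewrite lim_cst// in dc.
rewrite integral_mkcond [LHS](_ : _ = (\int[leb d]_(x in w) (g x * \1_(box a b) x)%:E)%E).
  by rewrite -dc.
rewrite [RHS]integral_mkcond; apply: eq_integral => x _.
rewrite !patchE indicE; have [xb|xb] := boolP (x \in box a b).
  rewrite mem_set ?mulr1//; apply: abw; apply: box_cbox; exact: set_mem.
by case: ifP => //; rewrite mulr0.
Qed.

(** Integrals over boxes vanish; inside one fixed box Dynkin induction extends this to every
    measurable subset, so [g] is null there, and countably many rational boxes cover [w]. *)
Lemma ae_eq0_bump w g : open w -> (leb d).-integrable w (EFin \o g) ->
  (forall n a b, cbox a b `<=` w -> \int[leb d]_(x in w) (g x * bump n a b x) = 0) ->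
  ae_eq (leb d) w g (cst 0).
Proof.
move=> ow ig gb0; have mw := open_rV_measurable ow.
have ibox a b : cbox a b `<=` w -> (\int[leb d]_(x in box a b) (g x)%:E = 0)%E.
  by move=> abw; apply: (integral_box_eq0 ig) => // n; exact: gb0.
have key a b : cbox a b `<=` w -> ae_eq (leb d) (box a b) g (cst 0).
  move=> abw; set B := box a b; have mB : measurable B by exact: measurable_box.
  have Bw : B `<=` w by apply: subset_trans abw; exact: box_cbox.
  have igB A : measurable A -> A `<=` B -> (leb d).-integrable A (EFin \o g).
    by move=> mA AB; apply: (integrableS mw) => //; exact: subset_trans Bw.
  have mI A : measurable A -> measurable (A `&` B) by move=> mA; exact: measurableI.
  have P : forall A, <<s boxes >> A -> (\int[leb d]_(x in A `&` B) (g x)%:E = 0)%E.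
    apply: (dynkin_induction boxes_generate).
    - move=> _ _ [a1 [b1 ->]] [a2 [b2 ->]]; rewrite boxI; by do 2 eexists.
    - by rewrite setTI; exact: ibox.
    - move=> _ [a1 [b1 ->]]; rewrite /B boxI; apply: ibox.
      move=> x xI; apply: abw => i; have := xI i; rewrite !mxE ge_max le_min.
      by move=> /andP[/andP[_ ->] /andP[_ ->]].
    - move=> A mA A0.
      have := ibox a b abw; rewrite -/B -{1}(setUIDK B A).
      rewrite integral_setU//.
      + by rewrite setIC A0 add0e setDE setIC.
      + exact: measurableI.
      + exact: measurableD.
      + rewrite setUIDK; apply/measurable_EFinP.
        apply: (measurable_funS mw Bw).
        by apply/measurable_EFinP; case/integrableP : ig.
      + by rewrite disj_set2E setDE setIACA setICr setI0.
    - move=> F mF tF F0.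
      rewrite setI_bigcupl integral_bigcup//.
      + by rewrite eseries0// => n _ _; exact: F0.
      + exact: trivIset_setIr.
      + by move=> k; exact: mI.
      + apply: igB; first by apply: bigcupT_measurable => k; exact: mI.
        by apply: bigcup_sub => k _ x [].
  have := @integral_ae_eq _ _ _ (leb d) B mB (cst 0%E) (EFin \o g) (igB B mB (@subset_refl _ _)) (measurable_cst _).
  move=> /(_ _)/= h; have {}h := h _.
  apply: filterS (h _) => [x /= e Bx|E EB mE]; first by have [] := e Bx.
  rewrite integral0 -(P E); last by rewrite -boxes_generate.
  by rewrite setIidl.
(* The exceptional points of one rational box, indexed by the code of its two corners so that they
   form a sequence of null sets. *)
pose bad (k : nat) : set 'rV[R]_d :=
  if unpickle k is Some p then
    let a := map_mx ratr (p : 'rV[rat]_d * 'rV[rat]_d).1 in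
    let b := map_mx ratr p.2 in
    [set x | cbox a b `<=` w /\ box a b x /\ g x <> 0]
  else set0.
have nbad k : (leb d).-negligible (bad k).
  rewrite /bad; case: unpickle => [p|]; last exact: negligible_set0.
  have [pw|pw] := pselect (cbox (map_mx ratr p.1) (map_mx ratr p.2) `<=` w); last first.
    by apply: (@negligibleS _ _ _ _ set0); [move=> x []|exact: negligible_set0].
  have [A [mA A0 hA]] := key _ _ pw; exists A; split => // x [_ [bx gx]].
  by apply: hA => /= /(_ bx).
apply: negligibleS (negligible_bigcup nbad) => x /= /not_implyP[wx gx].
have [p pw bx] := open_box_cover ow wx.
by exists (pickle p) => //; rewrite /bad pickleK.
Qed.

End fundamental_lemma.

(** * Test fields and integration by parts *)

Section partial_calculus.
Context {R : realType} {d : nat}.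
Implicit Types (f g : 'rV[R]_d -> R) (k : 'I_d).

Definition C1 k f := [/\ continuous f, forall x, derivable f x (delta_mx 0 k)
  & continuous (partial k f)].

Lemma partialN k f : (forall x, derivable f x (delta_mx 0 k)) ->
  partial k (- f) = - partial k f.
Proof. by move=> df; apply/funext => x; rewrite /partial deriveN. Qed.

Lemma partialZ k (c : R) f : (forall x, derivable f x (delta_mx 0 k)) ->
  partial k (c *: f) = c *: partial k f.
Proof. by move=> df; apply/funext => x; rewrite /partial deriveZ. Qed.

Lemma partial_cst k (c : R) : partial k (cst c : 'rV[R]_d -> R) = cst 0.
Proof. by apply/funext => x; exact: derive_cst. Qed.

Lemma mulfctE f g x : (f * g) x = f x * g x.
Proof. by []. Qed.

Lemma C1M k f g : C1 k f -> C1 k g -> C1 k (f * g).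
Proof.
move=> [cf df pf] [cg dg pg]; split.
- by move=> x; exact: (continuousM (cf x) (cg x)).
- by move=> x; apply: derivableM.
- rewrite partialM// => x.
  exact: (continuousD (continuousM (cf x) (pg x)) (continuousM (cg x) (pf x))).
Qed.

Lemma C1_coord k l : C1 k (fun x : 'rV[R]_d => x 0 l).
Proof.
have dl (x : 'rV[R]_d) : is_derive x (delta_mx 0 k : 'rV[R]_d) (fun x : 'rV[R]_d => x 0 l) (l == k)%:R.
  pose G (t : R) : R := (l == k)%:R * t + x 0 l.
  have dG : is_derive (0 : R) (1 : R) G ((l == k)%:R).
    have := is_deriveD (is_deriveZ ((l == k)%:R) (is_derive_id (0 : R) (1 : R)))
      (is_derive_cst (x 0 l) (0 : R) (1 : R)).
    have eA : (l == k)%:R%:A = (l == k)%:R :> R by rewrite /GRing.scale/= mulr1.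
    by rewrite addr0 eA.
  have hh (h : R) : (h *: delta_mx 0 k + x) 0 l = G (h *: 1 + 0).
    by rewrite coord_shift mulrC addr0 /G {1}/GRing.scale /= mulr1.
  have [dG1 dG2] := dG; split; first by apply/(derivable_quotient hh).
  by rewrite (derive_quotient hh).
split.
- by move=> x; exact: coord_continuous.
- by move=> x; have [] := dl x.
- rewrite (_ : partial k _ = cst (l == k)%:R); first exact: cst_continuous.
  by apply/funext => x; have [_] := dl x.
Qed.

Lemma partial_coord k : partial k (fun x : 'rV[R]_d => x 0 k) = cst 1.
Proof.
apply/funext => x; rewrite /partial.
have hh (h : R) : (h *: delta_mx 0 k + x) 0 k = id (h *: 1 + x 0 k).
  by rewrite coord_shift eqxx.
by apply: etrans (derive_quotient (f := fun x : 'rV[R]_d => x 0 k) (g := id) hh) _;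
  rewrite derive_id.
Qed.

Section integration_by_parts.
Variables (w K : set 'rV[R]_d).
Hypotheses (mw : measurable w) (cK : compact K) (Kw : K `<=` w).

Let clK : closed K.
Proof. by apply: compact_closed => //; exact: norm_hausdorff. Qed.

Let cubeK : exists M, K `<=` cube d M.
Proof. by apply: bounded_cube; exact: compact_bounded. Qed.

Lemma sqint_supp f : continuous f -> (forall x, ~ K x -> f x = 0) ->
  sqint (leb d) w f.
Proof.
move=> cf f0; have [M KM] := cubeK.
have mf := continuous_rV_measurable cf; split; first exact: measurable_funTS.
apply: (@integrableS _ _ _ (leb d) setT) => //.
apply: (@integrable_compact_supp _ _ _ M).
  by move=> x; apply: continuousM; exact: cf.
by move=> x Mx; rewrite f0 ?expr0n// => /KM.
Qed.

Lemma supp_partial k f : (forall x, ~ K x -> f x = 0) ->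
  forall x, ~ K x -> partial k f x = 0.
Proof. by move=> f0 x Kx; exact: (partial_supp k clK f0). Qed.

(** The derivative of the compactly supported product integrates to zero. The support condition
    falls on [f] alone, which allows [g] to be a coordinate function. *)
Lemma ibp k f g : C1 k f -> C1 k g -> (forall x, ~ K x -> f x = 0) ->
  sqip (leb d) w (partial k f) g = - sqip (leb d) w f (partial k g).
Proof.
move=> Cf Cg f0; have [cf df pf] := Cf; have [cg dg pg] := Cg.
have [M KM] := cubeK.
have [cfg dfg pfg] := C1M Cf Cg.
have fg0 x : ~ cube d M x -> (f * g) x = 0.
  by move=> Mx; rewrite mulfctE f0 ?mul0r// => /KM.
have := integral_partial0 dfg pfg fg0.
rewrite partialM// => I0.
have mE h : (forall x, ~ K x -> h x = 0) ->
   \int[leb d]_(x in w) h x = \int[leb d]_x h x.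
  move=> h0; rewrite Rintegral_mkcond; apply: eq_Rintegral => x _.
  rewrite patchE; case: ifPn => //; rewrite notin_setE => wx.
  by rewrite h0// => /Kw.
have Ic h : continuous h -> (forall x, ~ K x -> h x = 0) ->
    (leb d).-integrable setT (EFin \o h).
  move=> ch h0; apply: (@integrable_compact_supp _ _ _ M) => // x Mx.
  by apply: h0 => /KM.
have z1 x : ~ K x -> f x * partial k g x = 0 by move=> Kx; rewrite f0// mul0r.
have z2 x : ~ K x -> partial k f x * g x = 0.
  by move=> Kx; rewrite supp_partial// mul0r.
have c1 : continuous (fun x => f x * partial k g x).
  by move=> x; exact: (continuousM (cf x) (pg x)).
have c2 : continuous (fun x => partial k f x * g x).
  by move=> x; exact: (continuousM (pf x) (cg x)).
rewrite /sqip mE// mE//; apply/eqP; rewrite -addr_eq0 addrC -RintegralD//; try exact: Ic.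
apply/eqP; rewrite /Rintegral -[RHS]/(fine 0%E) -I0; congr fine.
by apply: eq_integral => x _ /=; rewrite [partial k f x * _]mulrC.
Qed.

(* Integrate the derivative of f ^+ 2 against the k-th coordinate. *)
Lemma poincare_coord k f M : w `<=` cube d M -> C1 k f ->
  (forall x, ~ K x -> f x = 0) ->
  sqip (leb d) w f f <= (2 * M) ^+ 2 * sqip (leb d) w (partial k f) (partial k f).
Proof.
move=> wM Cf f0; have [cf df pf] := Cf.
pose X : 'rV[R]_d -> R := fun x => x 0 k.
have CX : C1 k X by exact: C1_coord.
have Cff := C1M Cf Cf.
have cX : continuous X by move=> x; exact: coord_continuous.
have sip := semi_ip_sqip (leb d) mw.
have Sf : sqint (leb d) w f by exact: sqint_supp.
have Sp : sqint (leb d) w (partial k f).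
  by apply: sqint_supp => // x Kx; exact: supp_partial.
have SXp : sqint (leb d) w (X * partial k f).
  apply: sqint_supp => [x|x Kx]; first exact: (continuousM (cX x) (pf x)).
  by rewrite mulfctE supp_partial ?mulr0.
(* Parts applied to [f * f] and the coordinate [X], whose derivative is 1. *)
have e1 : sqip (leb d) w f f = - (2 * sqip (leb d) w f (X * partial k f)).
  have ff0 x : ~ K x -> (f * f) x = 0.
    by move=> Kx; rewrite mulfctE f0 ?mulr0.
  have := ibp Cff CX ff0; rewrite partial_coord partialM// => h.
  have -> : sqip (leb d) w f f = sqip (leb d) w (f * f) (cst 1).
    by apply: eq_Rintegral => x _ /=; rewrite mulr1.
  rewrite -[LHS]opprK -h -(sipZr sip)//; congr (- _).
  apply: eq_Rintegral => x _.
  transitivity ((f x * partial k f x + f x * partial k f x) * X x) => //.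
  by transitivity (f x * (2 * (X x * partial k f x))) => //; ring.
have aux (s p m : R) : s ^+ 2 <= m ^+ 2 -> (s * p) * (s * p) <= (m ^+ 2 * p) * p.
  by move=> h; rewrite mulrACA -expr2 -mulrA ler_wpM2r// -expr2 sqr_ge0.
have M2 : sqip (leb d) w (X * partial k f) (X * partial k f) <=
    M ^+ 2 * sqip (leb d) w (partial k f) (partial k f).
  rewrite -(sipZl sip)//; apply: le_Rintegral => //.
  - exact: sqint_mul.
  - by apply: sqint_mul => //; exact: (sipZ sip).
  - move=> x wx.
    have /cubeP/(_ k) h := wM x wx.
    have hX : X x ^+ 2 <= M ^+ 2.
      rewrite -(real_normK (num_real (X x))) ler_pXn2r// ?nnegrE//.
      exact: le_trans h.
    exact: aux.
have := cauchy_schwarz sip Sf SXp.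
have := sip_ge0 sip Sf; have := sip_ge0 sip Sp.
move: e1 M2; move: (sqip _ _ f f) (sqip _ _ f (X * _)) (sqip _ _ (X * _) _)
  (sqip _ _ (partial k f) _) => A B C D e1 M2 D0 A0 cs.
(* With [A = - (2 * B)], [B ^+ 2 <= A * C] and [C <= M ^+ 2 * D] one gets the claim multiplied by
   [A], which is then cancelled. *)
have [A00|An0] := eqVneq A 0; first by rewrite A00 mulr_ge0// sqr_ge0.
have Ap : 0 < A by rewrite lt_def An0.
rewrite -(ler_pM2l Ap) exprMn.
have -> : A * A = 4 * B ^+ 2 by rewrite e1; ring.
have : A * C <= A * (M ^+ 2 * D) by rewrite ler_wpM2l.
have -> : A * (2 ^+ 2 * M ^+ 2 * D) = 4 * (A * (M ^+ 2 * D)) by ring.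
by move: cs; move: (A * C) (A * (M ^+ 2 * D)) (B ^+ 2) => u v z; lra.
Qed.

End integration_by_parts.

End partial_calculus.

Section smooth_functions.
Context {R : realType} {d : nat}.
Implicit Types (f g : 'rV[R]_d -> R) (k : 'I_d).

Lemma smooth_partial k f : smooth f -> smooth (partial k f).
Proof. by move=> sf s; have := sf (rcons s k); rewrite foldr_rcons. Qed.

Lemma smooth_C1 k f : smooth f -> C1 k f.
Proof.
move=> sf; have [cf df] := sf [::]; split => //.
by have [] := smooth_partial k sf [::].
Qed.

Lemma smooth_cont f : smooth f -> continuous f.
Proof. by move=> /(_ [::])[]. Qed.

Lemma smooth_derivable k f : smooth f -> forall x, derivable f x (delta_mx 0 k).
Proof. by move=> /(_ [::])[_ /(_ k)]. Qed.

Lemma smooth_cst (c : R) : smooth (cst c : 'rV[R]_d -> R).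
Proof. by apply: bump_alg_smooth; exact: bump_cst. Qed.

Lemma smoothD f g : smooth f -> smooth g -> smooth (f + g).
Proof.
move=> sf sg s.
have E : foldr (@partial R d) (f + g) s = foldr (@partial R d) f s + foldr (@partial R d) g s.
  elim: s => //= k s ->; rewrite partialD//.
    by have [_ /(_ k)] := sf s.
  by have [_ /(_ k)] := sg s.
rewrite /= E; have [cf df] := sf s; have [cg dg] := sg s; split.
  by move=> x; exact: (continuousD (cf x) (cg x)).
by move=> k x; apply: derivableD.
Qed.

Lemma smoothZ (c : R) f : smooth f -> smooth (c *: f).
Proof.
move=> sf s.
have E : foldr (@partial R d) (c *: f) s = c *: foldr (@partial R d) f s.
  elim: s => //= k s ->; rewrite partialZ//.
  by have [_ /(_ k)] := sf s.
rewrite /= E; have [cf df] := sf s; split.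
  by move=> x; apply: (@continuousM _ _ (cst c)); [exact: cst_continuous|exact: cf].
by move=> k x; apply: derivableZ.
Qed.

Lemma smoothN f : smooth f -> smooth (- f).
Proof. by move=> sf; rewrite -scaleN1r; exact: smoothZ. Qed.

Lemma smooth_sum I (s : seq I) (F : I -> 'rV[R]_d -> R) :
  (forall i, smooth (F i)) -> smooth (\sum_(i <- s) F i).
Proof.
move=> sF; elim: s => [|i s IH]; first by rewrite big_nil; exact: smooth_cst.
by rewrite big_cons; exact: smoothD.
Qed.

End smooth_functions.

Section test_fields.
Context {R : realType} {d : nat}.
Implicit Types (w K : set 'rV[R]_d).

(** The compact set is a parameter, since differentiation preserves it and integration by parts
    wants both fields on a common one. *)
Definition test_on p q K (F : 'rV[R]_d -> 'M[R]_(p, q)) : Prop :=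
  (forall i j, smooth (fun x => F x i j)) /\ forall x, ~ K x -> F x = 0.

Lemma testP p q w (F : 'rV[R]_d -> 'M[R]_(p, q)) :
  test w F <-> exists K, [/\ compact K, K `<=` w & test_on K F].
Proof.
split; first by move=> [sF [K [cK Kw] F0]]; exists K.
by move=> [K [cK Kw [sF F0]]]; split=> //; exists K.
Qed.

Lemma compact_closed_rV K : compact K -> closed K.
Proof. by move=> cK; apply: compact_closed => //; exact: norm_hausdorff. Qed.

Lemma test_entry p q K (F : 'rV[R]_d -> 'M[R]_(p, q)) i j : test_on K F ->
  forall x, ~ K x -> F x i j = 0.
Proof. by move=> [_ F0] x /F0 ->; rewrite mxE. Qed.

Lemma test_lin p q w (c : R) (F G : 'rV[R]_d -> 'M[R]_(p, q)) :
  test w F -> test w G -> test w (c *: F + G).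
Proof.
move=> [sF [K [cK Kw] F0]] [sG [K' [cK' K'w] G0]]; split.
  move=> i j; rewrite (_ : (fun x => _) = c *: (fun x => F x i j) + (fun x => G x i j)).
    by apply: smoothD => //; exact: smoothZ.
  by apply/funext => x; rewrite !mxE.
exists (K `|` K'); first by split; [exact: compactU|move=> x [/Kw|/K'w]].
move=> x /not_orP[Kx K'x]; transitivity (c *: F x + G x) => //.
by rewrite F0// G0// scaler0 addr0.
Qed.

Lemma test0 p q w : test w (0 : 'rV[R]_d -> 'M[R]_(p, q)).
Proof.
split; last by exists set0 => //; split=> //; exact: compact0.
move=> i j; rewrite (_ : (fun x => _) = cst 0); first exact: smooth_cst.
by apply/funext => x; rewrite mxE.
Qed.

Lemma test_L2 p q w (F : 'rV[R]_d -> 'M[R]_(p, q)) :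
  measurable w -> test w F -> L2 w F.
Proof.
move=> mw [sF [K [cK Kw] F0]]; apply/(L2P _ mw) => i j.
apply: (sqint_supp mw cK); first exact: smooth_cont.
by move=> x Kx; rewrite F0// mxE.
Qed.

Lemma testS p q w w' (F : 'rV[R]_d -> 'M[R]_(p, q)) : w `<=` w' -> test w F -> test w' F.
Proof.
move=> ww' [sF [K [cK Kw] F0]]; split=> //; exists K => //; split => //.
exact: subset_trans ww'.
Qed.

Lemma test_grad p K (v : 'rV[R]_d -> 'rV[R]_p) : compact K ->
  test_on K v -> test_on K (grad v).
Proof.
move=> cK tv; have [sv v0] := tv; split.
  move=> i j; rewrite (_ : (fun x => _) = partial j (fun y => v y ord0 i)).
    exact: smooth_partial.
  by apply/funext => x; rewrite mxE.
move=> x Kx; apply/matrixP => i j; rewrite !mxE.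
apply: (partial_supp _ (compact_closed_rV cK)) => // y; exact: test_entry.
Qed.

Lemma divE p (Q : 'rV[R]_d -> 'M[R]_(p, d)) i :
  (fun x => div Q x 0 i) = \sum_j partial j (fun y => Q y i j).
Proof. by apply/funext => x; rewrite mxE fct_sumE. Qed.

Lemma test_div p K (Q : 'rV[R]_d -> 'M[R]_(p, d)) : compact K ->
  test_on K Q -> test_on K (div Q).
Proof.
move=> cK tQ; have [sQ Q0] := tQ; split.
  move=> i j; rewrite (ord1 i) divE; apply: smooth_sum => k; exact: smooth_partial.
move=> x Kx; apply/rowP => i; rewrite mxE big1 ?mxE// => j _.
apply: (partial_supp _ (compact_closed_rV cK)) => // y; exact: test_entry.
Qed.

Lemma test_gradstar p K (Q : 'rV[R]_d -> 'M[R]_(p, d)) : compact K ->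
  test_on K Q -> test_on K (gradstar Q).
Proof.
move=> cK tQ; have [sQ Q0] := test_div cK tQ; split.
  move=> i j; rewrite (_ : (fun x => _) = - (fun x => div Q x i j)).
    exact: smoothN.
  by apply/funext => x; rewrite mxE.
by move=> x Kx; rewrite /gradstar Q0// oppr0.
Qed.

Section parts.
Variables (w K : set 'rV[R]_d).
Hypotheses (mw : measurable w) (cK : compact K) (Kw : K `<=` w).

Lemma test_on_L2 p q (F : 'rV[R]_d -> 'M[R]_(p, q)) : test_on K F -> L2 w F.
Proof. by move=> tF; apply: test_L2 => //; apply/testP; exists K. Qed.

Lemma test_on_sqint p q (F : 'rV[R]_d -> 'M[R]_(p, q)) i j : test_on K F ->
  sqint (leb d) w (fun x => F x i j).
Proof. by move=> /test_on_L2/(L2P _ mw); exact. Qed.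

Lemma test_on_sqint_partial p q (F : 'rV[R]_d -> 'M[R]_(p, q)) k i j :
  test_on K F -> sqint (leb d) w (partial k (fun x => F x i j)).
Proof.
move=> tF; have [sF _] := tF; apply: (sqint_supp mw cK).
  exact/smooth_cont/smooth_partial.
by apply: (supp_partial cK); exact: test_entry.
Qed.

Lemma test_on_ibp p q r s (F : 'rV[R]_d -> 'M[R]_(p, q))
    (G : 'rV[R]_d -> 'M[R]_(r, s)) k i j i' j' : test_on K F -> test_on K G ->
  sqip (leb d) w (partial k (fun x => F x i j)) (fun x => G x i' j') =
  - sqip (leb d) w (fun x => F x i j) (partial k (fun x => G x i' j')).
Proof.
move=> tF [sG _]; have [sF _] := tF.
by apply: (ibp cK Kw); [exact: smooth_C1|exact: smooth_C1|exact: test_entry].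
Qed.

Lemma ip_grad p (v : 'rV[R]_d -> 'rV[R]_p) (Q : 'rV[R]_d -> 'M[R]_(p, d)) :
  test_on K v -> test_on K Q -> ip w (grad v) Q = ip w v (gradstar Q).
Proof.
move=> tv tQ; have sip := semi_ip_sqip (leb d) mw.
rewrite (ipE mw (test_on_L2 (test_grad cK tv)) (test_on_L2 tQ)).
rewrite (ipE mw (test_on_L2 tv) (test_on_L2 (test_gradstar cK tQ))).
rewrite big_ord1; apply: eq_bigr => i _.
have sqv := test_on_sqint 0 i tv.
have sqQ j := test_on_sqint_partial j i j tQ.
have -> : (fun x => gradstar Q x 0 i) = - \sum_j partial j (fun x => Q x i j).
  by rewrite -divE; apply/funext => x; rewrite mxE.
have hs : forall s : seq 'I_d, sqint (leb d) w (\sum_(j <- s) partial j (fun x => Q x i j)) /\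
    sqip (leb d) w (fun x => v x 0 i) (- \sum_(j <- s) partial j (fun x => Q x i j)) =
    \sum_(j <- s) sqip (leb d) w (fun x => grad v x i j) (fun x => Q x i j).
  elim=> [|j s [IH1 IH2]].
    rewrite !big_nil oppr0; split; first exact: sip0 sip.
    by rewrite (sipC sip) ?(sip0l sip)//; exact: sip0 sip.
  rewrite !big_cons; split; first exact: (sipD sip).
  rewrite opprD (sipDr sip)//; try exact: (sipN sip).
  rewrite IH2; congr (_ + _).
  have -> : (fun x => grad v x i j) = partial j (fun x => v x 0 i).
    by apply/funext => x; rewrite mxE.
  by rewrite (test_on_ibp j 0 i i j tv tQ) (sipNr sip).
by have [_ <-] := hs (index_enum _).
Qed.

End parts.

End test_fields.

Local Arguments leb {R} d : simpl never.

(** * Formal adjoints of the curl operators *)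

Section curl_two.
Context {R : realType}.
Implicit Types (w K : set 'rV[R]_2).

Lemma ord2P (P : 'I_2 -> Prop) : P 0 -> P 1 -> forall i, P i.
Proof.
move=> P0 P1 i; case: (unliftP ord0 i) => [j|] -> //.
by rewrite (ord1 j); have -> : lift ord0 0 = 1 :> 'I_2 by exact: val_inj.
Qed.

Lemma sum_ord2 (V : nmodType) (F : 'I_2 -> V) : \sum_i F i = F 0 + F 1.
Proof.
rewrite !big_ord_recl big_ord0 addr0.
by have -> : lift ord0 ord0 = 1 :> 'I_2 by exact: val_inj.
Qed.

Lemma curl2E0 (v : 'rV[R]_2 -> 'rV[R]_1) :
  (fun x => curl2 v x 0 0) = partial 1 (fun y => v y 0 0).
Proof. by apply/funext => x; rewrite /curl2 /perp mxE eqxx mxE. Qed.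

Lemma curl2E1 (v : 'rV[R]_2 -> 'rV[R]_1) :
  (fun x => curl2 v x 0 1) = - partial 0 (fun y => v y 0 0).
Proof. by apply/funext => x; rewrite /curl2 /perp mxE /= mxE. Qed.

Lemma rotE (q : 'rV[R]_2 -> 'rV[R]_2) :
  (fun x => Defs.rot q x 0 0) = partial 0 (fun y => q y 0 1) + partial 1 (fun y => - q y 0 0).
Proof.
rewrite /Defs.rot divE sum_ord2; congr (_ + _); congr partial.
  by apply/funext => y; rewrite mxE eqxx.
by apply/funext => y; rewrite mxE.
Qed.

Lemma test_curl2 K (v : 'rV[R]_2 -> 'rV[R]_1) : compact K ->
  test_on K v -> test_on K (curl2 v).
Proof.
move=> cK tv; have [sv v0] := tv.
have v00 := test_entry 0 0 tv.
have p0 k := supp_partial cK k v00; split.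
  move=> i; rewrite (ord1 i); apply: ord2P.
    by rewrite curl2E0; exact: smooth_partial.
  by rewrite curl2E1; apply: smoothN; exact: smooth_partial.
move=> x Kx; apply/rowP; apply: ord2P; rewrite [RHS]mxE.
  by rewrite -[LHS]/((fun x => curl2 v x 0 0) x) curl2E0 p0.
by rewrite -[LHS]/((fun x => curl2 v x 0 1) x) curl2E1 opprfctE p0// oppr0.
Qed.

Lemma test_rot K (q : 'rV[R]_2 -> 'rV[R]_2) : compact K ->
  test_on K q -> test_on K (Defs.rot q).
Proof.
move=> cK tq; have [sq q0] := tq; apply: test_div => //; split.
  move=> i; rewrite (ord1 i); apply: ord2P.
    by rewrite (_ : (fun x => _) = (fun x => q x 0 1))//; apply/funext => x; rewrite mxE eqxx.
  rewrite (_ : (fun x => _) = - (fun x => q x 0 0)); first exact: smoothN.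
  by apply/funext => x; rewrite mxE.
move=> x Kx; apply/rowP => i; rewrite !mxE q0// !mxE oppr0.
by case: ifP.
Qed.

Lemma ip_curl2 w K v q : measurable w -> compact K -> K `<=` w ->
  test_on K v -> test_on K q -> ip w (curl2 v) q = ip w v (Defs.rot q).
Proof.
move=> mw cK Kw tv tq; have sip := semi_ip_sqip (leb 2) mw.
pose V : 'rV[R]_2 -> R := fun y => v y 0 0.
pose Q i : 'rV[R]_2 -> R := fun y => q y 0 i.
have sV : sqint (leb 2) w V := test_on_sqint mw cK Kw 0 0 tv.
have sQ i : sqint (leb 2) w (Q i) := test_on_sqint mw cK Kw 0 i tq.
have pV k : sqint (leb 2) w (partial k V) := test_on_sqint_partial mw cK k 0 0 tv.
have pQ k i : sqint (leb 2) w (partial k (Q i)) := test_on_sqint_partial mw cK k 0 i tq.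
have I k j : sqip (leb 2) w (partial k V) (Q j) = - sqip (leb 2) w V (partial k (Q j)).
  exact: (test_on_ibp cK Kw k 0 0 0 j tv tq).
rewrite (ipE mw (test_on_L2 mw cK Kw (test_curl2 cK tv)) (test_on_L2 mw cK Kw tq)).
rewrite (ipE mw (test_on_L2 mw cK Kw tv) (test_on_L2 mw cK Kw (test_rot cK tq))).
rewrite !big_ord1 sum_ord2 curl2E0 curl2E1 rotE.
transitivity (sqip (leb 2) w V (partial 0 (Q 1) + partial 1 (- Q 0))) => //.
have [sq _] := tq; have -> : partial 1 (- Q 0) = - partial 1 (Q 0).
  by apply: partialN; exact: smooth_derivable (sq 0 0).
rewrite (sipBr sip)//.
transitivity (sqip (leb 2) w (partial 1 V) (Q 0) + sqip (leb 2) w (- partial 0 V) (Q 1)) => //.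
by rewrite (sipNl sip)// !I opprK addrC.
Qed.

End curl_two.

Section curl_three.
Context {R : realType}.
Implicit Types (w K : set 'rV[R]_3).

Lemma curl3E (v : 'rV[R]_3 -> 'rV[R]_3) i :
  (fun x => curl3 v x 0 i) = partial (i + 1) (fun y => v y 0 (i + 2))
    - partial (i + 2) (fun y => v y 0 (i + 1)).
Proof. by apply/funext => x; rewrite /curl3 mxE. Qed.

Lemma test_curl3 K (v : 'rV[R]_3 -> 'rV[R]_3) : compact K ->
  test_on K v -> test_on K (curl3 v).
Proof.
move=> cK tv; have [sv v0] := tv.
have v00 j := test_entry 0 j tv.
split.
  move=> i j; rewrite (ord1 i) curl3E; apply: smoothD.
    exact: smooth_partial.
  by apply: smoothN; exact: smooth_partial.
move=> x Kx; apply/rowP => i; rewrite !mxE.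
by rewrite !(supp_partial cK) ?subrr//; exact: v00.
Qed.

Lemma ip_curl3 w K v q : measurable w -> compact K -> K `<=` w ->
  test_on K v -> test_on K q -> ip w (curl3 v) q = ip w v (curl3 q).
Proof.
move=> mw cK Kw tv tq; have sip := semi_ip_sqip (leb 3) mw.
pose V i : 'rV[R]_3 -> R := fun y => v y 0 i.
pose Q i : 'rV[R]_3 -> R := fun y => q y 0 i.
have sV i : sqint (leb 3) w (V i) := test_on_sqint mw cK Kw 0 i tv.
have sQ i : sqint (leb 3) w (Q i) := test_on_sqint mw cK Kw 0 i tq.
have pV k i : sqint (leb 3) w (partial k (V i)) := test_on_sqint_partial mw cK k 0 i tv.
have pQ k i : sqint (leb 3) w (partial k (Q i)) := test_on_sqint_partial mw cK k 0 i tq.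
have I k i j : sqip (leb 3) w (partial k (V i)) (Q j) =
   - sqip (leb 3) w (V i) (partial k (Q j)).
  exact: (test_on_ibp cK Kw k 0 i 0 j tv tq).
rewrite (ipE mw (test_on_L2 mw cK Kw (test_curl3 cK tv)) (test_on_L2 mw cK Kw tq)).
rewrite (ipE mw (test_on_L2 mw cK Kw tv) (test_on_L2 mw cK Kw (test_curl3 cK tq))).
rewrite !big_ord1.
transitivity (\sum_i (- sqip (leb 3) w (V (i + 2)) (partial (i + 1) (Q i))
                      + sqip (leb 3) w (V (i + 1)) (partial (i + 2) (Q i)))).
  apply: eq_bigr => i _.
  have -> : (fun x => curl3 v x 0 i) =
      partial (i + 1) (V (i + 2)) - partial (i + 2) (V (i + 1)) by exact: curl3E.
  rewrite -/(Q i); transitivity (sqip (leb 3) w (partial (i + 1) (V (i + 2))) (Q i)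
      - sqip (leb 3) w (partial (i + 2) (V (i + 1))) (Q i)).
    exact: (sipBl sip (pV _ _) (pV _ _) (sQ i)).
  by rewrite !I opprK.
(* Cyclic shifts of the index by 1 and by 2 bring the same component [V i] to the front of both
   sums. *)
rewrite big_split/= (reindex_inj (addIr 1))/=.
rewrite [X in _ + X](reindex_inj (addIr 2))/= -big_split/=.
apply: eq_bigr => i _.
have -> : (fun x => curl3 q x 0 i) =
    partial (i + 1) (Q (i + 2)) - partial (i + 2) (Q (i + 1)) by exact: curl3E.
transitivity (sqip (leb 3) w (V i) (partial (i + 1) (Q (i + 2)))
      - sqip (leb 3) w (V i) (partial (i + 2) (Q (i + 1)))); last first.
  by apply/esym; exact: (sipBr sip (pQ _ _) (pQ _ _) (sV i)).
rewrite addrC.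
have -> : i + 1 + 2 = i by apply: val_inj; case: i => [[|[|[|]]]].
have -> : i + 1 + 1 = i + 2 by apply: val_inj; case: i => [[|[|[|]]]].
have -> : i + 2 + 1 = i by apply: val_inj; case: i => [[|[|[|]]]].
have -> : i + 2 + 2 = i + 1 by apply: val_inj; case: i => [[|[|[|]]]].
by [].
Qed.

End curl_three.

Section gradcurl.
Context {R : realType} {d : nat}.
Hypothesis hd : d = 2%N \/ d = 3%N.
Implicit Types (w K : set 'rV[R]_d).

Lemma test_on_curl K (v : bfield R d) : compact K -> test_on K v -> test_on K (curl v).
Proof.
by case: hd => e; subst d => cK tv; [exact: test_curl2|exact: test_curl3].
Qed.

Lemma test_on_curlstar K (q : 'rV[R]_d -> 'rV[R]_d) : compact K ->
  test_on K q -> test_on K (curlstar q).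
Proof.
by case: hd => e; subst d => cK tv; [exact: test_rot|exact: test_curl3].
Qed.

Lemma ip_curl w K (v : bfield R d) q : measurable w -> compact K -> K `<=` w ->
  test_on K v -> test_on K q -> ip w (curl v) q = ip w v (curlstar q).
Proof.
case: hd => e; subst d => mw cK Kw tv tq.
  exact: (ip_curl2 mw cK Kw tv tq).
exact: (ip_curl3 mw cK Kw tv tq).
Qed.

Lemma test_gradcurl w (v : bfield R d) : test w v -> test w (grad (curl v)).
Proof.
move=> /testP[K [cK Kw tK]]; apply/testP; exists K; split => //.
by apply: test_grad => //; exact: test_on_curl.
Qed.

Lemma test_curlstargradstar w (Q : tfield R d) : test w Q ->
  test w (curlstar (gradstar Q)).
Proof.
move=> /testP[K [cK Kw tK]]; apply/testP; exists K; split => //.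
by apply: test_on_curlstar => //; exact: test_gradstar.
Qed.

Lemma ip_gradcurl w (v : bfield R d) (Q : tfield R d) : measurable w ->
  test w v -> test w Q ->
  ip w (grad (curl v)) Q = ip w v (curlstar (gradstar Q)).
Proof.
move=> mw /testP[K1 [cK1 Kw1 tK1]] /testP[K2 [cK2 Kw2 tK2]].
have tS p q K K' (F : 'rV[R]_d -> 'M[R]_(p, q)) : K `<=` K' -> test_on K F -> test_on K' F.
  by move=> KK' [sF F0]; split=> // x K'x; apply: F0 => /KK'.
pose K := K1 `|` K2.
have cK : compact K by exact: compactU.
have Kw : K `<=` w by move=> x [/Kw1|/Kw2].
have tv : test_on K v by apply: tS tK1; exact: subsetUl.
have tQ : test_on K Q by apply: tS tK2; exact: subsetUr.
rewrite (ip_grad mw cK Kw)//; last exact: test_on_curl.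
by rewrite (ip_curl mw cK Kw)//; exact: test_gradstar.
Qed.

End gradcurl.

Section bump_fields.
Context {R : realType} {d : nat}.
Implicit Types w : set 'rV[R]_d.

Lemma test_bump p q w n a b (A : 'M[R]_(p, q)) : cbox a b `<=` w ->
  test w (fun x : 'rV[R]_d => bump n a b x *: A).
Proof.
move=> abw; split.
  move=> i j; apply: bump_alg_smooth.
  rewrite (_ : (fun x => _) = bump n a b * (fun=> A i j)).
    by apply: bump_mul; [exact: bump_bump_alg|exact: bump_cst].
  by apply/funext => x; rewrite mxE.
exists (cbox a b); first by split; [exact: compact_cbox|].
by move=> x xab; rewrite bump_out ?scale0r// => /box_cbox.
Qed.

Lemma sqint_cst w (c : R) : measurable w -> (leb d w < +oo)%E ->
  sqint (leb d) w (cst c).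
Proof.
move=> mw fw; split; first exact: measurable_cst.
rewrite (_ : EFin \o _ = cst (c ^+ 2)%:E); last by apply/funext.
by apply: (@measurable_bounded_integrable _ _ _ (leb d) (cst (c ^+ 2))) => //;
  exact: bounded_cst.
Qed.

Lemma sqint_integrable w g : measurable w -> (leb d w < +oo)%E ->
  sqint (leb d) w g -> (leb d).-integrable w (EFin \o g).
Proof.
move=> mw fw sg; have := sqint_mul mw sg (sqint_cst 1 mw fw).
by congr integrable; apply/funext => x /=; rewrite mulr1.
Qed.

Lemma sqint_ae_eq0 w g : open w -> (leb d w < +oo)%E -> sqint (leb d) w g ->
  (forall n a b, cbox a b `<=` w -> \int[leb d]_(x in w) (g x * bump n a b x) = 0) ->
  ae_eq (leb d) w g (cst 0).
Proof.
move=> ow fw sg; apply: ae_eq0_bump => //.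
by apply: sqint_integrable => //; exact: open_rV_measurable.
Qed.

(** A bump times [delta_mx i j] is a test field that isolates one entry, and the scalar fundamental
    lemma applies to each entry. *)
Lemma L2_test_eq0 p q w (F : 'rV[R]_d -> 'M[R]_(p, q)) : open w ->
  (leb d w < +oo)%E -> L2 w F -> (forall Phi, test w Phi -> ip w F Phi = 0) ->
  aeeq w F 0.
Proof.
move=> ow fw hF F0; have mw := open_rV_measurable ow.
have /(L2P _ mw) sF := hF.
have e0 i j : ae_eq (leb d) w (fun x => F x i j) (cst 0).
  apply: sqint_ae_eq0 => // n a b abw.
  rewrite -(F0 _ (test_bump n (delta_mx i j) abw)).
  apply: eq_Rintegral => x _; rewrite (bigD1 i)//= (bigD1 j)//= !mxE !eqxx mulr1.
  rewrite big1 => [|l lj]; last by rewrite !mxE (negPf lj) andbF !mulr0.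
  rewrite addr0 big1 ?addr0// => l li; rewrite big1// => m _.
  by rewrite !mxE (negPf li) !mulr0.
have : {ae leb d, forall x, forall ij : 'I_p * 'I_q, w x -> F x ij.1 ij.2 = 0}.
  by apply: filter_forall => -[i j]; exact: e0.
by apply: filterS => x h wx; apply/matrixP => i j; rewrite mxE; exact: (h (i, j)).
Qed.

End bump_fields.

(** * Weak derivatives *)

Section weak_operators.
Context {R : realType} {d p q r s : nat}.
Variable D : ('rV[R]_d -> 'M[R]_(r, s)) -> 'rV[R]_d -> 'M[R]_(p, q).
Hypothesis hD : forall w Phi, test w Phi -> test w (D Phi).
Implicit Types (w : set 'rV[R]_d) (v : 'rV[R]_d -> 'M[R]_(p, q))
  (G : 'rV[R]_d -> 'M[R]_(r, s)).

(** [D] plays the formal adjoint. With [curlstar] after [gradstar] this unfolds to [is_gradcurl],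
    with [grad] after [curl] to [is_curlstargradstar], so both operators are treated at once. *)
Definition is_weak w v G : Prop :=
  L2 w G /\ forall Phi, test w Phi -> ip w G Phi = ip w v (D Phi).

Lemma weak_lin w (k : R) v v' G G' : measurable w -> L2 w v -> L2 w v' ->
  is_weak w v G -> is_weak w v' G' -> is_weak w (k *: v + v') (k *: G + G').
Proof.
move=> mw hv hv' [hG GP] [hG' GP'].
have sL1 := @semi_ip_L2 R d r s w mw; have sL2 := @semi_ip_L2 R d p q w mw.
split; first exact: (sipL sL1).
move=> Phi tPhi; have tD := hD tPhi.
rewrite (sip_linear sL1)//; last exact: test_L2.
rewrite (sip_linear sL2)//; last exact: test_L2.
by rewrite GP// GP'.
Qed.

Lemma weak_unique w v G G' : open w -> (leb d w < +oo)%E ->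
  is_weak w v G -> is_weak w v G' -> aeeq w G G'.
Proof.
move=> ow fw [hG GP] [hG' GP']; have mw := open_rV_measurable ow.
have sL1 := @semi_ip_L2 R d r s w mw.
have : aeeq w (G - G') 0.
  apply: L2_test_eq0 => //; first exact: (sipB sL1).
  move=> Phi tPhi; rewrite (sipBl sL1)//; last exact: test_L2.
  by rewrite GP// GP'// subrr.
by apply: filterS => x h wx; apply/eqP; rewrite -subr_eq0; apply/eqP; exact: h.
Qed.

Lemma weak_restrict w w' v G : measurable w -> measurable w' -> w' `<=` w ->
  is_weak w v G -> is_weak w' v G.
Proof.
move=> mw mw' ww' [hG GP]; split; first exact: (L2S mw).
move=> Phi tPhi; have tD := hD tPhi.
have [_ [K [_ Kw'] P0]] := tPhi; have [_ [K2 [_ K2w'] D0]] := tD.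
rewrite (@ip_supp _ _ _ _ w w')//; last by move=> x wx; apply: P0 => /Kw'.
rewrite [RHS](@ip_supp _ _ _ _ w w')//; last by move=> x wx; apply: D0 => /K2w'.
by apply: GP; exact: testS tPhi.
Qed.

Lemma weak_ae w v v' G : measurable w -> L2 w v -> L2 w v' -> aeeq w v v' ->
  is_weak w v G -> is_weak w v' G.
Proof.
move=> mw hv hv' vv' [hG GP]; split=> // Phi tPhi; rewrite GP//.
by apply: ip_ae => //; apply: test_L2 => //; exact: hD.
Qed.

Lemma weak_ae_r w v G G' : measurable w -> L2 w G' -> aeeq w G G' ->
  is_weak w v G -> is_weak w v G'.
Proof.
move=> mw hG' GG' [hG GP]; split=> // Phi tPhi; rewrite -GP//.
by apply/esym; apply: ip_ae => //; exact: test_L2.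
Qed.

Lemma weak_closed w v G : measurable w -> L2 w v -> L2 w G ->
  (forall e : R, 0 < e -> exists v' G', [/\ L2 w v', is_weak w v' G',
     ip w (v' - v) (v' - v) < e & ip w (G' - G) (G' - G) < e]) ->
  is_weak w v G.
Proof.
move=> mw hv hG h; split=> // Phi tPhi.
have sL1 := @semi_ip_L2 R d r s w mw; have sL2 := @semi_ip_L2 R d p q w mw.
have LP : L2 w Phi by exact: test_L2.
have LD : L2 w (D Phi) by apply: test_L2 => //; exact: hD.
apply/eqP; rewrite -subr_eq0 -normr_le0; apply/ler_addgt0Pr => e e0; rewrite add0r.
pose A := sip_norm (ip w) Phi; pose B := sip_norm (ip w) (D Phi).
have A0 : 0 <= A by exact: sip_norm_ge0. have B0 : 0 <= B by exact: sip_norm_ge0.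
(* The errors in [v] and [G] get multiplied by the norms [B] and [A] of the fixed test data; the
   [+ 1] keeps the divisor positive. *)
have AB : 0 < A + B + 1 by rewrite ltr_wpDl ?addr_ge0.
have dl : 0 < e / (A + B + 1) by rewrite divr_gt0.
have [v' [G' [hv' [hG' GP'] h1 h2]]] := h _ (exprn_gt0 2 dl).
have Sv : L2 w (v' - v) by exact: (sipB sL2).
have SG : L2 w (G' - G) by exact: (sipB sL1).
have n1 : sip_norm (ip w) (v' - v) <= e / (A + B + 1).
  rewrite -[leRHS]ger0_norm ?(ltW dl)// -sqrtr_sqr ler_wsqrtr//; exact: ltW.
have n2 : sip_norm (ip w) (G' - G) <= e / (A + B + 1).
  rewrite -[leRHS]ger0_norm ?(ltW dl)// -sqrtr_sqr ler_wsqrtr//; exact: ltW.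
have -> : ip w G Phi - ip w v (D Phi) = ip w (v' - v) (D Phi) - ip w (G' - G) Phi.
  by rewrite (sipBl sL2)// (sipBl sL1)// GP'//; ring.
apply: le_trans (ler_normB _ _) _.
have := sip_cs sL2 Sv LD; have := sip_cs sL1 SG LP; rewrite -/A -/B.
have : e / (A + B + 1) * (A + B + 1) = e by rewrite divfK// gt_eqF.
move: (sip_norm_ge0 (ip w) (v' - v)) (sip_norm_ge0 (ip w) (G' - G)) n1 n2 dl.
move: (sip_norm _ (v' - v)) (sip_norm _ (G' - G)) (`|ip w (v' - v) _|) (`|ip w (G' - G) _|).
move: (e / _) => c x y X Y x0 y0 n1 n2 dl ce hY hX.
have : x * B <= c * B by rewrite ler_wpM2r.
have : y * A <= c * A by rewrite ler_wpM2r.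
rewrite -ce; lra.
Qed.

End weak_operators.

Lemma gradstar_scalar (R : realType) d (b : 'rV[R]_d -> R) i :
  (fun x => gradstar (fun y => b y *: 1%:M : 'M[R]_d) x 0 i) = - partial i b.
Proof.
apply/funext => x; rewrite /gradstar mxE opprfctE; congr (- _).
rewrite mxE (bigD1 i)//= big1 ?addr0 => [|j ji].
  by congr (partial i _ x); apply/funext => y; rewrite !mxE eqxx mulr1.
rewrite (_ : (fun y => _) = cst 0) ?partial_cst//.
by apply/funext => y; rewrite !mxE eq_sym (negPf ji) mulr0.
Qed.

Lemma ip0r (R : realType) d p q (w : set 'rV[R]_d) (F G : 'rV[R]_d -> 'M[R]_(p, q)) :
  (forall x, w x -> G x = 0) -> ip w F G = 0.
Proof.
move=> G0; rewrite /ip /Rintegral integral0_eq// => x wx.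
by rewrite big1// => i _; rewrite big1// => j _; rewrite G0// mxE mulr0.
Qed.

(** * Trace-free matrix fields *)

Section trace_free.
Context {R : realType} {d : nat}.

(** Pairing with a bump times the identity integrates the bump against the trace. This form of the
    condition survives limits and can be checked on weak derivatives. *)
Lemma trace_freeP (w : set 'rV[R]_d) (G : tfield R d) : open w ->
  (leb d w < +oo)%E -> L2 w G ->
  {ae leb d, forall x, w x -> \tr (G x) = 0} <->
  forall n a b, cbox a b `<=` w -> ip w G (fun x => bump n a b x *: 1%:M) = 0.
Proof.
move=> ow fw hG; have mw := open_rV_measurable ow.
have /(L2P _ mw) sG := hG; have sip := semi_ip_sqip (leb d) mw.
have sT : sqint (leb d) w (\sum_i (fun x => G x i i)).
  elim: (index_enum _) => [|i s IH]; first by rewrite big_nil; exact: sip0 sip.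
  by rewrite big_cons; exact: (sipD sip).
have trE x : (\sum_i (fun x => G x i i)) x = \tr (G x) by rewrite fct_sumE.
have ipE n a b : ip w G (fun x => bump n a b x *: 1%:M) =
    \int[leb d]_(x in w) ((\sum_i (fun x => G x i i)) x * bump n a b x).
  apply: eq_Rintegral => x _; rewrite trE /mxtrace mulr_suml.
  apply: eq_bigr => i _; rewrite (bigD1 i)//= !mxE eqxx mulr1.
  by rewrite big1 ?addr0// => j ji; rewrite !mxE eq_sym (negPf ji) !mulr0.
split=> [h n a b abw|h].
  have sb : sqint (leb d) w (bump n a b).
    have /(L2P _ mw)/(_ 0 0) := test_L2 mw (test_bump n (1%:M : 'M[R]_1) abw).
    by congr sqint; apply/funext => x; rewrite !mxE eqxx mulr1.
  rewrite ipE; transitivity (sqip (leb d) w (\sum_i (fun x => G x i i)) (bump n a b)) => //.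
  rewrite (@sqip_ae _ _ _ (leb d) w mw _ 0 _ sT (sip0 sip) sb) ?(sip0l sip)//.
  by apply: filterS h => x hx wx; rewrite trE hx.
apply: filterS (sqint_ae_eq0 ow fw sT _) => [x /= hx wx|n a b abw].
  by rewrite -trE hx.
by rewrite -ipE h.
Qed.

Hypothesis hd : d = 2%N \/ d = 3%N.
Implicit Types (w : set 'rV[R]_d).

(** Row-wise divergence turns [b] times the identity into the gradient of [b], and the rotation of a
    gradient vanishes because mixed derivatives of [b] commute. *)
Lemma curlstar_gradstar_scalar (b : 'rV[R]_d -> R) x : bump_alg b ->
  curlstar (gradstar (fun y => b y *: 1%:M : 'M[R]_d)) x = 0.
Proof.
move=> bb.
have dN k l : partial k (- partial l b) = - partial k (partial l b).
  apply: partialN; apply: smooth_derivable; apply: smooth_partial.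
  exact: bump_alg_smooth.
case: hd => e; subst d.
  apply/rowP => i; rewrite (ord1 i) [RHS]mxE.
  have /(congr1 (@^~ x)) /= -> := rotE (gradstar (fun y => b y *: 1%:M : 'M[R]_2)).
  rewrite gradstar_scalar (_ : (fun y => - _) = partial 0 b); last first.
    apply/funext => y.
    have /(congr1 (@^~ y)) /= -> := gradstar_scalar b 0.
    by rewrite opprfctE opprK.
  by rewrite dN (bump_alg_partialC 1 0 bb) addrC subrr.
apply/rowP => i; rewrite [RHS]mxE.
have /(congr1 (@^~ x)) /= -> := curl3E (gradstar (fun y => b y *: 1%:M : 'M[R]_3)) i.
by rewrite !gradstar_scalar !dN (bump_alg_partialC (i + 2) (i + 1) bb) subrr.
Qed.

(* curl* grad* annihilates scalar multiples of the identity. *)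
Lemma is_gradcurl_trace w (v : bfield R d) (G : tfield R d) : open w ->
  (leb d w < +oo)%E -> is_gradcurl w v G ->
  {ae leb d, forall x, w x -> \tr (G x) = 0}.
Proof.
move=> ow fw [hG GP]; apply/(trace_freeP ow fw hG) => n a b abw.
rewrite GP ?ip0r//; last exact: test_bump.
by move=> x _; apply: curlstar_gradstar_scalar; exact: bump_bump_alg.
Qed.

End trace_free.

Section poincare.
Context {R : realType}.

(** The one-directional inequality is used twice in coordinate 0, first on [phi] and then on its
    derivative; the second derivative is, up to sign, the entry [(1, 0)] of [grad (curl phi)]. *)
Lemma poincare2 (w : set 'rV[R]_2) M (phi : bfield R 2) : measurable w ->
  w `<=` cube 2 M -> test w phi ->
  ip w phi phi <= (2 * M) ^+ 2 * ((2 * M) ^+ 2 * ip w (grad (curl phi)) (grad (curl phi))).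
Proof.
move=> mw wM tphi; have /testP[K [cK Kw tK]] := tphi; have [sphi phi0] := tK.
pose f : 'rV[R]_2 -> R := fun x => phi x 0 0.
have f0 : forall x, ~ K x -> f x = 0 by exact: test_entry tK.
have sf : smooth f by exact: (sphi 0 0).
have p1 := poincare_coord mw cK Kw wM (smooth_C1 0 sf) f0.
have p2 := poincare_coord mw cK Kw wM (smooth_C1 0 (smooth_partial 0 sf))
  (supp_partial cK 0 f0).
rewrite (ipE mw (test_L2 mw tphi) (test_L2 mw tphi)) !big_ord1.
apply: le_trans p1 _; rewrite ler_wpM2l ?sqr_ge0//; apply: le_trans p2 _.
rewrite ler_wpM2l ?sqr_ge0//.
have hd : 2%N = 2%N \/ 2%N = 3%N by left.
have LG : L2 w (grad (curl phi)) by apply: test_L2 => //; exact: test_gradcurl.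
apply: le_trans (sqip_le_ip mw 1 0 LG).
have -> : (fun x => grad (curl phi) x 1 0) = - partial 0 (partial 0 f).
  transitivity (partial 0 (fun x => curl2 phi x 0 1)).
    by apply/funext => x; rewrite mxE.
  rewrite curl2E1; apply: partialN; apply: smooth_derivable.
  exact: smooth_partial.
rewrite le_eqVlt; apply/orP; left; apply/eqP.
by apply: eq_Rintegral => x _; rewrite opprfctE mulrNN.
Qed.

End poincare.

(** * Meshes *)

Section mesh_facts.
Context {R : realType} {d : nat}.
Implicit Types (w : set 'rV[R]_d).

Lemma continuous_dotp (e : 'rV[R]_d) : continuous (fun x => dotp x e).
Proof.
rewrite /dotp (_ : (fun x => _) = \sum_i (fun x : 'rV[R]_d => x ord0 i * e ord0 i)).
  elim: (index_enum _) => [|i s IH].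
    by rewrite big_nil; exact: cst_continuous.
  rewrite big_cons => x; apply: (continuousD _ (IH x)).
  apply: (@continuousM _ _ (fun x : 'rV[R]_d => x ord0 i) (cst (e ord0 i))).
    exact: coord_continuous.
  exact: cst_continuous.
by apply/funext => x; rewrite fct_sumE.
Qed.

Lemma lipschitz_cont (phi : 'rV[R]_d -> R) : lipschitz phi -> continuous phi.
Proof.
move=> [M [_ MP]] x A /nbhs_ballP[e /= e0 eA]; apply/nbhs_ballP.
pose k := `|M| + 1.
have k0 : 0 < k by rewrite ltr_wpDl.
have Mk : M < k by apply: le_lt_trans (ler_norm _) _; rewrite ltrDl.
exists (e / k) => /=; first by rewrite divr_gt0.
move=> y; rewrite -ball_normE/= => xy; apply: eA; rewrite -ball_normE/=.
have := MP k Mk (x, y) => /(_ (conj I I))/= /le_lt_trans; apply.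
by rewrite mulrC -ltr_pdivlMr.
Qed.

(* Moving against e from a boundary point leaves the closure of w. *)
Lemma lipschitz_domain_interior w (A : set 'rV[R]_d) : lipschitz_domain w ->
  open A -> A `<=` closure w -> A `<=` w.
Proof.
move=> [ow _ _ _ lip] oA Aw x Ax; apply: contrapT => wx.
have bx : boundary w x.
  split; first exact: Aw.
  by move=> /interior_subset.
have [e [phi [U [e1 /lipschitz_cont phic phie Ux wU]]]] := lip x bx.
have ex : dotp x e <= phi x.
  rewrite leNgt; apply/negP => h; apply: wx; apply/wU => //.
  exact: nbhs_singleton Ux.
pose y (t : R) := x + (- t) *: e.
have UA : nbhs x (U° `&` A).
  by apply: filterI; [exact: nbhs_interior|exact: open_nbhs_nbhs].
have /nbhs_ballP[r /= r0 rP] := UA.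
(* Small enough for [y t] to stay in the ball of radius [r] around [x], even though only [dotp e e],
   not this norm, is normalized. *)
pose t := r / (`|e| + 1).
have k0 : 0 < `|e| + 1 by rewrite ltr_wpDl.
have t0 : 0 < t by rewrite divr_gt0.
have [Uy Ay] : (U° `&` A) (y t).
  apply: rP; rewrite -ball_normE/= /y opprD addrA subrr add0r normrN normrZ.
  by rewrite normrN gtr0_norm// /t mulrAC ltr_pdivrMr// ltr_pM2l// ltrDl.
have dy : dotp (y t) e < phi (y t).
  rewrite /y phie; apply: lt_le_trans ex.
  have -> : dotp (x + - t *: e) e = dotp x e - t * dotp e e.
    rewrite /dotp mulr_sumr -sumrB; apply: eq_bigr => i _.
    by rewrite !mxE; ring.
  by rewrite e1 mulr1 ltrBlDr ltrDl.
(* Strictly below the graph, within [U], there is no point of [w]; this region is open, so it cannot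
   contain a point of the closure such as [y t]. *)
pose B := [set z | 0 < phi z - dotp z e].
have oB : open B.
  rewrite (_ : B = (fun z => phi z - dotp z e) @^-1` [set u | 0 < u])//.
  apply: open_comp; last exact: open_gt.
  by move=> z _; exact: (cvgB (phic z) (@continuous_dotp e z)).
have By : B (y t) by rewrite /B/= subr_gt0.
have nB : nbhs (y t) (U° `&` B).
  apply: filterI; last exact: open_nbhs_nbhs.
  by apply: open_nbhs_nbhs; split=> //; exact: open_interior.
have [z [wz [Uz Bz]]] := Aw _ Ay _ nB.
have := (wU z (interior_subset Uz)).1 wz.
by move: Bz; rewrite /B/= subr_gt0 => /ltW; rewrite leNgt => /negP.
Qed.

Lemma boundary_negligible w : lipschitz_polyhedron w ->
  (leb d).-negligible (boundary w).
Proof.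
move=> [_ [H H0 wH]].
apply: (@negligibleS _ _ _ _ (\bigcup_(h in [set h | h \in H]) [set x | dotp h.1 x = h.2])).
  by move=> x /wH[h hH hx]; exists h.
elim: H H0 {wH} => [|h H IH] H0.
  rewrite (_ : \bigcup_(_ in _) _ = set0); first exact: negligible_set0.
  by apply/seteqP; split=> // x [].
rewrite (_ : \bigcup_(_ in _) _ = [set x | dotp h.1 x = h.2] `|`
   \bigcup_(h in [set h | h \in H]) [set x | dotp h.1 x = h.2]).
  apply: negligibleU; last by apply: IH => k kH; apply: H0; rewrite inE kH orbT.
  exists [set x | dotp h.1 x = h.2]; split => //.
    exact: measurable_hyperplane.
  by apply: hyperplane_null; apply: H0; rewrite inE eqxx.
apply/seteqP; split=> x.
  move=> [k /=]; rewrite inE => /orP[/eqP->|kH] kx; [by left|by right; exists k].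
by move=> [hx|[k kH kx]]; [exists h => //=; rewrite inE eqxx|
  exists k => //=; rewrite inE kH orbT].
Qed.

Lemma leb_bounded w : measurable w -> bounded_set w -> (leb d w < +oo)%E.
Proof.
move=> mw /bounded_cube[M wM]; apply: le_lt_trans (leb_cube d M).
by apply: le_measure; rewrite ?inE//; exact: measurable_cbox.
Qed.

Section mesh.
Variables (Omega : set 'rV[R]_d) (N : nat) (T : 'I_N -> set 'rV[R]_d).
Hypotheses (hOmega : lipschitz_domain Omega) (hT : mesh Omega T).

Lemma mesh_open i : open (T i).
Proof. by case: hT => /(_ i)[[]]. Qed.

(** The mesh condition speaks of closures, under which an element could cover a slit of the domain;
    the Lipschitz boundary excludes slits. *)
Lemma mesh_sub i : T i `<=` Omega.
Proof.
apply: lipschitz_domain_interior => //; first exact: mesh_open.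
case: hT => _ _ ->; move=> x Tx; exists i => //; exact: subset_closure.
Qed.

Lemma mesh_disjoint i j : i != j -> T i `&` T j = set0.
Proof. by case: hT => _ h _; exact: h. Qed.

(** A point of the domain lies in some closed element, so one that is in no element is on the
    boundary of one, and polyhedral boundaries lie in finitely many hyperplanes. *)
Lemma mesh_negligible : (leb d).-negligible (Omega `\` \bigcup_i T i).
Proof.
case: hT => pT _ cl.
have : {ae leb d, forall x, forall i, ~ boundary (T i) x}.
  apply: filter_forall => i.
  apply: negligibleS (boundary_negligible (pT i)) => x /=.
  exact: contrapT.
apply: negligibleS => x [Ox nT] /= h; apply: nT.
have : closure Omega x by exact: subset_closure.
rewrite cl => -[i _ Tix]; exists i => //.
apply: interior_subset; apply: contrapT => nI; exact: (h i).
Qed.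

End mesh.

End mesh_facts.

Section quadratic_tools.
Context {R : realType}.

Lemma sqr_small_eq0 (D K : R) : (forall e, 0 < e -> D ^+ 2 <= e * K) -> D = 0.
Proof.
move=> h; apply/eqP; rewrite -sqrf_eq0 eq_le sqr_ge0 andbT.
apply/ler_addgt0Pr => e e0; rewrite add0r.
have k0 : 0 < `|K| + 1 by rewrite ltr_wpDl.
apply: le_trans (h (e / (`|K| + 1)) (divr_gt0 e0 k0)) _.
rewrite mulrAC ler_pdivrMr// ler_pM2l//.
by rewrite (le_trans (ler_norm K))// lerDl.
Qed.

Context {E : lmodType R}.
Variables (S : set E) (a : E -> E -> R).
Hypothesis H : semi_ip S a.

Lemma sip_sqrD_le k x y : S x -> S y ->
  a (k *: x + y) (k *: x + y) <= 2 * (k ^+ 2 * a x x + a y y).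
Proof.
move=> Sx Sy; have := sip_ge0 H (sipD H Sy (sipZ H (- k) Sx)).
rewrite [k *: x + y]addrC !(sip_sqrD H)// sqrrN; lra.
Qed.

Lemma sip_norm_near x y d : 0 < d -> d <= 1 -> S x -> S y ->
  a (y - x) (y - x) < d ^+ 2 ->
  `|a y y - a x x| <= (2 * sip_norm a x + 1) * d.
Proof.
move=> d0 d1 Sx Sy yx; have Syx : S (y - x) by exact: (sipB H).
have -> : a y y - a x x = 2 * a x (y - x) + a (y - x) (y - x).
  have {1 2}-> : y = x + 1 *: (y - x) by rewrite scale1r addrC subrK.
  rewrite (sip_sqrD H)//; ring.
have h1 := sip_cs H Sx Syx.
have h2 : sip_norm a (y - x) <= d.
  rewrite /sip_norm -(ger0_norm (ltW d0)) -sqrtr_sqr ler_wsqrtr//; exact: ltW.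
have h3 : a (y - x) (y - x) <= d.
  by apply: le_trans (ltW yx) _; rewrite expr2 ler_piMl// ltW.
have h4 := sip_ge0 H Syx; have h5 := sip_norm_ge0 a x.
have h6 : `|a x (y - x)| <= sip_norm a x * d.
  by apply: le_trans h1 _; rewrite ler_wpM2l.
apply: le_trans (ler_normD _ _) _.
rewrite normrM (ger0_norm (ler0n _ 2)) (ger0_norm h4).
by apply: le_trans (lerD (ler_wpM2l _ h6) h3) _ => //; lra.
Qed.

End quadratic_tools.

(** * Closed relations and adjoints *)

Section graph_space.
Context {R : realType} {E F : lmodType R}.
Variables (SE : set E) (a : E -> E -> R) (SF : set F) (b : F -> F -> R).
Hypotheses (ha : semi_ip SE a) (hb : semi_ip SF b).

Definition graph_ip (z z' : E * F) : R := a z.1 z'.1 + b z.2 z'.2.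

Definition graph_set (G : E -> F -> Prop) : set (E * F) := [set z | G z.1 z.2].

Definition lin_rel (G : E -> F -> Prop) := G 0 0 /\
  forall k x y x' y', G x y -> G x' y' -> G (k *: x + x') (k *: y + y').

(** Besides limits, this covers changes by vectors of norm zero: a closed relation does not see
    modifications on null sets. *)
Definition closed_rel (G : E -> F -> Prop) := forall x y, SE x -> SF y ->
  (forall e : R, 0 < e -> exists x' y', [/\ G x' y',
    a (x' - x) (x' - x) < e & b (y' - y) (y' - y) < e]) -> G x y.

Variable G : E -> F -> Prop.
Hypotheses (linG : lin_rel G) (subG : forall x y, G x y -> SE x /\ SF y).

Lemma semi_ip_graph : semi_ip (graph_set G) graph_ip.
Proof.
case: linG => G0 GL; split => //.
- by move=> k [x y] [x' y']; exact: GL.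
- move=> [x y] [x' y'] /subG[/= ? ?] /subG[/= ? ?].
  by rewrite /graph_ip/= (sipC ha)// (sipC hb).
- move=> k [x y] [x' y'] [x'' y''] /subG[/= ? ?] /subG[/= ? ?] /subG[/= ? ?].
  by rewrite /graph_ip/= (sip_linear ha)// (sip_linear hb)//; ring.
- by move=> [x y] /subG[/= ? ?]; rewrite /graph_ip/= addr_ge0// ?(sip_ge0 ha)// (sip_ge0 hb).
Qed.

Lemma complete_graph : complete_ip SE a -> complete_ip SF b -> closed_rel G ->
  complete_ip (graph_set G) graph_ip.
Proof.
move=> cE cF cG u Gu uC.
have uE n : SE (u n).1 by have [] := subG (Gu n).
have uF n : SF (u n).2 by have [] := subG (Gu n).
have [|x Sx xP] := cE _ uE.
  move=> e /uC[N NP]; exists N => m n Nm Nn; apply: le_lt_trans (NP m n Nm Nn).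
  by rewrite /graph_ip/= lerDl (sip_ge0 hb)//; exact: (sipB hb).
have [|y Sy yP] := cF _ uF.
  move=> e /uC[N NP]; exists N => m n Nm Nn; apply: le_lt_trans (NP m n Nm Nn).
  by rewrite /graph_ip/= lerDr (sip_ge0 ha)//; exact: (sipB ha).
exists (x, y).
  apply: cG => // e e0; have [N NP] := xP e e0; have [M MP] := yP e e0.
  exists (u (maxn N M)).1, (u (maxn N M)).2; split; first exact: Gu.
    by apply: NP; exact: leq_maxl.
  by apply: MP; exact: leq_maxr.
move=> e e0; have e20 : 0 < e / 2 by rewrite divr_gt0.
have [N NP] := xP _ e20; have [M MP] := yP _ e20.
exists (maxn N M) => n; rewrite geq_max => /andP[/NP h1 /MP h2].
by rewrite /graph_ip/= [ltRHS](splitr e) ltrD.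
Qed.

End graph_space.

Section adjoint_pair.
Context {R : realType} {E F : lmodType R}.
Variables (SE : set E) (a : E -> E -> R) (SP : set F) (b : F -> F -> R).
Hypotheses (ha : semi_ip SE a) (hb : semi_ip SP b).
Hypotheses (cE : complete_ip SE a) (cF : complete_ip SP b).
Variable A : E -> F -> Prop.
Hypotheses (linA : lin_rel A) (subA : forall x y, A x y -> SE x /\ SP y).

Definition rel_closure (v : E) (g : F) : Prop := [/\ SE v, SP g &
  forall e : R, 0 < e -> exists x y, [/\ A x y,
    a (x - v) (x - v) < e & b (y - g) (y - g) < e]].

Definition rel_adjoint (Q : F) (c : E) : Prop := [/\ SP Q, SE c &
  forall x y, A x y -> b y Q = a x c].

Local Notation HO := rel_closure.
Local Notation CO := rel_adjoint.

Lemma sub_rel_closure x y : A x y -> HO x y.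
Proof.
move=> Axy; have [Sx Sy] := subA Axy; split=> // e e0; exists x, y; split => //.
  by rewrite subrr (sip0l ha)//; exact: sip0 ha.
by rewrite subrr (sip0l hb)//; exact: sip0 hb.
Qed.

Lemma rel_closure_lin : lin_rel HO.
Proof.
split; first by apply: sub_rel_closure; case: linA.
move=> k x y x' y' [Sx Sy xy] [Sx' Sy' xy']; split.
- exact: (sipL ha).
- exact: (sipL hb).
(* The divisor is the total weight in the estimate [sip_sqrD_le] for a combination with coefficients
   [k] and 1. *)
move=> e e0; pose e' := e / (2 * (k ^+ 2 + 1)).
have k0 : 0 < 2 * (k ^+ 2 + 1) by rewrite mulr_gt0// ltr_wpDl// sqr_ge0.
have e'0 : 0 < e' by rewrite divr_gt0.
have [x1 [y1 [A1 h1 h2]]] := xy _ e'0; have [x2 [y2 [A2 h3 h4]]] := xy' _ e'0.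
have [S1 S2] := subA A1; have [S3 S4] := subA A2.
exists (k *: x1 + x2), (k *: y1 + y2); split; first by case: linA => _; exact.
- rewrite opprD addrACA -scalerBr.
  apply: le_lt_trans (sip_sqrD_le ha k (sipB ha S1 Sx) (sipB ha S3 Sx')) _.
  rewrite -(@divfK _ (2 * (k ^+ 2 + 1)) _ e) ?gt_eqF// -/e'.
  have := ler_wpM2l (sqr_ge0 k) (ltW h1); lra.
- rewrite opprD addrACA -scalerBr.
  apply: le_lt_trans (sip_sqrD_le hb k (sipB hb S2 Sy) (sipB hb S4 Sy')) _.
  rewrite -(@divfK _ (2 * (k ^+ 2 + 1)) _ e) ?gt_eqF// -/e'.
  have := ler_wpM2l (sqr_ge0 k) (ltW h2); lra.
Qed.

Lemma rel_closure_sub x y : HO x y -> SE x /\ SP y.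
Proof. by case. Qed.

Lemma rel_closure_closed : closed_rel SE a SP b HO.
Proof.
move=> x y Sx Sy h; split=> // e e0.
have e4 : 0 < e / 4 by rewrite divr_gt0.
have [x1 [y1 [[Sx1 Sy1 xy1] h1 h2]]] := h _ e4.
have [x2 [y2 [A2 h3 h4]]] := xy1 _ e4; have [Sx2 Sy2] := subA A2.
exists x2, y2; split => //.
  have := sip_sqrD_le ha 1 (sipB ha Sx2 Sx1) (sipB ha Sx1 Sx).
  rewrite scale1r addrA subrK; lra.
have := sip_sqrD_le hb 1 (sipB hb Sy2 Sy1) (sipB hb Sy1 Sy).
rewrite scale1r addrA subrK; lra.
Qed.

(** The identity holds on [A] by definition of the adjoint and passes to the closure by
    Cauchy-Schwarz. It is the integration by parts formula for global fields, without boundary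
    term. *)
Lemma green v g Q c : HO v g -> CO Q c -> b g Q = a v c.
Proof.
move=> [Sv Sg vg] [SQ Sc Qc]; apply/eqP; rewrite -subr_eq0; apply/eqP.
apply: (@sqr_small_eq0 _ _ (2 * (b Q Q + a c c))) => e /vg[x [y [Axy h1 h2]]].
have [Sx Sy] := subA Axy.
have -> : b g Q - a v c = a (x - v) c - b (y - g) Q.
  by rewrite (sipBl ha)// (sipBl hb)// (Qc _ _ Axy); ring.
have hx : SE (x - v) by exact: (sipB ha).
have hy : SP (y - g) by exact: (sipB hb).
have k1 := cauchy_schwarz ha hx Sc; have k2 := cauchy_schwarz hb hy SQ.
have k3 := ler_wpM2r (sip_ge0 ha Sc) (ltW h1).
have k4 := ler_wpM2r (sip_ge0 hb SQ) (ltW h2).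
have := sqr_ge0 (a (x - v) c + b (y - g) Q); rewrite sqrrD sqrrB.
move: (a (x - v) c) (b (y - g) Q) k1 k2 => s t k1 k2; nra.
Qed.

(* The closure of an operator is its second adjoint: the part of (X, Y)
   orthogonal to the closure gives an element of the adjoint that pairs with
   (X, Y) to minus its own norm. *)
Lemma rel_closure_biadjoint X Y : SE X -> SP Y ->
  (forall Q c, CO Q c -> b Y Q = a X c) -> HO X Y.
Proof.
move=> SX SY h.
have hg := semi_ip_graph ha hb rel_closure_lin rel_closure_sub.
have cg := complete_graph ha hb rel_closure_sub cE cF rel_closure_closed.
have hf : lin_rel (fun x y => SE x /\ SP y).
  split; first by split; [exact: sip0 ha|exact: sip0 hb].
  by move=> k x y x' y' [? ?] [? ?]; split; [exact: (sipL ha)|exact: (sipL hb)].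
have hfull := @semi_ip_graph _ _ _ SE a SP b ha hb _ hf (fun x y => id).
pose L := graph_ip a b (X, Y).
have [||[v g] /= vgP rP] :=
    @riesz _ _ _ _ hg L (graph_ip a b (X, Y) (X, Y)) cg.
- move=> k x y /rel_closure_sub Sx /rel_closure_sub Sy.
  rewrite /L (sipC hfull)//; last by apply: (sipL hfull).
  by rewrite (sip_linear hfull)// !(sipC hfull _ (conj SX SY : graph_set _ (X, Y))).
- by move=> x /rel_closure_sub Sx; exact: (cauchy_schwarz hfull).
have [Sv Sg _] := vgP.
have SXv : SE (X - v) by exact: (sipB ha).
have SYg : SP (Y - g) by exact: (sipB hb).
have COz : CO (Y - g) (- (X - v)).
  split => //; first exact: (sipN ha).
  move=> x y Axy; have [Sx Sy] := subA Axy.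
  have := rP (x, y) (sub_rel_closure Axy); rewrite /L /graph_ip/= => e.
  rewrite (sipNr ha)// (sipC ha Sx)// (sipC hb Sy)// (sipBl ha)// (sipBl hb)//.
  lra.
have e0 : b (Y - g) (Y - g) = - a (X - v) (X - v).
  rewrite -(sipNr ha)// [LHS](sipBl hb)// [RHS](sipBl ha)//; last exact: (sipN ha).
  by rewrite (h _ _ COz) (green vgP COz).
have p1 := sip_ge0 ha SXv; have p2 := sip_ge0 hb SYg.
apply: rel_closure_closed => // e ep; exists v, g; split => //.
  rewrite -opprB (sipNl ha) ?(sipNr ha)//; last exact: (sipN ha).
  lra.
rewrite -opprB (sipNl hb) ?(sipNr hb)//; last exact: (sipN hb).
lra.
Qed.

(** Both sides are continuous in the graph norm; the proof makes the modulus of continuity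
    explicit. *)
Lemma rel_closure_coercive gamma k :
  (forall x y, A x y -> k * (a x x + b y y) <= gamma * a x x + b y y) ->
  forall x y, HO x y -> k * (a x x + b y y) <= gamma * a x x + b y y.
Proof.
move=> hk x y [Sx Sy xy]; rewrite -subr_ge0.
(* By [sip_norm_near], approximation within [d] moves each squared norm by at most the factor in
   parentheses times [d]; the weights collect their occurrences on both sides. *)
pose K := (`|gamma| + `|k|) * (2 * sip_norm a x + 1)
  + (1 + `|k|) * (2 * sip_norm b y + 1).
have K1 : 0 <= K.
  by rewrite /K addr_ge0// mulr_ge0// ?addr_ge0// ?mulr_ge0 ?sip_norm_ge0.
apply/ler_addgt0Pr => e e0.
have [d [d0 d1 dK]] : exists d, [/\ 0 < d, d <= 1 & K * d <= e].
  have K0 : 0 < K + 1 by rewrite ltr_wpDl.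
  exists (Num.min 1 (e / (K + 1))); split.
  - by rewrite lt_min ltr01 divr_gt0.
  - by rewrite ge_min lexx.
  - apply: (@le_trans _ _ (K * (e / (K + 1)))).
      by rewrite ler_wpM2l// ge_min lexx orbT.
    by rewrite mulrCA ler_piMr ?ltW// ltr_pdivrMr// mul1r ltrDl.
have [x1 [y1 [A1 h1 h2]]] := xy _ (exprn_gt0 2 d0); have [Sx1 Sy1] := subA A1.
have n1 := sip_norm_near ha d0 d1 Sx Sx1 h1.
have n2 := sip_norm_near hb d0 d1 Sy Sy1 h2.
have l1 := ler_pM (normr_ge0 gamma) (normr_ge0 _) (lexx `|gamma|) n1.
have l2 := ler_pM (normr_ge0 k) (normr_ge0 _) (lexx `|k|) n1.
have l3 := ler_pM (normr_ge0 k) (normr_ge0 _) (lexx `|k|) n2.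
rewrite -!normrM in l1 l2 l3.
have := hk _ _ A1; move: dK; rewrite /K; move: l1 l2 l3 n2.
rewrite !ler_norml => /andP[? ?] /andP[? ?] /andP[? ?] /andP[? ?]; nra.
Qed.

End adjoint_pair.

(** * Abstract ultraweak formulation *)

Section ultraweak.
Context {R : realType} {E F : lmodType R}.
Variables (SE : set E) (a : E -> E -> R) (SP : set F) (b : F -> F -> R).
Hypotheses (ha : semi_ip SE a) (hb : semi_ip SP b).
Hypotheses (cE : complete_ip SE a) (cF : complete_ip SP b).
Variable A : E -> F -> Prop.
Hypotheses (linA : lin_rel A) (subA : forall x y, A x y -> SE x /\ SP y).
Variables (GT : E -> F -> Prop) (CT : F -> E -> Prop).
Hypotheses (linGT : lin_rel GT) (subGT : forall x y, GT x y -> SE x /\ SP y).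
Hypotheses (linCT : lin_rel CT) (subCT : forall x y, CT x y -> SP x /\ SE y).
Hypotheses (clGT : closed_rel SE a SP b GT) (clCT : closed_rel SP b SE a CT).

Local Notation HO := (rel_closure SE a SP b A).
Local Notation CO := (rel_adjoint SE a SP b A).

Hypotheses (HO_GT : forall x y, HO x y -> GT x y).
Hypotheses (CO_CT : forall x y, CO x y -> CT x y).
Variables (gamma k : R).
Hypotheses (gamma0 : 0 <= gamma) (k0 : 0 < k).
Hypothesis coerA :
  forall x y, A x y -> k * (a x x + b y y) <= gamma * a x x + b y y.

Definition is_trace (v : E) (g : F) (uh : F -> R) :=
  forall Q c, CT Q c -> uh Q = b g Q - a v c.

Definition is_trace_star (Q : F) (c : E) (ph : E -> R) :=
  forall v g, GT v g -> ph v = b g Q - a v c.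

Definition trace0_rel (uh : F -> R) := exists v g, HO v g /\ is_trace v g uh.

Definition trace_star_rel (ph : E -> R) :=
  exists Q c, CO Q c /\ is_trace_star Q c ph.

(** The quotient norms of the traces stay abstract: besides nonnegativity, the argument needs that
    they are at most the norm of any representative in the closure or the adjoint, and that they
    control the action on broken test pairs. *)
Variables (nT : (F -> R) -> R) (nS : (E -> R) -> R).
Hypotheses (nT0 : forall uh, 0 <= nT uh) (nS0 : forall ph, 0 <= nS ph).
Hypothesis nT_le : forall v g uh, HO v g -> is_trace v g uh ->
  nT uh <= Num.sqrt (a v v + b g g).
Hypothesis nS_le : forall Q c ph, CO Q c -> is_trace_star Q c ph ->
  nS ph <= Num.sqrt (b Q Q + a c c).
Hypothesis nT_bound : forall uh Q c, trace0_rel uh -> CT Q c ->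
  `|uh Q| <= nT uh * Num.sqrt (b Q Q + a c c).
Hypothesis nS_bound : forall ph v g, trace_star_rel ph -> GT v g ->
  `|ph v| <= nS ph * Num.sqrt (a v v + b g g).

Local Notation trial := (E * F * (F -> R) * (E -> R))%type.
Local Notation dtest := ((E * F) * (F * E))%type.

Definition trial_set (w : trial) : Prop :=
  [/\ SE w.1.1.1, SP w.1.1.2, trace0_rel w.1.2 & trace_star_rel w.2].

Definition trial_norm (w : trial) : R :=
  Num.sqrt (a w.1.1.1 w.1.1.1 + b w.1.1.2 w.1.1.2 + nT w.1.2 ^+ 2 + nS w.2 ^+ 2).

(** Each test function comes with its broken derivative, so the test norm is a graph norm and
    linearity does not hinge on a choice of derivatives. *)
Definition test_set : set dtest :=
  graph_set (fun z z' => graph_set GT z /\ graph_set CT z').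

Definition test_ip : dtest -> dtest -> R :=
  graph_ip (graph_ip a b) (graph_ip b a).

Definition uw_form (w : trial) (t : dtest) : R :=
  a w.1.1.1 (gamma *: t.1.1 + t.2.2) + b w.1.1.2 (t.2.1 - t.1.2)
  + w.1.2 t.2.1 + w.2 t.1.1.

Let hG := semi_ip_graph ha hb linGT subGT.
Let hC := semi_ip_graph hb ha linCT subCT.

Lemma semi_ip_test : semi_ip test_set test_ip.
Proof.
apply: (semi_ip_graph hG hC) => //; split.
  by split; [exact: sip0 hG|exact: sip0 hC].
by move=> c x y x' y' [? ?] [? ?]; split; [exact: (sipL hG)|exact: (sipL hC)].
Qed.

Lemma complete_test : complete_ip test_set test_ip.
Proof.
apply: (complete_graph hG hC) => //.
- exact: (complete_graph ha hb).
- exact: (complete_graph hb ha).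
Qed.

Lemma test_norm_ge v g Q q : GT v g -> CT Q q -> let S := sip_norm test_ip (v, g, (Q, q)) in
  [/\ sip_norm a v <= S, sip_norm a q <= S, sip_norm b g <= S & sip_norm b Q <= S].
Proof.
move=> /subGT[Sv Sg] /subCT[SQ Sq].
have pv := sip_ge0 ha Sv; have pg := sip_ge0 hb Sg.
have pq := sip_ge0 ha Sq; have pQ := sip_ge0 hb SQ.
by split; rewrite ler_wsqrtr// /test_ip /graph_ip/=; lra.
Qed.

Lemma trace_lin : forall c uh uh', trace0_rel uh -> trace0_rel uh' ->
  trace0_rel (c *: uh + uh').
Proof.
move=> c uh uh' [v [g [vg e]]] [v' [g' [vg' e']]].
exists (c *: v + v'), (c *: g + g'); split.
  by have [_] := rel_closure_lin ha hb linA subA; exact.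
move=> Q q Qq; have [SQ Sq] := subCT Qq.
have [Sv Sg _] := vg; have [Sv' Sg' _] := vg'.
rewrite (sip_linear hb)// (sip_linear ha)//.
by transitivity (c * uh Q + uh' Q) => //; rewrite (e _ _ Qq) (e' _ _ Qq); ring.
Qed.

Lemma adjoint_lin : lin_rel CO.
Proof.
split.
  split; [exact: sip0 hb|exact: sip0 ha|] => x y /subA[Sx Sy].
  by rewrite (sipC hb) ?(sipC ha Sx) ?(sip0l hb) ?(sip0l ha)//;
    [exact: sip0 ha|exact: sip0 hb].
move=> c x y x' y' [Sx Sy xy] [Sx' Sy' xy']; split.
- exact: (sipL hb).
- exact: (sipL ha).
move=> p q Apq; have [Sp Sq] := subA Apq.
rewrite (sipDr hb)// ?(sipDr ha)//; try exact: (sipZ ha); try exact: (sipZ hb).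
by rewrite (sipZr hb)// (sipZr ha)// (xy _ _ Apq) (xy' _ _ Apq).
Qed.

Lemma trace_star_lin : forall c ph ph', trace_star_rel ph -> trace_star_rel ph' ->
  trace_star_rel (c *: ph + ph').
Proof.
move=> c ph ph' [v [g [vg e]]] [v' [g' [vg' e']]].
exists (c *: v + v'), (c *: g + g'); split.
  by have [_] := adjoint_lin; exact.
move=> Q q Qq; have [SQ Sq] := subGT Qq.
have [Sv Sg _] := vg; have [Sv' Sg' _] := vg'.
rewrite (sipDr hb)// ?(sipDr ha)//; try exact: (sipZ ha); try exact: (sipZ hb).
rewrite (sipZr hb)// (sipZr ha)//.
by transitivity (c * ph Q + ph' Q) => //; rewrite (e _ _ Qq) (e' _ _ Qq); ring.
Qed.

Lemma trial_set0 : trial_set 0.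
Proof.
split; [exact: sip0 ha|exact: sip0 hb| |].
  exists 0, 0; split; first by case: (rel_closure_lin ha hb linA subA).
  by move=> Q c /subCT[? ?]; rewrite (sip0l ha)// (sip0l hb)// subrr.
exists 0, 0; split; first by case: adjoint_lin.
move=> v g /subGT[Sv Sg]; rewrite (sipC ha Sv (sip0 ha)) (sipC hb Sg (sip0 hb)).
by rewrite (sip0l ha)// (sip0l hb)// subrr.
Qed.

Lemma trial_setL c w w' : trial_set w -> trial_set w' -> trial_set (c *: w + w').
Proof.
move: w w' => [[[u P] uh] ph] [[[u' P'] uh'] ph'] [/= ? ? ? ?] [/= ? ? ? ?]; split.
- exact: (sipL ha).
- exact: (sipL hb).
- by apply: trace_lin.
- exact: trace_star_lin.
Qed.

Lemma uw_form_trial_lin c w w' t : trial_set w -> trial_set w' -> test_set t ->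
  uw_form (c *: w + w') t = c * uw_form w t + uw_form w' t.
Proof.
move: w w' t => [[[u P] uh] ph] [[[u' P'] uh'] ph'] [[v g] [Q q]].
move=> [/= Su SPP _ _] [/= Su' SPP' _ _] [/= /subGT[/= Sv Sg] /subCT[/= SQ Sq]].
have S1 : SE (gamma *: v + q) by exact: (sipL ha).
have S2 : SP (Q - g) by exact: (sipB hb).
rewrite /uw_form/= (sip_linear ha)// (sip_linear hb)//.
rewrite [(c *: uh + uh') Q](_ : _ = c * uh Q + uh' Q)//.
rewrite [(c *: ph + ph') v](_ : _ = c * ph v + ph' v)//.
ring.
Qed.

Lemma trace_test_lin c uh Q q Q' q' : trace0_rel uh -> CT Q q -> CT Q' q' ->
  uh (c *: Q + Q') = c * uh Q + uh Q'.
Proof.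
move=> [v [g [[Sv Sg _] e]]] C1 C2.
have [S1 S2] := subCT C1; have [S3 S4] := subCT C2.
rewrite (e _ _ C1) (e _ _ C2) (e (c *: Q + Q') (c *: q + q')); last by case: linCT => _; exact.
rewrite (sipDr hb)// ?(sipDr ha)//; try exact: (sipZ ha); try exact: (sipZ hb).
by rewrite (sipZr hb)// (sipZr ha)//; ring.
Qed.

Lemma trace_star_test_lin c ph v g v' g' : trace_star_rel ph -> GT v g -> GT v' g' ->
  ph (c *: v + v') = c * ph v + ph v'.
Proof.
move=> [Q [q [[SQ Sq _] e]]] C1 C2.
have [S1 S2] := subGT C1; have [S3 S4] := subGT C2.
rewrite (e _ _ C1) (e _ _ C2) (e (c *: v + v') (c *: g + g')); last by case: linGT => _; exact.
by rewrite (sip_linear hb)// (sip_linear ha)//; ring.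
Qed.

Lemma uw_form_test_lin w c t t' : trial_set w -> test_set t -> test_set t' ->
  uw_form w (c *: t + t') = c * uw_form w t + uw_form w t'.
Proof.
move: w t t' => [[[u P] uh] ph] [[v g] [Q q]] [[v' g'] [Q' q']].
move=> [/= Su SPP T1 T2] [/= G1 C1] [/= G2 C2].
rewrite /graph_set/= in G1 C1 G2 C2.
have [/= Sv Sg] := subGT G1; have [/= SQ Sq] := subCT C1.
have [/= Sv' Sg'] := subGT G2; have [/= SQ' Sq'] := subCT C2.
rewrite /uw_form/= (trace_test_lin c T1 C1 C2) (trace_star_test_lin c T2 G1 G2).
have -> : gamma *: (c *: v + v') + (c *: q + q') =
          c *: (gamma *: v + q) + (gamma *: v' + q').
  by rewrite !scalerDr !scalerA [c * gamma]mulrC addrACA.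
have -> : c *: Q + Q' - (c *: g + g') = c *: (Q - g) + (Q' - g').
  by rewrite opprD addrACA scalerBr.
have S1 : SE (gamma *: v + q) by exact: (sipL ha).
have S2 : SP (Q - g) by exact: (sipB hb).
have S3 : SE (gamma *: v' + q') by exact: (sipL ha).
have S4 : SP (Q' - g') by exact: (sipB hb).
rewrite (sipDr ha (sipZ ha c S1) S3 Su) (sipDr hb (sipZ hb c S2) S4 SPP).
by rewrite (sipZr hb)// (sipZr ha)//; ring.
Qed.

(** The form is a sum of six pairings, each at most the product of the two norms, one of them
    weighted by [gamma]; hence [gamma + 5]. *)
Lemma uw_form_bounded w t : trial_set w -> test_set t ->
  `|uw_form w t| <= (gamma + 5) * trial_norm w * sip_norm test_ip t.
Proof.
move: w t => [[[u P] uh] ph] [[v g] [Q q]].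
move=> [/= Su SPP T1 T2] [/= G1 C1].
rewrite /graph_set/= in G1 C1.
have [/= Sv Sg] := subGT G1; have [/= SQ Sq] := subCT C1.
have /= nh := nT_bound T1 C1; have /= mh := nS_bound T2 G1.
rewrite /uw_form/= (sipDr ha)// ?(sipZr ha)//; last exact: (sipZ ha).
rewrite (sipBr hb)//.
set U := trial_norm _; set S := sip_norm _ _.
have U0 : 0 <= U by exact: sqrtr_ge0.
have S0 : 0 <= S by exact: sqrtr_ge0.
have pu := sip_ge0 ha Su; have pP := sip_ge0 hb SPP.
have pv := sip_ge0 ha Sv; have pg := sip_ge0 hb Sg.
have pq := sip_ge0 ha Sq; have pQ := sip_ge0 hb SQ.
have p1 := sqr_ge0 (nT uh); have p2 := sqr_ge0 (nS ph).
have Su_U : sip_norm a u <= U by rewrite ler_wsqrtr//=; lra.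
have SP_U : sip_norm b P <= U by rewrite ler_wsqrtr//=; lra.
have nT_U : nT uh <= U.
  by rewrite -(ger0_norm (nT0 uh)) -sqrtr_sqr ler_wsqrtr//=; lra.
have nS_U : nS ph <= U.
  by rewrite -(ger0_norm (nS0 ph)) -sqrtr_sqr ler_wsqrtr//=; lra.
have := test_norm_ge G1 C1; rewrite /= -/S => -[Sv_S Sq_S Sg_S SQ_S].
have G_S : Num.sqrt (a v v + b g g) <= S by rewrite ler_wsqrtr// /test_ip /graph_ip/=; lra.
have C_S : Num.sqrt (b Q Q + a q q) <= S by rewrite ler_wsqrtr// /test_ip /graph_ip/=; lra.
have B x y x' y' (z : R) : 0 <= x -> 0 <= y -> x <= x' -> y <= y' -> `|z| <= x * y -> `|z| <= x' * y'.
  by move=> x0 y0 xx yy /le_trans; apply; exact: ler_pM.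
have b1 := B _ _ _ _ _ (sip_norm_ge0 _ _) (sip_norm_ge0 _ _) Su_U Sv_S (sip_cs ha Su Sv).
have b2 := B _ _ _ _ _ (sip_norm_ge0 _ _) (sip_norm_ge0 _ _) Su_U Sq_S (sip_cs ha Su Sq).
have b3 := B _ _ _ _ _ (sip_norm_ge0 _ _) (sip_norm_ge0 _ _) SP_U SQ_S (sip_cs hb SPP SQ).
have b4 := B _ _ _ _ _ (sip_norm_ge0 _ _) (sip_norm_ge0 _ _) SP_U Sg_S (sip_cs hb SPP Sg).
have b5 := B _ _ _ _ _ (nT0 uh) (sqrtr_ge0 _) nT_U C_S nh.
have b6 := B _ _ _ _ _ (nS0 ph) (sqrtr_ge0 _) nS_U G_S mh.
have b7 := ler_wpM2l gamma0 b1.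
rewrite -{1}(ger0_norm gamma0) -normrM in b7.
rewrite -mulrA; move: (U * S) b7 b2 b3 b4 b5 b6 => M.
rewrite !ler_norml => /andP[? ?] /andP[? ?] /andP[? ?] /andP[? ?] /andP[? ?] /andP[? ?].
apply/andP; split; lra.
Qed.

Lemma uw_form_riesz w : trial_set w -> exists2 t, test_set t &
  forall t', test_set t' -> test_ip t t' = uw_form w t'.
Proof.
move=> Sw; apply: (@riesz _ _ _ _ semi_ip_test _ (((gamma + 5) * trial_norm w) ^+ 2)).
- exact: complete_test.
- by move=> c x y Sx Sy; exact: uw_form_test_lin.
move=> x Sx; rewrite -(sip_norm_sqr semi_ip_test Sx) -exprMn -[leLHS]real_normK ?num_real//.
by rewrite lerXn2r ?nnegrE// ?uw_form_bounded// !mulr_ge0 ?sqrtr_ge0// addr_ge0.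
Qed.

(** Here [m] bounds the global representative of the first trace, [m + 1] both fields, and the inner
    bracket the second trace; it is the largest of these. The factor 2 is the square root of the
    number of components. *)
Definition uw_const : R :=
  let m := (3 + gamma) / k in 2 * (m + 3 + gamma * (m + 1)).

Lemma uw_const_gt0 : 0 < uw_const.
Proof.
have m0 : 0 < (3 + gamma) / k by rewrite divr_gt0// ltr_wpDr.
rewrite /uw_const mulr_gt0// ltr_wpDr//; last by rewrite addr_gt0.
by rewrite mulr_ge0// addr_ge0// ltW.
Qed.

(* If (v, g, Q, q) is the Riesz representative of b(w, .), then the equations
   themselves exhibit (u - q, Q - P) and (P + g, gamma u - v) as global
   representatives of the two traces; testing one against the other gives the
   energy identity. *)
Lemma uw_form_infsup w t : trial_set w -> test_set t ->
  (forall t', test_set t' -> test_ip t t' = uw_form w t') ->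
  trial_norm w <= uw_const * sip_norm test_ip t.
Proof.
move: w t => [[[u P] uh] ph] [[v g] [Q q]].
move=> [/= Su SPP [v0 [g0 [HO0 tr0]]] [Q0 [q0 [CO0 ts0]]]] [/= G1 C1] rep.
rewrite /graph_set/= in G1 C1.
have [/= Sv Sg] := subGT G1; have [/= SQ Sq] := subCT C1.
have [_ linCO] := adjoint_lin.
have [HO00 linHO] := rel_closure_lin ha hb linA subA.
have [GT0 _] := linGT; have [CT0 _] := linCT.
have S0 := sip0 ha; have S0' := sip0 hb.
have a0r x : SE x -> a x 0 = 0 by move=> Sx; rewrite (sipC ha)// (sip0l ha).
have b0r x : SP x -> b x 0 = 0 by move=> Sx; rewrite (sipC hb)// (sip0l hb).
have ph0 : ph 0 = 0 by rewrite (ts0 _ _ GT0) (sip0l ha) ?(sip0l hb)// ?subrr; case: CO0.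
have uh0 : uh 0 = 0 by rewrite (tr0 _ _ CT0) a0r ?b0r// ?subrr; case: HO0.
(* Testing with [(0, 0)] in the first or in the second slot separates the two equations. *)
have repC Q' c' : CT Q' c' -> b Q Q' + a q c' = a u c' + b P Q' + uh Q'.
  move=> C'; have [SQ' Sc'] := subCT C'.
  have := rep ((0, 0), (Q', c')) (conj GT0 C').
  rewrite /test_ip /graph_ip/= /uw_form/= a0r// b0r// ph0 scaler0 !add0r subr0; lra.
have repG v' g' : GT v' g' -> a v v' + b g g' = gamma * a u v' - b P g' + ph v'.
  move=> G'; have [Sv' Sg'] := subGT G'.
  have := rep ((v', g'), (0, 0)) (conj G' CT0).
  rewrite /test_ip /graph_ip/= /uw_form/= a0r// b0r// uh0 !addr0 sub0r.
  rewrite (sipZr ha)// (sipNr hb)//; lra.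
pose vt := u - q; pose gt := Q - P; pose Qt := P + g; pose ct := gamma *: u - v.
have Svt : SE vt by exact: (sipB ha). have Sgt : SP gt by exact: (sipB hb).
have SQt : SP Qt by exact: (sipD hb).
have Sct : SE ct by apply: (sipB ha) => //; exact: (sipZ ha).
have trt : is_trace vt gt uh.
  move=> Q' c' C'; have [SQ' Sc'] := subCT C'; have := repC _ _ C'.
  by rewrite /vt /gt (sipBl ha)// (sipBl hb)//; lra.
have tst : is_trace_star Qt ct ph.
  move=> v' g' G'; have [Sv' Sg'] := subGT G'; have := repG _ _ G'.
  rewrite /Qt /ct (sipDr hb)// (sipBr ha)//; last exact: (sipZ ha).
  rewrite (sipZr ha)// (sipC ha Sv' Su) (sipC ha Sv' Sv) (sipC hb Sg' SPP) (sipC hb Sg' Sg).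
  lra.
(* The pair has the same trace as a genuine element of the closure, so by [green] it satisfies the
   adjoint identity against every adjoint pair, and [rel_closure_biadjoint] applies. *)
have HOt : HO vt gt.
  apply: (rel_closure_biadjoint ha hb cE cF) => // Q' c' CO'.
  have := trt _ _ (CO_CT CO'); rewrite (tr0 _ _ (CO_CT CO')).
  by rewrite (green ha hb subA HO0 CO') subrr => /esym/eqP; rewrite subr_eq0 => /eqP.
have COt : CO Qt ct.
  split => // v' g' A'; have HO' := sub_rel_closure ha hb subA A'.
  have := tst _ _ (HO_GT HO'); rewrite (ts0 _ _ (HO_GT HO')).
  by rewrite (green ha hb subA HO' CO0) subrr => /esym/eqP; rewrite subr_eq0 => /eqP.
set S := sip_norm _ _.
have := test_norm_ge G1 C1; rewrite /= -/S => -[Sv_S Sq_S Sg_S SQ_S].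
have S_ge0 : 0 <= S by exact: sqrtr_ge0.
pose n := Num.sqrt (a vt vt + b gt gt).
have n0 : 0 <= n by exact: sqrtr_ge0.
have pvt := sip_ge0 ha Svt; have pgt := sip_ge0 hb Sgt.
have n2 : n ^+ 2 = a vt vt + b gt gt by rewrite sqr_sqrtr// addr_ge0.
have vt_n : sip_norm a vt <= n by rewrite ler_wsqrtr//; lra.
have gt_n : sip_norm b gt <= n by rewrite ler_wsqrtr//; lra.
(* [green] for the two exhibited pairs, after [Qt] and [ct] are rewritten so that [gt] and
   [gamma *: vt] appear; the other terms involve only the representative. *)
have energy : gamma * a vt vt + b gt gt = b gt Q + b gt g - gamma * a vt q + a vt v.
  have := green ha hb subA HOt COt.
  have eQt : Qt = (Q + g) - gt by rewrite /gt opprB addrC addrA subrK.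
  have ect : ct = (gamma *: vt + gamma *: q) - v by rewrite /ct /vt scalerBr subrK.
  rewrite eQt ect; clearbody vt gt.
  rewrite (sipBr hb)// ?(sipDr hb)// ?(sipBr ha)// ?(sipDr ha)// ?(sipZr ha)//;
    try exact: (sipZ ha); try exact: (sipD hb).
    lra.
  by apply: (sipD ha); exact: (sipZ ha).
have B x y y' (z : R) : 0 <= x -> 0 <= y -> x <= n -> y <= y' -> `|z| <= x * y -> `|z| <= n * y'.
  by move=> x0 y0 xx yy /le_trans; apply; exact: ler_pM.
have e1 := B _ _ _ _ (sip_norm_ge0 _ _) (sip_norm_ge0 _ _) gt_n SQ_S (sip_cs hb Sgt SQ).
have e2 := B _ _ _ _ (sip_norm_ge0 _ _) (sip_norm_ge0 _ _) gt_n Sg_S (sip_cs hb Sgt Sg).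
have e3 := B _ _ _ _ (sip_norm_ge0 _ _) (sip_norm_ge0 _ _) vt_n Sq_S (sip_cs ha Svt Sq).
have e4 := B _ _ _ _ (sip_norm_ge0 _ _) (sip_norm_ge0 _ _) vt_n Sv_S (sip_cs ha Svt Sv).
have coer := rel_closure_coercive ha hb subA coerA HOt.
pose m := (3 + gamma) / k.
have m0 : 0 <= m by rewrite divr_ge0 ?addr_ge0// ltW.
(* Each of the four products in [energy] is at most [n * S], one of them weighted by [gamma];
   coercivity bounds the left side below by [k * n ^+ 2], and one [n] cancels. *)
have nm : n <= m * S.
  have : k * n ^+ 2 <= (3 + gamma) * (n * S).
    rewrite n2; apply: le_trans coer _; rewrite energy.
    have e5 := ler_wpM2l gamma0 e3.
    rewrite -{1}(ger0_norm gamma0) -normrM in e5.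
    move: e1 e2 e4 e5; rewrite !ler_norml.
    move=> /andP[? ?] /andP[? ?] /andP[? ?] /andP[? ?]; lra.
  have [->|n_neq0] := eqVneq n 0; first by rewrite mulr_ge0.
  have np : 0 < n by rewrite lt_def n_neq0.
  have -> : k * n ^+ 2 = n * (k * n) by ring.
  have -> : (3 + gamma) * (n * S) = n * ((3 + gamma) * S) by ring.
  rewrite ler_pM2l// => h.
  by rewrite /m mulrAC ler_pdivlMr// mulrC.
have nu : sip_norm a u <= (m + 1) * S.
  have -> : u = vt + q by rewrite /vt subrK.
  apply: le_trans (sip_normD ha Svt Sq) _; lra.
have nP : sip_norm b P <= (m + 1) * S.
  have -> : P = Q - gt by rewrite /gt opprB addrCA subrr addr0.
  apply: le_trans (sip_normD hb SQ (sipN hb Sgt)) _.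
  by rewrite (sip_normN hb)//; lra.
have nTh : nT uh <= m * S by apply: le_trans nm; exact: nT_le.
have nSh : nS ph <= (m + 3 + gamma * (m + 1)) * S.
  apply: le_trans (nS_le COt tst) _.
  have nQt : sip_norm b Qt <= (m + 2) * S.
    apply: le_trans (sip_normD hb SPP Sg) _; lra.
  have nct : sip_norm a ct <= (gamma * (m + 1) + 1) * S.
    apply: le_trans (sip_normD ha (sipZ ha gamma Su) (sipN ha Sv)) _.
    rewrite (sip_normN ha)//.
    have -> : sip_norm a (gamma *: u) = gamma * sip_norm a u.
      rewrite /sip_norm (sipZl ha) ?(sipZr ha)//; last exact: (sipZ ha).
      by rewrite mulrA -expr2 sqrtrM ?sqr_ge0// sqrtr_sqr ger0_norm.
    have := ler_wpM2l gamma0 nu; lra.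
  have h := lerD nQt nct.
  apply: (@le_trans _ _ (sip_norm b Qt + sip_norm a ct)); last by lra.
  rewrite -[leRHS]ger0_norm ?addr_ge0 ?sip_norm_ge0// -sqrtr_sqr ler_wsqrtr//.
  rewrite sqrrD (sip_norm_sqr hb)// (sip_norm_sqr ha)//.
  have := mulr_ge0 (sip_norm_ge0 b Qt) (sip_norm_ge0 a ct); lra.
pose K := m + 3 + gamma * (m + 1).
have gm : 0 <= gamma * (m + 1) by rewrite mulr_ge0// addr_ge0.
have KS : (m + 3) * S <= K * S by rewrite ler_wpM2r// /K lerDl.
have Kp : 0 <= K by rewrite /K; lra.
have K0 : 0 <= K * S by rewrite mulr_ge0.
have Sm : 0 <= m * S by rewrite mulr_ge0.
rewrite /trial_norm/= /uw_const -/m -/K -mulrA -[leRHS]ger0_norm ?mulr_ge0//.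
rewrite -sqrtr_sqr ler_wsqrtr//.
rewrite -(sip_norm_sqr ha Su) -(sip_norm_sqr hb SPP).
have sq x : 0 <= x -> x <= K * S -> x ^+ 2 <= (K * S) ^+ 2.
  by move=> x0 xx; rewrite lerXn2r ?nnegrE.
have m1K : (m + 1) * S <= K * S by apply: le_trans KS; rewrite ler_wpM2r// lerD2l ler1n.
have mK : m * S <= K * S by apply: le_trans m1K; rewrite ler_wpM2r// lerDl.
have q1 := sq _ (sip_norm_ge0 a u) (le_trans nu m1K).
have q2 := sq _ (sip_norm_ge0 b P) (le_trans nP m1K).
have q3 := sq _ (nT0 uh) (le_trans nTh mK).
have q4 := sq _ (nS0 ph) nSh.
rewrite exprMn; move: q1 q2 q3 q4; move: (_ ^+ 2) (_ ^+ 2) (_ ^+ 2) (_ ^+ 2) (_ ^+ 2) => *; lra.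
Qed.

(** The energy form is equivalent to the graph form on the closure, hence complete, and represents
    [f]. The traces are left as parameters because any functionals with the prescribed values on
    broken pairs will do. *)
Lemma uw_solution f : SE f -> exists v g, [/\ HO v g, CO (- g) (gamma *: v - f) &
  forall uh ph, is_trace v g uh -> is_trace_star (- g) (gamma *: v - f) ph ->
  trial_set (v, - g, uh, ph) /\
  forall t, test_set t -> uw_form (v, - g, uh, ph) t = a f t.1.1].
Proof.
move=> Sf; have hH := semi_ip_graph ha hb (rel_closure_lin ha hb linA subA) (@rel_closure_sub _ _ _ SE a SP b A).
have cH := complete_graph ha hb (@rel_closure_sub _ _ _ SE a SP b A) cE cF (rel_closure_closed ha hb subA).
pose en (z z' : E * F) := gamma * a z.1 z'.1 + b z.2 z'.2.
have coer := rel_closure_coercive ha hb subA coerA.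
have enle x : graph_set HO x -> k * graph_ip a b x x <= en x x.
  exact: coer.
have hen : semi_ip (graph_set HO) en.
  split.
  - exact: sip0 hH.
  - exact: (sipL hH).
  - by move=> [x y] [x' y'] [/= ? ? _] [/= ? ? _]; rewrite /en/= (sipC ha)// (sipC hb).
  - move=> c [x y] [x' y'] [x'' y''] [/= ? ? _] [/= ? ? _] [/= ? ? _].
    by rewrite /en/= (sip_linear ha)// (sip_linear hb)//; ring.
  - move=> x Sx; apply: le_trans (enle x Sx).
    by apply: mulr_ge0; [exact: ltW|exact: (sip_ge0 hH)].
have cen : complete_ip (graph_set HO) en.
  apply: (@complete_ip_equiv _ _ _ (graph_ip a b) en k (gamma + 1)) => //.
    by rewrite ltr_wpDl.
  move=> [x y] [/= Sx Sy _]; rewrite /en /graph_ip/=.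
  have := sip_ge0 ha Sx; have := mulr_ge0 gamma0 (sip_ge0 hb Sy); lra.
have [||[v g] /= HOvg rep] := @riesz _ _ _ _ hen (fun z => a f z.1) (a f f / k) cen.
- move=> c [x y] [x' y'] [/= ? ? _] [/= ? ? _].
  by rewrite (sipDr ha)// ?(sipZr ha)//; exact: (sipZ ha).
- move=> [x y] HOxy; have [/= Sx Sy _] := HOxy.
  apply: le_trans (cauchy_schwarz ha Sf Sx) _; rewrite -mulrA ler_wpM2l ?(sip_ge0 ha)//.
  rewrite mulrC ler_pdivlMr// mulrC; apply: le_trans (enle (x, y) HOxy).
  by apply: ler_wpM2l; [exact: ltW|rewrite /graph_ip/= lerDl (sip_ge0 hb)].
have [Sv Sg _] := HOvg.
have Sc : SE (gamma *: v - f) by apply: (sipB ha) => //; exact: (sipZ ha).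
(* The variational equation restricted to [A] is exactly membership in the adjoint; this is where
   the second-order equation comes from. *)
have COP : CO (- g) (gamma *: v - f).
  split => //; first exact: (sipN hb).
  move=> x y Axy; have [Sx Sy] := subA Axy.
  have := rep (x, y) (sub_rel_closure ha hb subA Axy); rewrite /en/= => e.
  rewrite (sipNr hb)// (sipBr ha)//; last exact: (sipZ ha).
  by rewrite (sipZr ha)// (sipC ha Sx Sv) (sipC ha Sx Sf) (sipC hb Sy Sg); lra.
exists v, g; split => // uh ph tuh tph; split.
  split => //=; first exact: (sipN hb).
    by exists v, g.
  by exists (- g), (gamma *: v - f).
move=> [[v' g'] [Q' c']] [/= G1 C1]; rewrite /graph_set/= in G1 C1.
have [Sv' Sg'] := subGT G1; have [SQ' Sc'] := subCT C1.
rewrite /uw_form/= (tuh _ _ C1) (tph _ _ G1).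
rewrite (sipDr ha)// ?(sipZr ha)//; last exact: (sipZ ha).
rewrite (sipNl hb)// ?(sipBr hb)//; last exact: (sipB hb).
rewrite (sipNr hb)// (sipBr ha)//; last exact: (sipZ ha).
rewrite (sipZr ha)// (sipC ha Sv' Sv) (sipC ha Sv' Sf) (sipC hb Sg' Sg).
ring.
Qed.

End ultraweak.

Section linear_on.
Context {R : realType} {E : lmodType R}.
Variables (S : set E) (L : E -> R).
Hypotheses (S0 : S 0) (SL : forall k x y, S x -> S y -> S (k *: x + y)).

Lemma sum_on (I : Type) (s : seq I) (c : I -> R) (x : I -> E) :
  (forall i, S (x i)) -> S (\sum_(i <- s) c i *: x i).
Proof.
by move=> Sx; elim: s => [|i s IH]; rewrite ?big_nil// big_cons; exact: SL.
Qed.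

Hypothesis linL : forall k x y, S x -> S y -> L (k *: x + y) = k * L x + L y.

Lemma linear_on_sum (I : Type) (s : seq I) (c : I -> R) (x : I -> E) :
  (forall i, S (x i)) -> L (\sum_(i <- s) c i *: x i) = \sum_(i <- s) c i * L (x i).
Proof.
move=> Sx; elim: s => [|i s IH].
  have := linL 1 S0 S0; rewrite scale1r addr0 mul1r !big_nil => h.
  by apply: (@addrI _ (L 0)); rewrite -h addr0.
by rewrite !big_cons linL ?IH//; exact: sum_on.
Qed.

Lemma linear_onB x y : S x -> S y -> L (x - y) = L x - L y.
Proof. by move=> Sx Sy; rewrite -scaleN1r addrC linL// mulN1r addrC. Qed.

End linear_on.

(** * Petrov-Galerkin approximation *)

Section petrov_galerkin.
Context {R : realType} {W V : lmodType R}.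
Variables (SU : set W) (SV : set V) (ipv : V -> V -> R) (B : W -> V -> R).
Variables (nU : W -> R) (C K : R).
Hypotheses (SU0 : SU 0) (SUL : forall c w w', SU w -> SU w' -> SU (c *: w + w')).
Hypothesis hV : semi_ip SV ipv.
Hypotheses (C0 : 0 <= C) (K0 : 0 <= K) (nU0 : forall w, 0 <= nU w).
Hypothesis Blin : forall c w w' t, SU w -> SU w' -> SV t ->
  B (c *: w + w') t = c * B w t + B w' t.
Hypothesis infsup : forall w t, SU w -> SV t ->
  (forall t', SV t' -> ipv t t' = B w t') -> nU w <= C * sip_norm ipv t.
Hypothesis bounded : forall w t, SU w -> SV t ->
  `|B w t| <= K * nU w * sip_norm ipv t.

(** The zero vector represents the form of [w - w'], so the inf-sup bound is zero. *)
Lemma form_eq_null w w' : SU w -> SU w' -> (forall t, SV t -> B w t = B w' t) ->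
  nU (w - w') = 0.
Proof.
move=> Sw Sw' ww'; apply/eqP; rewrite eq_le nU0 andbT.
have SD : SU (w - w') by rewrite -scaleN1r addrC; exact: SUL.
have := infsup SD (sip0 hV); rewrite /sip_norm (sip0l hV (sip0 hV)) sqrtr0 mulr0; apply.
move=> t St; rewrite (sip0l hV)// -scaleN1r addrC Blin// ww'// mulN1r.
by rewrite addNr.
Qed.

Variables (n : nat) (e : 'I_n -> W).
Hypothesis Se : forall i, SU (e i).
Variable T : W -> V.
Hypothesis TP : forall w, SU w -> SV (T w) /\ forall t', SV t' -> ipv (T w) t' = B w t'.

Let Uh : set W := [set w | exists c : 'I_n -> R, w = \sum_i c i *: e i].

Lemma span_sub w : Uh w -> SU w.
Proof. by move=> [c ->]; exact: sum_on. Qed.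

Lemma spanB w w' : Uh w -> Uh w' -> Uh (w - w').
Proof.
move=> [c ->] [c' ->]; exists (fun i => c i - c' i); rewrite -sumrB.
by apply: eq_bigr => i _; rewrite scalerBl.
Qed.

Lemma BB w w' t : SU w -> SU w' -> SV t -> B (w - w') t = B w t - B w' t.
Proof.
by move=> Sw Sw' St; rewrite (@linear_onB _ _ SU (B ^~ t))// => *; exact: Blin.
Qed.

Lemma SUB w w' : SU w -> SU w' -> SU (w - w').
Proof. by move=> Sw Sw'; rewrite -scaleN1r addrC; exact: SUL. Qed.

Lemma form_test_norm w : SU w -> B w (T w) = ipv (T w) (T w).
Proof. by move=> /TP[ST /(_ _ ST)]. Qed.

(** The difference lies in the span, so its own image under [T] is an admissible test vector, and
    there the form equals the squared norm that bounds [nU (w - w')]. *)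
Lemma galerkin_null w w' : Uh w -> Uh w' ->
  (forall z, Uh z -> B w (T z) = B w' (T z)) -> nU (w - w') = 0.
Proof.
move=> Uw Uw' ww'; apply/eqP; rewrite eq_le nU0 andbT.
have UD := spanB Uw Uw'; have SD := span_sub UD; have [ST TT] := TP SD.
apply: le_trans (infsup SD ST TT) _.
rewrite /sip_norm -form_test_norm// BB//; [|exact: span_sub|exact: span_sub].
by rewrite ww'// subrr sqrtr0 mulr0.
Qed.

(** The norm of [T (w - wh)] is the residual norm, which the discrete solution minimizes over the
    span; the factors [C] and [K] convert between it and [nU]. *)
Lemma galerkin_quasi_optimal w wh : SU w -> Uh wh ->
  (forall z, Uh z -> B wh (T z) = B w (T z)) ->
  forall z, Uh z -> nU (w - wh) <= C * K * nU (w - z).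
Proof.
move=> Sw Uwh orth z Uz.
have Swh := span_sub Uwh; have Sz := span_sub Uz.
have SD := SUB Sw Swh; have [ST TT] := TP SD.
have SD' := SUB Sw Sz; have [ST' TT'] := TP SD'.
have UD := spanB Uz Uwh; have SD2 := span_sub UD; have [ST2 TT2] := TP SD2.
rewrite -mulrA; apply: le_trans (infsup SD ST TT) _; apply: ler_wpM2l => //.
set N := sip_norm ipv _.
have N0 : 0 <= N by exact: sip_norm_ge0.
suff : N * N <= K * nU (w - z) * N.
  have [->|N1] := eqVneq N 0; first by rewrite !mulr_ge0.
  by rewrite ler_pM2r// lt_def N1.
rewrite -expr2 (sip_norm_sqr hV)//.
(* The difference is [B (z - wh) (T (w - wh))], which by symmetry of [ipv] equals
   [B (w - wh) (T (z - wh))], zero by orthogonality. *)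
have -> : ipv (T (w - wh)) (T (w - wh)) = ipv (T (w - z)) (T (w - wh)).
  rewrite TT// TT'//; apply/eqP; rewrite -subr_eq0 -(BB SD SD' ST) opprB.
  rewrite addrC addrA subrK -TT2// (sipC hV)// TT// BB// orth//.
  by rewrite subrr.
rewrite TT'//; apply: le_trans (ler_norm _) _; exact: bounded.
Qed.

Variables (l : V -> R) (M : R).
Hypothesis llin : forall c x y, SV x -> SV y -> l (c *: x + y) = c * l x + l y.
Hypothesis lbnd : forall t, SV t -> `|l t| <= M * sip_norm ipv t.

Lemma load_null t : SV t -> ipv t t = 0 -> l t = 0.
Proof.
move=> St t0; have := lbnd St; rewrite /sip_norm t0 sqrtr0 mulr0 => h.
by apply/eqP; rewrite -normr_eq0 eq_le h normr_ge0.
Qed.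

(** [T] is only a choice of representatives and is linear up to vectors of norm zero, on which the
    bounded functional [l] vanishes. *)
Lemma load_span (y : 'I_n -> R) :
  l (T (\sum_i y i *: e i)) = \sum_i y i * l (T (e i)).
Proof.
have Ste i : SV (T (e i)) by have [] := TP (Se i).
have Sz : SU (\sum_i y i *: e i) by exact: sum_on.
have [ST TT] := TP Sz.
have SS : SV (\sum_i y i *: T (e i)).
  by apply: sum_on => //; [exact: sip0 hV|exact: (sipL hV)].
rewrite -(linear_on_sum (sip0 hV) (sipL hV) llin)//.
apply/eqP; rewrite -subr_eq0; apply/eqP.
rewrite -(linear_onB llin)//.
have SD := sipB hV ST SS.
apply: load_null => //; rewrite [LHS](sipBl hV)//.
rewrite TT// (linear_on_sum SU0 SUL (L := B ^~ _))//; last first.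
  by move=> *; exact: Blin.
rewrite (linear_on_sum (sip0 hV) (sipL hV) (L := ipv ^~ _))//; last first.
  by move=> *; exact: (sip_linear hV).
by rewrite -sumrB big1// => i _; have [_ ->] := TP (Se i); rewrite ?subrr.
Qed.

(* A vector annihilated by the Gram matrix of the T (e i) yields a null test
   vector, on which the load vanishes: the normal equations are consistent. *)
Lemma galerkin_exists : exists2 w, Uh w & forall z, Uh z -> B w (T z) = l (T z).
Proof.
have Ste i : SV (T (e i)) by have [] := TP (Se i).
pose G : 'M[R]_n := \matrix_(i, j) B (e i) (T (e j)).
pose r : 'rV[R]_n := \row_j l (T (e j)).
have SS y : SV (\sum_i y i *: T (e i)).
  by apply: sum_on => //; [exact: sip0 hV|exact: (sipL hV)].
have : (r <= G)%MS.
  (* Membership in the row space means annihilating the cokernel, whose column [k] supplies the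
     coefficients of the null vector. *)
  rewrite submxE; apply/eqP/rowP => k; rewrite !mxE.
  pose y i := cokermx G i k.
  transitivity (l (\sum_i y i *: T (e i))).
    rewrite (linear_on_sum (sip0 hV) (sipL hV) llin)//.
    by apply: eq_bigr => i _; rewrite mxE mulrC.
  apply: load_null => //.
  rewrite (linear_on_sum (sip0 hV) (sipL hV) (L := ipv ^~ _))//; last first.
    by move=> *; exact: (sip_linear hV).
  apply: big1 => i _; rewrite (sipC hV)//.
  rewrite (linear_on_sum (sip0 hV) (sipL hV) (L := ipv ^~ _))//; last first.
    by move=> *; exact: (sip_linear hV).
  have := congr1 (fun X : 'M[R]_n => X i k) (mulmx_coker G); rewrite !mxE => h.
  rewrite (_ : \sum_(j <- _) _ = 0) ?mulr0// -[RHS]h; apply: eq_bigr => j _.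
  have [_ h2] := TP (Se i).
  by rewrite mxE mulrC (sipC hV)// h2.
move=> /submxP[c rc].
exists (\sum_i c 0 i *: e i); first by exists (c 0).
move=> z [y ->]; rewrite load_span.
have Sw : SU (\sum_i c 0 i *: e i) by exact: sum_on.
have Sz : SU (\sum_i y i *: e i) by exact: sum_on.
have [STw TTw] := TP Sw; have [STz TTz] := TP Sz.
rewrite -TTw// (sipC hV)// TTz//.
rewrite (linear_on_sum SU0 SUL (L := B ^~ _))//; last by move=> *; exact: Blin.
apply: eq_bigr => j _; congr (_ * _).
have [_ h2] := TP (Se j); rewrite -h2// (sipC hV)// TTw//.
rewrite (linear_on_sum SU0 SUL (L := B ^~ _))//; last by move=> *; exact: Blin.
have := congr1 (fun X : 'rV[R]_n => X 0 j) rc; rewrite !mxE => ->.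
by apply: eq_bigr => i _; rewrite mxE.
Qed.

End petrov_galerkin.

(** * The formulation on a mesh *)

Section broken_operators.
Context {R : realType} {d p q r s : nat}.
Variable D : ('rV[R]_d -> 'M[R]_(r, s)) -> 'rV[R]_d -> 'M[R]_(p, q).
Hypothesis hD : forall w Phi, test w Phi -> test w (D Phi).
Implicit Types (w : set 'rV[R]_d) (v : 'rV[R]_d -> 'M[R]_(p, q))
  (G : 'rV[R]_d -> 'M[R]_(r, s)).

(** Unfolds to [gradcurl] and to [curlstargradstar] for the two choices of [D]. *)
Definition weak_rep w v : 'rV[R]_d -> 'M[R]_(r, s) := xget (fun=> 0) (is_weak D w v).

Lemma weak_repP w v G : is_weak D w v G -> is_weak D w v (weak_rep w v).
Proof. by move=> h; apply: xgetPex; exists G. Qed.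

Lemma weak_rep_ae w v G : open w -> (leb d w < +oo)%E -> is_weak D w v G ->
  aeeq w (weak_rep w v) G.
Proof. by move=> ow fw h; exact: weak_unique (weak_repP h) h. Qed.

Variables (Omega : set 'rV[R]_d) (N : nat) (T : 'I_N -> set 'rV[R]_d).
Hypotheses (oO : open Omega) (fO : (leb d Omega < +oo)%E).
Hypotheses (oT : forall i, open (T i)) (sT : forall i, T i `<=` Omega).
Hypothesis dT : forall i j, i != j -> T i `&` T j = set0.
Hypothesis nT : (leb d).-negligible (Omega `\` \bigcup_i T i).

Let mO : measurable Omega. Proof. exact: open_rV_measurable. Qed.
Let mT i : measurable (T i). Proof. exact: open_rV_measurable. Qed.
Let fT i : (leb d (T i) < +oo)%E.
Proof. by apply: le_lt_trans fO; apply: le_measure; rewrite ?inE. Qed.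

(** A single field on the whole domain holds the derivatives on all elements; its values on the
    skeleton are arbitrary. *)
Definition broken v G : Prop :=
  [/\ L2 Omega v, L2 Omega G & forall i, is_weak D (T i) v G].

Lemma weak_broken v G : L2 Omega v -> is_weak D Omega v G -> broken v G.
Proof.
move=> hv hG; have [LG _] := hG; split => // i.
exact: (weak_restrict hD mO (mT i) (@sT i)).
Qed.

Lemma weak_zero w : measurable w -> is_weak D w 0 0.
Proof.
move=> mw; have s1 := @semi_ip_L2 R d r s w mw; have s2 := @semi_ip_L2 R d p q w mw.
split; first exact: sip0 s1.
move=> Phi tP; rewrite (sip0l s1) ?(sip0l s2)//; first exact: test_L2 (hD tP).
exact: test_L2.
Qed.

Lemma broken_lin : lin_rel broken.
Proof.
have s1 := @semi_ip_L2 R d r s Omega mO; have s2 := @semi_ip_L2 R d p q Omega mO.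
split; first by split; [exact: sip0 s2|exact: sip0 s1|move=> i; exact: weak_zero].
move=> k v G v' G' [hv hG vG] [hv' hG' vG']; split.
- exact: (sipL s2).
- exact: (sipL s1).
- move=> i; apply: weak_lin => //; exact: (L2S mO).
Qed.

(** Nonnegativity of the squared norm of [F - cut w' F]. *)
Lemma ip_mono p' q' w w' (F : 'rV[R]_d -> 'M[R]_(p', q')) : measurable w ->
  measurable w' -> w' `<=` w -> L2 w F -> ip w' F F <= ip w F F.
Proof.
move=> mw mw' ww' hF; have S := @semi_ip_L2 R d p' q' w mw.
have hc : L2 w (cut w' F) by apply: L2_cut => //; exact: (L2S mw).
have hd : L2 w (F - cut w' F) by exact: (sipB S).
have e1 : ip w (cut w' F) (cut w' F) = ip w' F F.
  rewrite -(@ip_cut _ _ _ _ w w')//.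
  by apply: eq_ip => // x wx; rewrite cut_in.
have e2 : ip w F (cut w' F) = ip w' F F by rewrite -ip_cut.
have := sip_ge0 S hd; rewrite (sipBl S)// !(sipBr S)// (sipC S hc hF) e1 e2.
lra.
Qed.

Lemma broken_closed : closed_rel (@L2 R d p q Omega) (ip Omega)
  (@L2 R d r s Omega) (ip Omega) broken.
Proof.
have s1 := @semi_ip_L2 R d r s Omega mO; have s2 := @semi_ip_L2 R d p q Omega mO.
move=> v G hv hG h; split => // i; apply: weak_closed => //; try exact: (L2S mO).
move=> e /h[v' [G' [[hv' hG' vG'] h1 h2]]]; exists v', G'; split => //.
- exact: (L2S mO).
- apply: le_lt_trans h1; apply: ip_mono => //; exact: (sipB s2).
- apply: le_lt_trans h2; apply: ip_mono => //; exact: (sipB s1).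
Qed.

Lemma sum_ip p' q' (F H : 'rV[R]_d -> 'M[R]_(p', q')) : L2 Omega F -> L2 Omega H ->
  \sum_i ip (T i) F H = ip Omega F H.
Proof. exact: ip_partition. Qed.

Lemma ip_broken v G H i : broken v G -> L2 Omega H ->
  ip (T i) (weak_rep (T i) v) H = ip (T i) G H.
Proof.
move=> [_ hG vG] hH; have h := vG i; have [h1 _] := weak_repP h.
apply: ip_ae => //; try exact: (L2S mO).
exact: weak_rep_ae.
Qed.

Lemma ip_broken2 v G v' G' i : broken v G -> broken v' G' ->
  ip (T i) (weak_rep (T i) v) (weak_rep (T i) v') = ip (T i) G G'.
Proof.
move=> vG [_ hG' vG']; have h := vG' i; have [h1 _] := weak_repP h.
have [_ hG vGi] := vG; have [h2 _] := weak_repP (vGi i).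
have S := @semi_ip_L2 R d r s (T i) (mT i).
rewrite (sipC S)// (ip_ae (mT i) h1 (L2S mO (mT i) (@sT i) hG') h2)//.
  by rewrite (sipC S (L2S mO (mT i) (@sT i) hG') h2) (ip_broken i vG hG').
exact: weak_rep_ae.
Qed.

(** The chosen derivatives are extended by zero and added; disjointness leaves only the [i]-th one
    on [T i]. *)
Lemma broken_exists v : L2 Omega v -> (forall i, exists G, is_weak D (T i) v G) ->
  broken v (\sum_i cut (T i) (weak_rep (T i) v)).
Proof.
move=> hv h; have S := @semi_ip_L2 R d r s Omega mO.
have hi i : is_weak D (T i) v (weak_rep (T i) v) by have [G /weak_repP] := h i.
have hL : L2 Omega (\sum_i cut (T i) (weak_rep (T i) v)).
  elim/big_ind: _ => [|F G|i _]; [exact: sip0 S|exact: (sipD S)|].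
  by apply: L2_cut => //; have [] := hi i.
split => // i; apply: (weak_ae_r (mT i) _ _ (hi i)); first exact: (L2S mO).
apply: aeW => x Tx; rewrite fct_sumE (bigD1 i)//= cut_in// big1 ?addr0// => j ji.
rewrite cut_out// => Tj; have := dT ji.
by move=> /seteqP[/(_ x)] /(_ (conj Tj Tx)).
Qed.

End broken_operators.

Section trace_free_fields.
Context {R : realType} {d : nat}.
Implicit Types (w : set 'rV[R]_d) (F G : tfield R d).

Lemma L2perp_lin w : measurable w ->
  L2perp w (0 : tfield R d) /\
  forall k F G, L2perp w F -> L2perp w G -> L2perp w (k *: F + G).
Proof.
move=> mw; have S := @semi_ip_L2 R d d d w mw; split.
  by split; [exact: sip0 S|apply: aeW => x _; exact: mxtrace0].
move=> k F G [hF tF] [hG tG]; split; first exact: (sipL S).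
apply: filterS2 tF tG => x /= hF' hG' wx.
transitivity (\tr (k *: F x + G x)) => //.
by rewrite mxtraceD mxtraceZ hF'// hG'// mulr0 addr0.
Qed.

Lemma semi_ip_L2perp w : measurable w -> semi_ip (@L2perp R d w) (ip w).
Proof.
move=> mw; have S := @semi_ip_L2 R d d d w mw; have [L0 LL] := L2perp_lin mw.
split => //.
- by move=> x y [hx _] [hy _]; exact: (sipC S).
- by move=> k x y z [hx _] [hy _] [hz _]; exact: (sip_linear S).
- by move=> x [hx _]; exact: (sip_ge0 S).
Qed.

Lemma L2perp_closed w G : open w -> (leb d w < +oo)%E -> L2 w G ->
  (forall e : R, 0 < e -> exists2 F, L2perp w F & ip w (F - G) (F - G) < e) ->
  L2perp w G.
Proof.
move=> ow fw hG h; split => //; apply/(trace_freeP ow fw hG) => n a b abw.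
have mw := open_rV_measurable ow; have S := @semi_ip_L2 R d d d w mw.
set B := fun x => _.
have hB : L2 w B by apply: test_L2 => //; exact: test_bump.
apply: (@sqr_small_eq0 _ _ (ip w B B)) => e /h[F [hF tF] FG].
have F0 : ip w F B = 0 by have /(trace_freeP ow fw hF) := tF; apply.
have hFG : L2 w (F - G) by exact: (sipB S).
have -> : ip w G B ^+ 2 = ip w (F - G) B ^+ 2 by rewrite (sipBl S)// F0 sub0r sqrrN.
apply: le_trans (cauchy_schwarz S hFG hB) _.
by rewrite ler_wpM2r ?(sip_ge0 S)// ltW.
Qed.

Lemma complete_L2perp w : open w -> (leb d w < +oo)%E ->
  complete_ip (@L2perp R d w) (ip w).
Proof.
move=> ow fw u Su uC; have mw := open_rV_measurable ow.
have [|G hG GP] := @complete_ip_L2 R d d d w mw fw u _ uC.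
  by move=> n; have [] := Su n.
exists G => //; apply: L2perp_closed => // e /GP[N NP]; exists (u N) => //.
exact: NP.
Qed.

End trace_free_fields.

Lemma poincare_gradcurl (R : realType) d (w : set 'rV[R]_d) M (phi : bfield R d) :
  d = 2%N -> measurable w -> w `<=` cube d M -> test w phi ->
  ip w phi phi <= (2 * M) ^+ 2 * (2 * M) ^+ 2 * ip w (grad (curl phi)) (grad (curl phi)).
Proof. by move=> d2; rewrite -mulrA; subst d; exact: poincare2. Qed.

(** * The operators on the domain as a closure and an adjoint *)

Section domain.
Context {R : realType} {d : nat}.
Hypothesis hd : d = 2%N \/ d = 3%N.
Variable Omega : set 'rV[R]_d.
Hypotheses (oO : open Omega) (fO : (leb d Omega < +oo)%E).

Let mO : measurable Omega. Proof. exact: open_rV_measurable. Qed.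

Let hD1 w (Phi : tfield R d) : test w Phi -> test w (curlstar (gradstar Phi)).
Proof. exact: test_curlstargradstar. Qed.

Let hD2 w (phi : bfield R d) : test w phi -> test w (grad (curl phi)).
Proof. exact: test_gradcurl. Qed.

Definition test_rel (v : bfield R d) (g : tfield R d) : Prop :=
  test Omega v /\ is_gradcurl Omega v g.

Local Notation SE := (@L2 R d 1 (ncomp d) Omega).
Local Notation SP := (@L2perp R d Omega).
Local Notation HO := (rel_closure SE (ip Omega) SP (ip Omega) test_rel).
Local Notation CO := (rel_adjoint SE (ip Omega) SP (ip Omega) test_rel).

Let hE : semi_ip SE (ip Omega). Proof. exact: semi_ip_L2. Qed.
Let hF : semi_ip SP (ip Omega). Proof. exact: semi_ip_L2perp. Qed.
Let hL : semi_ip (@L2 R d d d Omega) (ip Omega). Proof. exact: semi_ip_L2. Qed.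

Lemma gradcurl_L2perp v G : is_gradcurl Omega v G -> SP G.
Proof. by move=> h; split; [case: h|exact: is_gradcurl_trace h]. Qed.

Lemma test_gradcurlP v : test Omega v -> is_gradcurl Omega v (grad (curl v)).
Proof.
move=> tv; split; first by apply: test_L2 => //; exact: hD2.
by move=> Phi tP; exact: ip_gradcurl.
Qed.

Lemma test_rel_lin : lin_rel test_rel.
Proof.
split; first by split; [exact: test0|exact: weak_zero].
move=> k v g v' g' [tv vg] [tv' vg']; split; first exact: test_lin.
by apply: (weak_lin hD1) => //; exact: test_L2.
Qed.

Lemma test_rel_sub v g : test_rel v g -> SE v /\ SP g.
Proof. by move=> [tv vg]; split; [exact: test_L2|exact: gradcurl_L2perp vg]. Qed.

(** The constant comes from [gamma] alone if [d = 3] and from a cube containing the domain if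
    [d = 2], where [gamma] may vanish; no mesh is involved. *)
Lemma test_rel_coercive (gamma : R) : bounded_set Omega -> 0 <= gamma ->
  (d = 3%N -> 0 < gamma) -> exists2 k : R, 0 < k & forall v g, test_rel v g ->
    k * (ip Omega v v + ip Omega g g) <= gamma * ip Omega v v + ip Omega g g.
Proof.
move=> bO g0 g3.
have pos v g : test_rel v g -> 0 <= ip Omega v v /\ 0 <= ip Omega g g.
  move=> vg; have [hv [hg _]] := test_rel_sub vg.
  by split; [exact: (sip_ge0 hE)|exact: (sip_ge0 hL)].
have [e|e] := hd; last first.
  have gp := g3 e; exists (Num.min gamma 1); first by rewrite lt_min gp ltr01.
  move=> v g /pos[p1 p2].
  have h1 : Num.min gamma 1 * ip Omega v v <= gamma * ip Omega v v.
    by rewrite ler_wpM2r// ge_min lexx.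
  have h2 : Num.min gamma 1 * ip Omega g g <= 1 * ip Omega g g.
    by rewrite ler_wpM2r// ge_min lexx orbT.
  lra.
have [M OM] := bounded_cube bO.
pose K : R := (2 * M) ^+ 2 * (2 * M) ^+ 2.
have K0 : 0 <= K by rewrite mulr_ge0// sqr_ge0.
have poin v g : test_rel v g -> ip Omega v v <= K * ip Omega g g.
  move=> [tv vg]; have [hg _] := vg.
  have wg := test_gradcurlP tv; have [hg' _] := wg.
  have ae := weak_unique oO fO vg wg.
  rewrite (ip_ae mO hg hg' hg ae) (sipC hL hg' hg) (ip_ae mO hg hg' hg' ae).
  exact: poincare_gradcurl.
exists (1 + K)^-1; first by rewrite invr_gt0 ltr_wpDr.
move=> v g vg; have [p1 p2] := pos _ _ vg; have h := poin _ _ vg.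
rewrite mulrC ler_pdivrMr; last by rewrite ltr_wpDr.
have h1 := mulr_ge0 g0 p1; have h2 := mulr_ge0 h1 K0.
have -> : (gamma * ip Omega v v + ip Omega g g) * (1 + K) =
  gamma * ip Omega v v + gamma * ip Omega v v * K + ip Omega g g + K * ip Omega g g by ring.
lra.
Qed.

Lemma closure_gradcurl v g : HO v g -> is_gradcurl Omega v g.
Proof.
move=> [hv [hg _] h]; apply: (weak_closed hD1) => // e /h[x [y [[tx xy] h1 h2]]].
by exists x, y; split => //; exact: test_L2.
Qed.

(** The distributional definition tests with classical derivatives, the adjoint with all weak ones;
    uniqueness of weak derivatives identifies the two. *)
Lemma adjointP Q c : CO Q c <-> SP Q /\ is_curlstargradstar Omega Q c.
Proof.
split=> [[hQ hc h]|[hQ [hc h]]].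
  split=> //; split=> // phi tphi.
  rewrite (sipC hE)//; last exact: test_L2.
  rewrite -(h phi (grad (curl phi))); last by split => //; exact: test_gradcurlP.
  apply: (sipC hF) => //; exact: gradcurl_L2perp (test_gradcurlP tphi).
split => // x y [tx xy].
have Lx : SE x by exact: test_L2.
rewrite (sipC hE)// h//.
have [hy _] := xy; have tg := hD2 tx; have [LQ _] := hQ.
have Lg : L2 Omega (grad (curl x)) by exact: test_L2.
rewrite (sipC hL LQ Lg); apply: ip_ae => //.
exact: weak_unique xy (test_gradcurlP tx).
Qed.

Lemma Hgc_normE v g : SE v -> is_gradcurl Omega v g ->
  Hgc_norm Omega v = Num.sqrt (ip Omega v v + ip Omega g g).
Proof.
move=> hv vg; have [hg _] := vg; have [h1 _] := weak_repP vg.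
rewrite /Hgc_norm /L2norm !sqr_sqrtr; last 2 first.
- exact: (sip_ge0 hL).
- exact: (sip_ge0 hE).
congr (Num.sqrt (_ + _)).
have e := weak_rep_ae oO fO vg.
by rewrite (ip_ae mO h1 hg h1 e) (sipC hL hg h1) (ip_ae mO h1 hg hg e).
Qed.

Lemma Hcg_normE Q c : SP Q -> is_curlstargradstar Omega Q c ->
  Hcg_norm Omega Q = Num.sqrt (ip Omega Q Q + ip Omega c c).
Proof.
move=> hQ vg; have [hg _] := vg; have [h1 _] := weak_repP vg.
rewrite /Hcg_norm /L2norm !sqr_sqrtr; last 2 first.
- exact: (sip_ge0 hE).
- exact: (sip_ge0 hF).
congr (Num.sqrt (_ + _)).
have e := weak_rep_ae oO fO vg.
by rewrite (ip_ae mO h1 hg h1 e) (sipC hE hg h1) (ip_ae mO h1 hg hg e).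
Qed.

Lemma Hgc0P v : Hgc0 Omega v <-> exists g, HO v g.
Proof.
split=> [[[hv [G0 vG0]] h]|[g HOvg]].
  have vG := weak_repP vG0; exists (gradcurl Omega v).
  split=> //; first exact: gradcurl_L2perp vG.
  move=> e e0; have [|phi tphi] := h (Num.sqrt e); first by rewrite sqrtr_gt0.
  have hphi : SE phi by exact: test_L2.
  have pg := test_gradcurlP tphi.
  have [_ lin] := @test_rel_lin.
  have vpg : is_gradcurl Omega (v - phi) (gradcurl Omega v - grad (curl phi)).
    have := weak_lin hD1 (-1) mO hphi hv pg vG.
    by rewrite !scaleN1r addrC [- grad _ + _]addrC.
  rewrite (Hgc_normE _ vpg); last exact: (sipB hE).
  rewrite ltr_sqrt// => hlt.
  have [hG _] := vG; have [hpg _] := pg.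
  have Sd := sipB hE hv hphi; have Sd' := sipB hL hG hpg.
  exists phi, (grad (curl phi)); split; first by split.
    rewrite (sip_distC hE)//.
    by apply: le_lt_trans hlt; rewrite lerDl (sip_ge0 hL).
  rewrite (sip_distC hL)//.
  by apply: le_lt_trans hlt; rewrite lerDr (sip_ge0 hE).
have vg := closure_gradcurl HOvg; have [hv [hg _] h] := HOvg.
split; first by split => //; exists g.
(* Squared because the graph norm is a square root, halved to share it between field and
   derivative. *)
move=> e e0; have e2 : 0 < e ^+ 2 / 2 by rewrite divr_gt0// exprn_gt0.
have [phi [y [[tphi py] h1 h2]]] := h _ e2.
have hphi : SE phi by exact: test_L2.
have [hy _] := py.
have vpg : is_gradcurl Omega (v - phi) (g - y).
  have := weak_lin hD1 (-1) mO hphi hv py vg.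
  by rewrite !scaleN1r addrC [- y + _]addrC.
exists phi => //; rewrite (Hgc_normE _ vpg); last exact: (sipB hE).
rewrite -(ger0_norm (ltW e0)) -sqrtr_sqr ltr_sqrt ?exprn_gt0//.
rewrite (sip_distC hE)// (sip_distC hL)//; lra.
Qed.

(** * Broken spaces, traces and the formulation on a fixed mesh *)

Section on_mesh.
Variables (N : nat) (T : 'I_N -> set 'rV[R]_d).
Hypotheses (oT : forall i, open (T i)) (sT : forall i, T i `<=` Omega).
Hypothesis dT : forall i j, i != j -> T i `&` T j = set0.
Hypothesis nT : (leb d).-negligible (Omega `\` \bigcup_i T i).

Let mT i : measurable (T i). Proof. exact: open_rV_measurable. Qed.
Let fT i : (leb d (T i) < +oo)%E.
Proof. by apply: le_lt_trans fO; apply: le_measure; rewrite ?inE. Qed.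

Definition broken_gradcurl : bfield R d -> tfield R d -> Prop :=
  broken (fun Phi : tfield R d => curlstar (gradstar Phi)) Omega T.

Definition broken_curlstar : tfield R d -> bfield R d -> Prop :=
  broken (fun phi : bfield R d => grad (curl phi)) Omega T.

Local Notation GT := broken_gradcurl.

Definition broken_curlstar_perp (Q : tfield R d) (c : bfield R d) : Prop :=
  SP Q /\ broken_curlstar Q c.

Local Notation CT := broken_curlstar_perp.

(** Weak derivatives are trace free on each element, and almost every point of the domain is in an
    element. *)
Lemma broken_gradcurl_sub v g : GT v g -> SE v /\ SP g.
Proof.
move=> [hv hg vg]; split => //; split => //.
have hi : {ae leb d, forall x, forall i, T i x -> \tr (g x) = 0}.
  by apply: filter_forall => i; exact: (is_gradcurl_trace hd (@oT i) (fT i) (vg i)).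
have hn : {ae leb d, forall x, Omega x -> exists i, T i x}.
  apply: negligibleS nT => x /= /not_implyP[Ox nx]; split => // -[i _ Tx].
  by apply: nx; exists i.
by apply: filterS2 hi hn => x h1 h2 /h2[i /h1].
Qed.

Lemma broken_gradcurl_lin : lin_rel GT.
Proof. exact: (broken_lin hD1). Qed.

Lemma broken_gradcurl_closed : closed_rel SE (ip Omega) SP (ip Omega) GT.
Proof. by move=> v g hv [hg _]; exact: (broken_closed hD1). Qed.

Lemma broken_curlstar_perp_sub Q c : CT Q c -> SP Q /\ SE c.
Proof. by move=> [hQ [_ hc _]]. Qed.

Lemma broken_curlstar_perp_lin : lin_rel CT.
Proof.
have [B0 BL] : lin_rel broken_curlstar by exact: (broken_lin hD2).
split; first by split => //; exact: sip0 hF.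
move=> k Q c Q' c' [? ?] [? ?]; split; first exact: (sipL hF).
exact: BL.
Qed.

Lemma broken_curlstar_perp_closed : closed_rel SP (ip Omega) SE (ip Omega) CT.
Proof.
move=> Q c hQ hc h; split => //; have [LQ _] := hQ.
apply: (broken_closed hD2) => // e /h[Q' [c' [[_ h1] h2 h3]]].
by exists Q', c'.
Qed.

Lemma closure_broken v g : HO v g -> GT v g.
Proof.
move=> HOvg; have [hv _ _] := HOvg.
by apply: (weak_broken hD1) => //; exact: closure_gradcurl.
Qed.

Lemma adjoint_broken Q c : CO Q c -> CT Q c.
Proof.
move=> /adjointP[hQ Qc]; split => //; have [LQ _] := hQ.
exact: (weak_broken hD2).
Qed.

Lemma Hgc_meshP v : Hgc_mesh Omega T v <-> exists g, GT v g.
Proof.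
split=> [[hv h]|[g [hv hg vg]]].
  exists (\sum_i cut (T i) (weak_rep (fun Phi : tfield R d => curlstar (gradstar Phi)) (T i) v)).
  by apply: broken_exists => // i; have [] := h i.
split=> // i; split; first exact: (L2S mO).
by exists g; exact: vg.
Qed.

Lemma Hcg_meshP Q : Hcg_mesh Omega T Q <-> exists c, CT Q c.
Proof.
split=> [[hQ h]|[c [hQ [LQ hc Qc]]]].
  exists (\sum_i cut (T i) (weak_rep (fun phi : bfield R d => grad (curl phi)) (T i) Q)).
  split => //; apply: broken_exists => //; first by case: hQ.
  by move=> i; have [] := h i.
split=> // i; split; last by exists c; exact: Qc.
split; first exact: (L2S mO).
by case: hQ => _; apply: filterS => x h /(@sT i).
Qed.

Lemma trE v g Q c : SE v -> is_gradcurl Omega v g -> CT Q c ->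
  tr Omega T v Q = ip Omega g Q - ip Omega v c.
Proof.
move=> hv vg [[LQ _] Qc]; have [hg _] := vg; have [h1 _] := weak_repP vg.
rewrite /tr (ip_ae mO h1 hg LQ (weak_rep_ae oO fO vg)); congr (_ - _).
have [_ hc _] := Qc.
rewrite -(sum_ip oO oT sT dT nT hv hc); apply: eq_bigr => i _.
have hvi : L2 (T i) v by exact: (L2S mO).
have hci : L2 (T i) c by exact: (L2S mO).
have [_ _ /(_ i) /weak_repP [hri _]] := Qc.
have S := @semi_ip_L2 R d 1 (ncomp d) (T i) (mT i).
by rewrite (sipC S)// (ip_broken oO fO oT sT i Qc hv) (sipC S).
Qed.

Lemma trstarE Q c v g : SP Q -> is_curlstargradstar Omega Q c -> GT v g ->
  trstar Omega T Q v = ip Omega g Q - ip Omega v c.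
Proof.
move=> [LQ _] Qc vg; have [hv hg _] := vg; have [hc _] := Qc.
have [h1 _] := weak_repP Qc.
rewrite /trstar; congr (_ - _).
  rewrite -(sum_ip oO oT sT dT nT hg LQ); apply: eq_bigr => i _.
  exact: (ip_broken oO fO oT sT i vg LQ).
by rewrite (sipC hE hv h1) (ip_ae mO h1 hc hv (weak_rep_ae oO fO Qc)) (sipC hE).
Qed.

Local Notation is_trace := (is_trace (ip Omega) (ip Omega) CT).
Local Notation is_trace_star := (is_trace_star (ip Omega) (ip Omega) GT).

Lemma is_traceP v g uh : SE v -> is_gradcurl Omega v g ->
  is_trace v g uh <-> eq_Hcg_dual Omega T (tr Omega T v) uh.
Proof.
move=> hv vg; split=> [h Q /Hcg_meshP[c Qc]|h Q c Qc].
  by rewrite (trE hv vg Qc) (h _ _ Qc).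
by rewrite -(trE hv vg Qc) h//; apply/Hcg_meshP; exists c.
Qed.

Lemma is_trace_starP Q c ph : SP Q -> is_curlstargradstar Omega Q c ->
  is_trace_star Q c ph <-> eq_Hgc_dual Omega T (trstar Omega T Q) ph.
Proof.
move=> hQ Qc; split=> [h v /Hgc_meshP[g vg]|h v g vg].
  by rewrite (trstarE hQ Qc vg) (h _ _ vg).
by rewrite -(trstarE hQ Qc vg) h//; apply/Hgc_meshP; exists g.
Qed.

Local Notation trace0_rel := (trace0_rel SE (ip Omega) SP (ip Omega) test_rel CT).
Local Notation trace_star_rel := (trace_star_rel SE (ip Omega) SP (ip Omega) test_rel GT).

Lemma trace_space0P uh : trace_space0 Omega T uh <-> trace0_rel uh.
Proof.
split=> [[v /Hgc0P[g vg] h]|[v [g [vg h]]]].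
  exists v, g; split => //; have [hv _ _] := vg.
  by apply/is_traceP => //; exact: closure_gradcurl.
exists v; first by apply/Hgc0P; exists g.
have [hv _ _] := vg; by apply/(is_traceP _ hv (closure_gradcurl vg)).
Qed.

Lemma trace_space_starP ph : trace_space_star Omega T ph <-> trace_star_rel ph.
Proof.
split=> [[Q [hQ [c Qc]] h]|[Q [c [/adjointP[hQ Qc] h]]]].
  exists Q, c; split; first by apply/adjointP.
  exact/is_trace_starP.
exists Q; first by split => //; exists c.
exact/(is_trace_starP _ hQ Qc).
Qed.

(** The empty set matters: a functional that is no trace has no representatives, and its norm is
    then the default infimum 0. *)
Lemma inf_nonneg_ge0 (A : set R) : (forall x, A x -> 0 <= x) -> 0 <= inf A.
Proof.
move=> A0; have [A1|/set0P/negP/negPn/eqP->] := pselect (A !=set0); last by rewrite inf0.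
exact: lb_le_inf.
Qed.

Lemma norm_inf_ge0 uh : 0 <= norm_inf Omega T uh.
Proof. by apply: inf_nonneg_ge0 => x [v _ <-]; exact: sqrtr_ge0. Qed.

Lemma norm_inf_star_ge0 ph : 0 <= norm_inf_star Omega T ph.
Proof. by apply: inf_nonneg_ge0 => x [v _ <-]; exact: sqrtr_ge0. Qed.

Lemma norm_inf_le v g uh : HO v g -> is_trace v g uh ->
  norm_inf Omega T uh <= Num.sqrt (ip Omega v v + ip Omega g g).
Proof.
move=> vg h; have [hv _ _] := vg; have wg := closure_gradcurl vg.
apply: ge_inf; first by exists 0 => x [y _ <-]; exact: sqrtr_ge0.
exists v; last exact: Hgc_normE.
by split; [split => //; exists g|exact/(is_traceP _ hv wg)].
Qed.

Lemma norm_inf_star_le Q c ph : CO Q c -> is_trace_star Q c ph ->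
  norm_inf_star Omega T ph <= Num.sqrt (ip Omega Q Q + ip Omega c c).
Proof.
move=> /adjointP[hQ Qc] h.
apply: ge_inf; first by exists 0 => x [y _ <-]; exact: sqrtr_ge0.
exists Q; last exact: Hcg_normE.
by split; [split => //; exists c|exact/(is_trace_starP _ hQ Qc)].
Qed.

Lemma inf_mulr_ge (A : set R) (x y : R) : A !=set0 -> 0 <= y ->
  (forall z, A z -> x <= z * y) -> x <= inf A * y.
Proof.
move=> A0 y0 h; have [y00|yn] := eqVneq y 0.
  by have [z Az] := A0; have := h _ Az; rewrite y00 !mulr0.
have yp : 0 < y by rewrite lt_def yn.
rewrite -ler_pdivrMr//; apply: lb_le_inf => // z Az.
by rewrite ler_pdivrMr//; exact: h.
Qed.

(** Cauchy-Schwarz in the product space for [(v, g)] and [(- c, Q)]. *)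
Lemma graph_cs v g Q c : SE v -> SP g -> SP Q -> SE c ->
  `|ip Omega g Q - ip Omega v c| <=
  Num.sqrt (ip Omega v v + ip Omega g g) * Num.sqrt (ip Omega Q Q + ip Omega c c).
Proof.
move=> hv hg hQ hc.
have full : lin_rel (fun x y => SE x /\ SP y).
  split; first by split; [exact: sip0 hE|exact: sip0 hF].
  by move=> k x y x' y' [? ?] [? ?]; split; [exact: (sipL hE)|exact: (sipL hF)].
have S := semi_ip_graph hE hF full (fun x y => id).
have := sip_cs S (conj hv hg : graph_set _ (v, g)) (conj (sipN hE hc) hQ : graph_set _ (- c, Q)).
rewrite /sip_norm /graph_ip/= (sipNl hE) ?(sipNr hE)// ?opprK; last exact: (sipN hE).
by rewrite addrC [ip Omega c c + _]addrC.
Qed.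

(** Every extension, with or without zero boundary values, computes [uh Q] by the trace formula, so
    the estimate holds for each and hence for the infimum. *)
Lemma norm_inf_bound uh Q c : trace0_rel uh -> CT Q c ->
  `|uh Q| <= norm_inf Omega T uh * Num.sqrt (ip Omega Q Q + ip Omega c c).
Proof.
move=> /trace_space0P[v0 [hv0 _] h0] QC; have [hQ hc] := broken_curlstar_perp_sub QC.
apply: inf_mulr_ge; [by exists (Hgc_norm Omega v0), v0|exact: sqrtr_ge0|].
move=> _ [v [[hv [g vg]] h] <-]; rewrite (Hgc_normE hv vg).
have := (is_traceP uh hv vg).2 h; move=> /(_ _ _ QC) ->.
by apply: graph_cs => //; exact: gradcurl_L2perp vg.
Qed.

Lemma norm_inf_star_bound ph v g : trace_star_rel ph -> GT v g ->
  `|ph v| <= norm_inf_star Omega T ph * Num.sqrt (ip Omega v v + ip Omega g g).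
Proof.
move=> /trace_space_starP[Q0 hQ0 h0] VG; have [hv hg] := broken_gradcurl_sub VG.
apply: inf_mulr_ge; [by exists (Hcg_norm Omega Q0), Q0|exact: sqrtr_ge0|].
move=> _ [Q [[hQ [c Qc]] h] <-]; rewrite (Hcg_normE hQ Qc).
have := (is_trace_starP ph hQ Qc).2 h; move=> /(_ _ _ VG) ->.
by rewrite mulrC; apply: graph_cs => //; case: Qc.
Qed.

Local Notation trial := (bfield R d * tfield R d * (tfield R d -> R) * (bfield R d -> R))%type.
Local Notation SU := (trial_set SE (ip Omega) SP (ip Omega) test_rel GT CT).
Local Notation nU := (trial_norm (ip Omega) (ip Omega) (norm_inf Omega T) (norm_inf_star Omega T)).
Local Notation SV := (test_set GT CT).
Local Notation dtest := ((bfield R d * tfield R d) * (tfield R d * bfield R d))%type.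

Lemma in_UP (w : trial) : in_U Omega T w <-> SU w.
Proof.
by move: w => [[[u P] uh] ph]; split=> -[/= ? ? /trace_space0P ? /trace_space_starP ?].
Qed.

Lemma normUE (w : trial) : SU w -> normU Omega T w = nU w.
Proof.
move: w => [[[u P] uh] ph] [/= hu hP _ _]; rewrite /normU /trial_norm/= /L2norm.
by rewrite !sqr_sqrtr//; [exact: (sip_ge0 hF)|exact: (sip_ge0 hE)].
Qed.

Definition components (z : dtest) : bfield R d * tfield R d := (z.1.1, z.2.1).

Lemma in_VP t : in_V Omega T t <-> exists2 z, SV z & components z = t.
Proof.
move: t => [v Q]; split=> [[/= /Hgc_meshP[g vg] /Hcg_meshP[c Qc]]|].
  by exists ((v, g), (Q, c)).
move=> [[[v' g] [Q' c]] [/= G1 C1] [<- <-]]; split => /=.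
  by apply/Hgc_meshP; exists g.
by apply/Hcg_meshP; exists c.
Qed.

Lemma ipVE z z' : SV z -> SV z' ->
  ipV T (components z) (components z') = test_ip (ip Omega) (ip Omega) z z'.
Proof.
move: z z' => [[v g] [Q c]] [[v' g'] [Q' c']] [/= G1 C1] [/= G2 C2].
rewrite /graph_set/= in G1 C1 G2 C2.
have [hv [hg _]] := broken_gradcurl_sub G1.
have [hv' [hg' _]] := broken_gradcurl_sub G2.
have [[hQ _] hc] := broken_curlstar_perp_sub C1.
have [[hQ' _] hc'] := broken_curlstar_perp_sub C2.
rewrite /test_ip /graph_ip /= !big_split/=; congr (_ + _ + (_ + _)).
- exact: (sum_ip oO oT sT dT nT).
- rewrite -(sum_ip oO oT sT dT nT hg hg'); apply: eq_bigr => i _.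
  exact: (ip_broken2 oO fO oT sT i G1 G2).
- exact: (sum_ip oO oT sT dT nT).
- rewrite -(sum_ip oO oT sT dT nT hc hc'); apply: eq_bigr => i _.
  exact: (ip_broken2 oO fO oT sT i C1.2 C2.2).
Qed.

Lemma bformE gamma w z : SU w -> SV z ->
  bform T gamma w (components z) = uw_form (ip Omega) (ip Omega) gamma w z.
Proof.
move: w z => [[[u P] uh] ph] [[v g] [Q c]] [/= hu hP _ _] [/= G1 C1].
rewrite /graph_set/= in G1 C1.
have [hv [hg _]] := broken_gradcurl_sub G1.
have [[hQ _] hc] := broken_curlstar_perp_sub C1.
have [LP _] := hP.
rewrite /bform /uw_form/=; congr (_ + _ + _ + _).
- have hs : SE (gamma *: v + c) by exact: (sipL hE).
  rewrite -(sum_ip oO oT sT dT nT hu hs); apply: eq_bigr => i _.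
  have S := @semi_ip_L2 R d 1 (ncomp d) (T i) (mT i).
  have ui : L2 (T i) u by exact: (L2S mO).
  have vi : L2 (T i) (gamma *: v) by apply: (sipZ S); exact: (L2S mO).
  have ci : L2 (T i) c by exact: (L2S mO).
  have [_ _ /(_ i) /weak_repP [ri _]] := C1.2.
  rewrite (sipDr S vi ci ui) [LHS](sipDr S vi ri ui); congr (_ + _).
  by rewrite (sipC S ui ri) (sipC S ui ci); exact: (ip_broken oO fO oT sT i C1.2 hu).
- have hs : L2 Omega (Q - g) by exact: (sipB hL).
  rewrite -(sum_ip oO oT sT dT nT LP hs); apply: eq_bigr => i _.
  have S := @semi_ip_L2 R d d d (T i) (mT i).
  have Pi : L2 (T i) P by exact: (L2S mO).
  have Qi : L2 (T i) Q by exact: (L2S mO).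
  have gi : L2 (T i) g by exact: (L2S mO).
  have [_ _ /(_ i) /weak_repP [ri _]] := G1.
  rewrite (sipBr S Qi gi Pi) [LHS](sipBr S Qi ri Pi); congr (_ - _).
  by rewrite (sipC S Pi ri) (sipC S Pi gi); exact: (ip_broken oO fO oT sT i G1 LP).
Qed.

(** Fields at distance zero agree almost everywhere; for traces the norm bounds show that the
    difference acts as zero on the broken spaces. *)
Lemma eqU_null (w w' : trial) : SU w -> SU w' -> nU (w - w') = 0 -> eqU Omega T w w'.
Proof.
have tl := trial_setL hE hF test_rel_lin test_rel_sub broken_gradcurl_sub broken_curlstar_perp_sub.
move=> Sw Sw' n0.
have SD : SU (w - w') by rewrite -scaleN1r addrC; exact: tl.
move: w w' Sw Sw' n0 SD => [[[u P] uh] ph] [[[u' P'] uh'] ph'] Sw Sw' n0 [/= hu hP hT hS].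
have pu := sip_ge0 hE hu; have pP := sip_ge0 hF hP.
have q1 := sqr_ge0 (norm_inf Omega T (uh - uh')).
have q2 := sqr_ge0 (norm_inf_star Omega T (ph - ph')).
have h : ip Omega (u - u') (u - u') + ip Omega (P - P') (P - P') +
   norm_inf Omega T (uh - uh') ^+ 2 + norm_inf_star Omega T (ph - ph') ^+ 2 <= 0.
  by rewrite -sqrtr_eq0; apply/eqP; exact: n0.
have ae p q (F G : 'rV[R]_d -> 'M[R]_(p, q)) : L2 Omega (F - G) ->
    ip Omega (F - G) (F - G) <= 0 -> aeeq Omega F G.
  move=> hFG h0; have S := @semi_ip_L2 R d p q Omega mO.
  have : aeeq Omega (F - G) 0.
    by apply: ip_eq0 => //; apply/eqP; rewrite eq_le h0 (sip_ge0 S).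
  by apply: filterS => x e Ox; apply/eqP; rewrite -subr_eq0; apply/eqP; exact: (e Ox).
have [LP _] := hP.
have t0 : norm_inf Omega T (uh - uh') = 0.
  by apply/eqP; rewrite -sqrf_eq0 eq_le q1 andbT; lra.
have s0 : norm_inf_star Omega T (ph - ph') = 0.
  by apply/eqP; rewrite -sqrf_eq0 eq_le q2 andbT; lra.
split.
- by apply: ae => //; lra.
- by apply: ae => //; lra.
- move=> Q /Hcg_meshP[c Qc]; have := norm_inf_bound hT Qc.
  by rewrite t0 mul0r normr_le0 subr_eq0 => /eqP.
- move=> v /Hgc_meshP[g vg]; have := norm_inf_star_bound hS vg.
  by rewrite s0 mul0r normr_le0 subr_eq0 => /eqP.
Qed.

Variables (gamma k : R).
Hypotheses (gamma0 : 0 <= gamma) (k0 : 0 < k).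
Hypothesis coer : forall v g, test_rel v g ->
  k * (ip Omega v v + ip Omega g g) <= gamma * ip Omega v v + ip Omega g g.

Local Notation ipv := (test_ip (ip Omega) (ip Omega)).
Local Notation B := (uw_form (ip Omega) (ip Omega) gamma).

Let linA : lin_rel test_rel := test_rel_lin.
Let subA := test_rel_sub.
Let linGT := broken_gradcurl_lin.
Let subGT := broken_gradcurl_sub.
Let linCT := broken_curlstar_perp_lin.
Let subCT := broken_curlstar_perp_sub.
Let clGT := broken_gradcurl_closed.
Let clCT := broken_curlstar_perp_closed.
Let cE : complete_ip SE (ip Omega). Proof. exact: complete_ip_L2. Qed.
Let cF : complete_ip SP (ip Omega). Proof. exact: complete_L2perp. Qed.

Let hV : semi_ip SV ipv.
Proof. exact: (semi_ip_test hE hF linGT subGT linCT subCT). Qed.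

Let SUL : forall c w w', SU w -> SU w' -> SU (c *: w + w').
Proof. exact: trial_setL. Qed.

Let SU0 : SU 0. Proof. exact: trial_set0. Qed.

Let Blin : forall c w w' t, SU w -> SU w' -> SV t ->
  B (c *: w + w') t = c * B w t + B w' t.
Proof. exact: uw_form_trial_lin. Qed.

Let infsup w t : SU w -> SV t -> (forall t', SV t' -> ipv t t' = B w t') ->
  nU w <= uw_const gamma k * sip_norm ipv t.
Proof.
exact: (uw_form_infsup hE hF cE cF linA subA linGT subGT linCT subCT closure_broken
  adjoint_broken gamma0 k0 coer norm_inf_ge0 norm_inf_star_ge0 norm_inf_le norm_inf_star_le).
Qed.

Let bounded w t : SU w -> SV t ->
  `|B w t| <= (gamma + 5) * nU w * sip_norm ipv t.
Proof.
exact: (uw_form_bounded hE hF subGT subCT gamma0 norm_inf_ge0 norm_inf_star_ge0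
  norm_inf_bound norm_inf_star_bound).
Qed.

Let rep w : SU w -> exists2 t, SV t & forall t', SV t' -> ipv t t' = B w t'.
Proof.
exact: (uw_form_riesz hE hF cE cF linGT subGT linCT subCT clGT clCT gamma0
  norm_inf_ge0 norm_inf_star_ge0 norm_inf_bound norm_inf_star_bound).
Qed.

Let nU0 w : 0 <= nU w. Proof. exact: sqrtr_ge0. Qed.

Lemma trial_to_testP w : SU w -> exists2 z, SV z &
  components z = trial_to_test Omega T gamma w /\
  forall t', SV t' -> ipv z t' = B w t'.
Proof.
move=> Sw; have [t St tP] := rep Sw.
have : [set t | in_V Omega T t /\
    forall dt, in_V Omega T dt -> ipV T t dt = bform T gamma w dt] (components t).
  split; first by apply/in_VP; exists t.
  move=> _ /in_VP[z Sz <-].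
  rewrite ipVE// bformE//.
  exact: tP.
move=> h; have [] := xgetPex (0, 0) (ex_intro _ _ h).
rewrite -/(trial_to_test Omega T gamma w).
move=> /in_VP[z Sz zE] zP; exists z => //; split=> // t' St'.
rewrite -ipVE// zE zP.
  exact: bformE.
by apply/in_VP; exists t'.
Qed.

(** [trial_to_test] returns fields without derivatives, whereas the abstract theory acts on pairs;
    the lift adds derivatives to the very same fields. *)
Definition test_lift (w : trial) : dtest := xget 0 [set z | SV z /\
  components z = trial_to_test Omega T gamma w /\
  forall t', SV t' -> ipv z t' = B w t'].

Lemma test_liftP w : SU w -> [/\ SV (test_lift w),
  components (test_lift w) = trial_to_test Omega T gamma w &
  forall t', SV t' -> ipv (test_lift w) t' = B w t'].
Proof.
move=> /trial_to_testP[z Sz [zE zP]].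
suff [? []] : [set z | SV z /\
  components z = trial_to_test Omega T gamma w /\
  forall t', SV t' -> ipv z t' = B w t'] (test_lift w) by [].
by apply: xgetPex; exists z.
Qed.

Variable f : bfield R d.
Hypothesis hf : SE f.

Let l (z : dtest) : R := ip Omega f z.1.1.

Lemma VFP w : VF Omega T gamma f w <-> SU w /\ forall z, SV z -> B w z = l z.
Proof.
split=> [[/in_UP Sw h]|[Sw h]].
  split=> // z Sz; rewrite -bformE// h//.
  by apply/in_VP; exists z.
split; first exact/in_UP.
move=> _ /in_VP[z Sz <-].
by rewrite bformE// h.
Qed.

Lemma load_le z : SV z -> `|l z| <= L2norm Omega f * sip_norm ipv z.
Proof.
move: z => [[v g] [Q c]] [/= G1 C1]; rewrite /graph_set/= in G1 C1.
have [hv hg] := subGT G1; have [hQ hc] := subCT C1.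
apply: le_trans (sip_cs hE hf hv) _; apply: ler_wpM2l; first exact: sqrtr_ge0.
rewrite ler_wsqrtr// /test_ip /graph_ip/=.
have := sip_ge0 hE hv; have := sip_ge0 hF hg; have := sip_ge0 hF hQ.
have := sip_ge0 hE hc; lra.
Qed.

(** The squared norm of the Riesz representative is the load on it, at most the norm of [f] times
    that norm; one factor cancels. *)
Lemma VF_bound w : SU w -> (forall z, SV z -> B w z = l z) ->
  nU w <= uw_const gamma k * L2norm Omega f.
Proof.
move=> Sw h; have [t St tP] := rep Sw.
apply: le_trans (infsup Sw St tP) _.
apply: ler_wpM2l; first by rewrite ltW// uw_const_gt0.
set n := sip_norm _ _; have n0 : 0 <= n by exact: sip_norm_ge0.
have [->|nn] := eqVneq n 0; first exact: sqrtr_ge0.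
have np : 0 < n by rewrite lt_def nn.
rewrite -(ler_pM2r np) -expr2 (sip_norm_sqr hV)// tP// h//.
by apply: le_trans (ler_norm _) _; exact: load_le.
Qed.

Lemma VF_exists : exists u g uh ph, [/\ HO u g, CO (- g) (gamma *: u - f),
  is_trace u g uh,
  is_trace_star (- g) (gamma *: u - f) ph &
  SU (u, - g, uh, ph) /\ forall z, SV z -> B (u, - g, uh, ph) z = l z].
Proof.
have [u [g [ug cg h]]] := uw_solution hE hF cE cF linA subA subGT subCT gamma0 k0 coer hf.
have [hu _ _] := ug; have wg := closure_gradcurl ug.
have /adjointP[hP wP] := cg.
have t1 : is_trace u g (tr Omega T u).
  by apply/is_traceP.
have t2 : is_trace_star (- g) (gamma *: u - f)
    (trstar Omega T (- g)).
  by apply/is_trace_starP.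
exists u, g, (tr Omega T u), (trstar Omega T (- g)); split => //.
exact: h.
Qed.

Lemma VF_uniquely_solvable : uniquely_solvable Omega T (VF Omega T gamma f).
Proof.
split.
  have [u [g [uh [ph [_ _ _ _ h]]]]] := VF_exists.
  by exists (u, - g, uh, ph); apply/VFP.
move=> w w' /VFP[Sw h] /VFP[Sw' h']; apply: eqU_null => //.
apply: (form_eq_null SUL hV nU0 Blin infsup) => // t St.
by rewrite h// h'.
Qed.

(** Uniqueness identifies the given solution with the constructed one, but only almost everywhere
    and on the broken spaces, so each property must be carried across null sets. *)
Lemma VF_regular u P uh ph : VF Omega T gamma f (u, P, uh, ph) ->
  [/\ Hgc0 Omega u,
      aeeq Omega P (- gradcurl Omega u) /\ Hcg Omega P,
      eq_Hcg_dual Omega T (tr Omega T u) uh,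
      eq_Hgc_dual Omega T (trstar Omega T P) ph &
      aeeq Omega (curlstargradstar Omega (gradcurl Omega u) + gamma *: u) f].
Proof.
move=> hw; have [u' [g [uh' [ph' [ug cg t1 t2 h]]]]] := VF_exists.
have hw' : VF Omega T gamma f (u', - g, uh', ph') by apply/VFP.
have [_ uniq] := VF_uniquely_solvable; have [eu eP eT eS] := uniq _ _ hw hw'.
have [/in_UP[/= hu hP _ _] _] := hw.
have [LP _] := hP.
have [hu' hg _] := ug; have [Lg _] := hg.
have HOu : HO u g.
  (* The constructed pair is at distance zero from [(u, g)]. *)
  apply: (rel_closure_closed hE hF subA) => // e e0; exists u', g; split => //.
    have Sd := sipB hE hu' hu.
    rewrite (ip_ae mO Sd (sip0 hE) Sd) ?(sip0l hE)//.
    apply: filterS eu => x e1 Ox; transitivity (u' x - u x) => //.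
    by rewrite (e1 Ox) subrr.
  by rewrite subrr (sip0l hF)//; exact: (sip0 hF).
have wg := closure_gradcurl HOu.
have ge : aeeq Omega (gradcurl Omega u) g by exact: weak_rep_ae.
have /adjointP[_ wc] := cg.
have LNg : L2 Omega (- g) by exact: (sipN hL).
have wP : is_curlstargradstar Omega P (gamma *: u' - f).
  apply: (weak_ae _ mO LNg LP _ wc); first exact: test_gradcurl.
  by apply: filterS eP => x e1 Ox; rewrite e1.
split.
- by apply/Hgc0P; exists g.
- split; last by split => //; exists (gamma *: u' - f).
  apply: filterS2 eP ge => x e1 e2 Ox.
  by rewrite (e1 Ox); transitivity (- (gradcurl Omega u x)) => //; rewrite (e2 Ox).
- have tu : is_trace u g uh.
    move=> Q q Qq; have [SQ Sq] := subCT Qq.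
    rewrite (ip_ae mO hu hu' Sq eu) -(t1 _ _ Qq) eT//.
    by apply/Hcg_meshP; exists q.
  exact/(is_traceP uh hu wg).
- have tP : is_trace_star P (gamma *: u' - f) ph.
    move=> v q vq; have [Sv [Sq _]] := subGT vq.
    rewrite (sipC hL Sq LP) (ip_ae mO LP LNg Sq eP) (sipC hL LNg Sq) -(t2 _ _ vq) eS//.
    by apply/Hgc_meshP; exists q.
  exact/(is_trace_starP ph hP wP).
- have Sc : SE (gamma *: u' - f) by apply: (sipB hE) => //; exact: (sipZ hE).
  have Lgu : L2 Omega (gradcurl Omega u) by have [] := weak_repP wg.
  have w1 : is_curlstargradstar Omega g (f - gamma *: u').
    have := weak_lin (@test_gradcurl R d hd) (-1) mO LNg (sip0 hL) wc
      (weak_zero (@test_gradcurl R d hd) mO).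
    by rewrite !scaleN1r !addr0 opprK opprB.
  have w2 : is_curlstargradstar Omega (gradcurl Omega u) (f - gamma *: u').
    apply: (weak_ae (@test_gradcurl R d hd) mO Lg Lgu _ w1).
    by apply: filterS ge => x e1 Ox; rewrite e1.
  have e2 := weak_rep_ae oO fO w2.
  apply: filterS2 e2 eu => x h1 h2 Ox.
  transitivity (curlstargradstar Omega (gradcurl Omega u) x + gamma *: u x) => //.
  rewrite [curlstargradstar _ _ x](h1 Ox) (h2 Ox).
  by transitivity (f x - gamma *: u' x + gamma *: u' x) => //; rewrite subrK.
Qed.

Variables (n : nat) (e : 'I_n -> trial).
Hypothesis he : forall i, in_U Omega T (e i).

Let Uh : set trial := [set w | exists c : 'I_n -> R, w = \sum_i c i *: e i].

Let Se i : SU (e i). Proof. exact/in_UP. Qed.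

Let sub z : Uh z -> SU z. Proof. exact: (span_sub SU0 SUL Se). Qed.

Let lift_sub w : SU w -> SV (test_lift w) /\
  forall t', SV t' -> ipv (test_lift w) t' = B w t'.
Proof. by move=> /test_liftP[]. Qed.

Let llin c x y : SV x -> SV y -> l (c *: x + y) = c * l x + l y.
Proof.
move: x y => [[v g] [Q q]] [[v' g'] [Q' q']] [/= /subGT[/= hv _] _] [/= /subGT[/= hv' _] _].
by rewrite /l/= (sipDr hE)// ?(sipZr hE)//; exact: (sipZ hE).
Qed.

Lemma DPGP w : DPG Omega T gamma f Uh w <->
  Uh w /\ forall z, Uh z -> B w (test_lift z) = l (test_lift z).
Proof.
split=> [[Uw h]|[Uw h]]; split=> // z Uz.
  have [Sz zE _] := test_liftP (sub Uz).
  rewrite -bformE//; last exact: sub.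
  rewrite zE; transitivity (Lform Omega f (trial_to_test Omega T gamma z)).
    by apply: h; exists z.
  by rewrite -zE.
case: Uz => z' Uz' <-; have [Sz zE _] := test_liftP (sub Uz').
rewrite -zE bformE//; last exact: sub.
exact: h.
Qed.

Lemma DPG_uniquely_solvable : uniquely_solvable Omega T (DPG Omega T gamma f Uh).
Proof.
split.
  have [w Uw h] := galerkin_exists SU0 SUL hV Blin Se lift_sub llin load_le.
  by exists w; apply/DPGP.
move=> w w' /DPGP[Uw h] /DPGP[Uw' h'].
apply: eqU_null; [exact: sub|exact: sub|].
apply: (galerkin_null SU0 SUL nU0 Blin infsup Se lift_sub) => // z Uz.
by rewrite h// h'.
Qed.

Lemma DPG_quasi_optimal w wh : VF Omega T gamma f w -> DPG Omega T gamma f Uh wh ->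
  normU Omega T (w - wh) <= uw_const gamma k * (gamma + 5) *
    inf [set normU Omega T (w - z) | z in Uh].
Proof.
move=> /VFP[Sw h] /DPGP[Uwh h'].
have SB z : SU z -> SU (w - z) by move=> Sz; rewrite -scaleN1r addrC; exact: SUL.
have C0 : 0 <= uw_const gamma k by rewrite ltW// uw_const_gt0.
have C1 : 0 <= gamma + 5 by rewrite addr_ge0.
have E y : Uh y -> normU Omega T (w - y) = nU (w - y).
  by move=> Uy; apply: normUE; apply: SB; exact: sub.
suff key z : Uh z -> normU Omega T (w - wh) <=
    normU Omega T (w - z) * (uw_const gamma k * (gamma + 5)).
  rewrite mulrC; apply: inf_mulr_ge.
  - by exists (normU Omega T (w - wh)), wh.
  - by rewrite mulr_ge0.
  - by move=> _ [z Uz <-]; exact: key.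
move=> Uz; rewrite mulrC (E _ Uz) (E _ Uwh).
apply: (galerkin_quasi_optimal SU0 SUL hV C0 C1 nU0 Blin infsup bounded Se lift_sub) => // y Uy.
by have [Sy _ _] := test_liftP (sub Uy); rewrite h//; exact: h'.
Qed.

End on_mesh.

End domain.

Theorem theorem6 (R : realType) (d : nat) (hd : d = 2%N \/ d = 3%N)
  (Omega : set 'rV[R]_d)
  (hOmega : lipschitz_domain Omega) (hsc : simply_connected Omega)
  (gamma : R) (hgamma : 0 <= gamma) (hgamma3 : d = 3%N -> 0 < gamma) :
  exists2 C : R, 0 < C &
    forall (N : nat) (T : 'I_N -> set 'rV[R]_d), mesh Omega T ->
    forall f : bfield R d, L2 Omega f ->
    forall Uh, finite_dim_subspace Omega T Uh ->
    [/\ uniquely_solvable Omega T (VF Omega T gamma f),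
        uniquely_solvable Omega T (DPG Omega T gamma f Uh) &
        forall u P uh ph wh, let w := (u, P, uh, ph) in
          VF Omega T gamma f w -> DPG Omega T gamma f Uh wh ->
          [/\ normU Omega T w <= C * L2norm Omega f,
              normU Omega T (w - wh)
                <= C * inf [set normU Omega T (w - z) | z in Uh] &
              [/\ Hgc0 Omega u,
                  aeeq Omega P (- gradcurl Omega u) /\ Hcg Omega P,
                  eq_Hcg_dual Omega T (tr Omega T u) uh,
                  eq_Hgc_dual Omega T (trstar Omega T P) ph &
                  aeeq Omega (curlstargradstar Omega (gradcurl Omega u)
                              + gamma *: u) f]]].
Proof.
have [oO _ _ bO _] := hOmega; have mO := open_rV_measurable oO.
have fO := leb_bounded mO bO.
have [k k0 coer] := test_rel_coercive hd oO fO bO hgamma hgamma3.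
have C0 := uw_const_gt0 hgamma k0.
have g5 : 1 <= gamma + 5 by lra.
(* Stability times boundedness, as quasi-optimality needs; since [gamma + 5] is at least 1, the same
   constant serves the a priori bound. *)
exists (uw_const gamma k * (gamma + 5)); first by rewrite mulr_gt0//; lra.
move=> N T hT f hf Uh hUh.
have [n [e [he ->]]] := hUh.
have oT := mesh_open hT; have sT := mesh_sub hOmega hT.
have dT := mesh_disjoint hT; have nT := mesh_negligible hT.
split.
- exact: (VF_uniquely_solvable hd oO fO oT sT dT nT hgamma k0 coer).
- exact: (DPG_uniquely_solvable hd oO fO oT sT dT nT hgamma k0 coer).
move=> u P uh ph wh w hw hwh; split.
- have /(VFP hd oO fO oT sT dT nT)[Sw h] := hw.
  rewrite (normUE oO)//.
  apply: le_trans (VF_bound hd oO fO oT sT dT nT hgamma k0 coer hf Sw h) _.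
  by rewrite ler_wpM2r ?sqrtr_ge0// ler_peMr// ltW.
- exact: (DPG_quasi_optimal hd oO fO oT sT dT nT hgamma k0 coer he hw hwh).
- exact: (VF_regular hd oO fO oT sT dT nT hgamma k0 coer hf hw).
Qed.
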